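(* Let $(S,e)$ be a quasicomplete infinitesimally strictly convex immersed surface in $\mathbb{H}^3$, let $\phi:S\to\partial_\infty\mathbb{H}^3$ denote its asymptotic Gauss map, and let $\omega$ denote the Kulkarni-Pinkall form of the developed Möbius surface $(S,\phi)$. Then, for all $x\in S$, $$e(x)\in\overline{B}(\phi_*\omega(x)).$$
   Context: **Immersed surfaces.** An immersed surface in $\mathbb{H}^3$ is a pair $(S,e)$ with $S$ an oriented surface and $e:S\to\mathbb{H}^3$ a smooth immersion. $N_e:S\to \mathrm{U}\mathbb{H}^3$ (unit tangent bundle) is the positively oriented unit normal. The fundamental forms are $\mathrm{I}_e(\xi,\nu)=\langle De\cdot\xi,De\cdot\nu\rangle$, $\mathrm{II}_e(\xi,\nu)=\langle\nabla_\xi N_e,De\cdot\nu\rangle$, $\mathrm{III}_e(\xi,\nu)=\langle\nabla_\xi N_e,\nabla_\nu N_e\rangle$. $(S,e)$ is infinitesimally strictly convex (ISC) if $\mathrm{II}_e$ is everywhere positive-definite, and quasicomplete if the metric $\mathrm{I}_e+\mathrm{III}_e$ is complete. The horizon map $\mathrm{Hor}:\mathrm{U}\mathbb{H}^3\to\partial_\infty\mathbb{H}^3=\hat{\mathbb{C}}$ sends $\dot\gamma(0)$ to $\lim_{t\to+\infty}\gamma(t)$ for every unit speed geodesic $\gamma$. The asymptotic Gauss map of $e$ is $\phi_e:=\mathrm{Hor}\circ N_e$; when $e$ is ISC it is a local diffeomorphism. The pair $(S,\phi_e)$ is then a developed Möbius surface: $S$ is given the Möbius structure whose charts are the local restrictions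 of $\phi_e$. **Kulkarni-Pinkall form.** For a surface $S$ with local diffeomorphism $\phi:S\to\hat{\mathbb{C}}$, a Möbius disk is a pair $(D,\alpha)$ with $D\subseteq\hat{\mathbb{C}}$ an open round disk and $\alpha:D\to S$ a smooth map with $\phi\circ\alpha=\mathrm{Id}$. Let $(D_i,\alpha_i)_{i\in I}$ be the family of all Möbius disks and $I(x)=\{i: x\in\alpha_i(D_i)\}$. For a disk $D$, $\omega(D)$ is the area form of its hyperbolic (curvature $-1$) metric. The Kulkarni-Pinkall form is $\omega_\phi(x):=\inf_{i\in I(x)}(\phi^*\omega(D_i))(x)\in\Lambda^2T_x^*S$ (these forms are positive multiples of one another, so the infimum makes sense). $\phi_*\omega(x)$ is the corresponding element of $\Lambda^2T^*_{\phi(x)}\partial_\infty\mathbb{H}^3$. **Horoballs.** Given an open horoball $B$ centred at $y\in\partial_\infty\mathbb{H}^3$, let $H$ be an open half-space containing $B$ whose boundary is tangent to $\partial B$ at some point, and let $D=\partial_\infty H$. The form $\omega(D)(y)$ depends only on $B$, is called the asymptotic curvature of $B$, and together with $y$ determines $B$. For a positive $\omega_y\in\Lambda^2T^*_y\partial_\infty\mathbb{H}^3$, $B(\omega_y)$ denotes the open horoball with asymptotic centre $y$ and asymptotic curvature $\omega_y$, and $\overline{B}(\omega_y)$ its closure. By convention $B(0)=\mathbb{H}^3$. *)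

(* Defs.v *)
(* MathComp-Analysis. Hyperbolic space is the hyperboloid in Minkowski space
   'rV[R]_(1 + 3), whose coordinate 0 is the time coordinate; the ideal boundary
   (the Riemann sphere) is the unit sphere of 'rV[R]_3, a point u of which is
   the future light ray through row_mx 1 u. *)
From HB Require Import structures.
From mathcomp Require Import all_boot all_order all_algebra.
From mathcomp Require Import all_classical all_reals all_analysis.
Set Implicit Arguments.
Unset Strict Implicit.
Unset Printing Implicit Defensive.
Import Order.TTheory GRing.Theory Num.Theory numFieldNormedType.Exports.
Local Open Scope classical_set_scope.
Local Open Scope ring_scope.

Definition dot (R : realType) n (u v : 'rV[R]_n) : R :=
  \sum_(i < n) u 0 i * v 0 i.

(* The standard volume form on n-tuples of vectors of R^n. *)
Definition vol (R : realType) n (s : n.-tuple 'rV[R]_n) : R :=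
  \det (\matrix_(i < n) tnth s i).

Section Smoothness.
Context {R : realType} {V W : normedModType R}.

(* Meant for U open: f is k times continuously differentiable on U. *)
Fixpoint Ck (k : nat) (U : set V) (f : V -> W) : Prop :=
  match k with
  | 0%N => forall x, U x -> {for x, continuous f}
  | k'.+1 => (forall x, U x -> differentiable f x) /\
             (forall v, Ck k' U (fun x => 'D_v f x))
  end.

(* f is C^oo on the arbitrary subset A of V: locally, it is the restriction
   of a C^oo function defined on an open subset of V. *)
Definition smooth (A : set V) (f : V -> W) : Prop :=
  forall x, A x -> exists U (F : V -> W),
    [/\ open U, U x, forall k, Ck k U F & forall y, (A `&` U) y -> F y = f y].

End Smoothness.

(* A smooth oriented surface. The atlas is indexed by the points of the surface:
   chart x, with domain chart_dom x and inverse param x, is a chart around x. Charts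
   and their inverses are total functions, with no meaning off chart_dom x and off
   chart x @` chart_dom x respectively. *)
Record oriented_surface (R : realType) := OrientedSurface {
  points :> topologicalType ;
  chart_dom : points -> set points ;
  chart : points -> points -> 'rV[R]_2 ;
  param : points -> 'rV[R]_2 -> points ;
  surface_hausdorff : hausdorff_space points ;
  surface_second_countable : @second_countable points ;
  dom_open : forall x, open (chart_dom x) ;
  dom_center : forall x, chart_dom x x ;
  chart_open : forall x, open (chart x @` chart_dom x) ;
  chartK : forall x y, chart_dom x y -> param x (chart x y) = y ;
  chart_continuous : forall x y, chart_dom x y -> {for y, continuous (chart x)} ;
  param_continuous : forall x q,
    (chart x @` chart_dom x) q -> {for q, continuous (param x)} ;
  transition_smooth : forall x y,
    smooth (chart x @` (chart_dom x `&` chart_dom y)) (chart y \o param x) ;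
  transition_oriented : forall x y q, (chart x @` (chart_dom x `&` chart_dom y)) q ->
    0 < \det (jacobian (chart y \o param x) q)
}.

Section Surfaces.
Context {R : realType} (S : oriented_surface R).

Definition smooth_map m (f : S -> 'rV[R]_m) : Prop :=
  forall x, smooth (chart x @` chart_dom x) (f \o param x).

(* The tangent space of S at x is identified with 'rV[R]_2 by means of the
   chart indexed by x; its standard basis is positively oriented. *)
Definition differential m (f : S -> 'rV[R]_m) (x : S) : 'rV[R]_2 -> 'rV[R]_m :=
  'd (f \o param x) (chart x x).

Definition smooth_to n (D : set 'rV[R]_n) (a : 'rV[R]_n -> S) : Prop :=
  {within D, continuous a} /\
  forall x, smooth (D `&` a @^-1` chart_dom x) (chart x \o a).

Definition frame0 : 'rV[R]_2 := delta_mx 0 0.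
Definition frame1 : 'rV[R]_2 := delta_mx 0 1.

(* Used both for symmetric bilinear forms and for 2-forms. *)
Definition tensor2 := forall x : S, 'rV[R]_2 -> 'rV[R]_2 -> R.

(* c is a C^1 curve on a neighbourhood of `[a, b]. *)
Definition C1_curve (c : R -> S) (a b : R) : Prop :=
  exists U : set R, [/\ open U, `[a, b] `<=` U,
    forall t, U t -> {for t, continuous c} &
    forall x, @Ck R R^o _ 1 (U `&` c @^-1` chart_dom x) (chart x \o c)].

Definition velocity (c : R -> S) (t : R) : 'rV[R]_2 :=
  derive1 (chart (c t) \o c) t.

Definition curve_length (g : tensor2) (c : R -> S) (a b : R) : \bar R :=
  (\int[lebesgue_measure]_(t in `[a, b])
    (Num.sqrt (g (c t) (velocity c t) (velocity c t)))%:E)%E.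

(* The distance is +oo between distinct components: S need not be connected. *)
Definition riemannian_dist (g : tensor2) (x y : S) : \bar R :=
  ereal_inf [set l | exists c a b,
    [/\ a <= b, C1_curve c a b, c a = x, c b = y & l = curve_length g c a b]].

Definition complete_metric (g : tensor2) : Prop :=
  forall u : nat -> S,
    (forall eps : R, 0 < eps -> exists N, forall m n, (N <= m)%N -> (N <= n)%N ->
      (riemannian_dist g (u m) (u n) < eps%:E)%E) ->
    exists x : S, forall eps : R, 0 < eps -> exists N, forall n, (N <= n)%N ->
      (riemannian_dist g (u n) x < eps%:E)%E.

End Surfaces.

Section HyperbolicSpace.
Context {R : realType}.
Implicit Types (p v n : 'rV[R]_(1 + 3)) (u y : 'rV[R]_3).

Definition mink v n : R := dot (rsubmx v) (rsubmx n) - v 0 0 * n 0 0.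

Definition H3 : set 'rV[R]_(1 + 3) := [set p | mink p p = -1 /\ 0 < p 0 0].

Definition boundary : set 'rV[R]_3 := [set u | dot u u = 1].

Definition light u : 'rV[R]_(1 + 3) := row_mx 1 u.

Definition cosh (t : R) : R := (expR t + expR (- t)) / 2.
Definition sinh (t : R) : R := (expR t - expR (- t)) / 2.

(* The unit speed geodesic through p with unit initial velocity v. *)
Definition geodesic p v (t : R) : 'rV[R]_(1 + 3) := cosh t *: p + sinh t *: v.

(* Identifies H3 with the open unit ball of R^3 so that the closed ball is the
   compactification of H3 by its ideal boundary. *)
Definition klein p : 'rV[R]_3 := (p 0 0)^-1 *: rsubmx p.

Definition horizon p v : 'rV[R]_3 := lim (klein (geodesic p v t) @[t --> +oo]).

(* Open half-spaces of H3, and open round disks of the boundary, are both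
   parametrised by the unit spacelike vectors; round_disk n is the ideal
   boundary of halfspace n, and is a disk of arbitrary centre and of arbitrary
   spherical radius in ]0, pi[. *)
Definition spacelike_unit n : Prop := mink n n = 1.
Definition halfspace n : set 'rV[R]_(1 + 3) := [set p | H3 p /\ 0 < mink p n].
Definition round_disk n : set 'rV[R]_3 :=
  [set u | boundary u /\ 0 < mink (light u) n].

(* The area form of the hyperbolic metric of round_disk n, at u. The map
   u |-> (mink (light u) n)^-1 *: light u - n is a conformal diffeomorphism of
   round_disk n onto the hyperbolic plane of equation mink p n = 0 in H3, and
   pulls the metric of the latter back to dot v w / mink (light u) n ^+ 2. For
   n = (0, a) this is the Poincare metric of a hemisphere. The boundary is
   oriented by its outward normal. *)
Definition hyperbolic_area n u (v w : 'rV[R]_3) : R :=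
  vol [tuple u; v; w] / mink (light u) n ^+ 2.

(* For s > 0, the open horoballs centred at y. *)
Definition horoball y (s : R) : set 'rV[R]_(1 + 3) :=
  [set p | H3 p /\ - mink p (light y) < s].

(* The boundaries of halfspace n and of horoball y s meet at p, where they have
   the same tangent plane. *)
Definition tangent_at n y (s : R) p : Prop :=
  [/\ H3 p, mink p n = 0, - mink p (light y) = s &
      forall v, mink v p = 0 -> (mink v n = 0 <-> mink v (light y) = 0)].

(* Only the values of a 2-form on the tangent plane dot y v = 0 of the boundary
   at y are relevant. *)
Definition eq_form_at y (w1 w2 : 'rV[R]_3 -> 'rV[R]_3 -> R) : Prop :=
  forall v w : 'rV[R]_3, dot y v = 0 -> dot y w = 0 -> w1 v w = w2 v w.

Definition asymptotic_curvature y (s : R) (w : 'rV[R]_3 -> 'rV[R]_3 -> R) : Prop :=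
  exists n, [/\ spacelike_unit n, horoball y s `<=` halfspace n,
                exists p, tangent_at n y s p &
                eq_form_at y w (hyperbolic_area n y)].

(* The open horoball with asymptotic centre y and asymptotic curvature w, which
   is the whole of H3 when w = 0. *)
Definition horoball_of y (w : 'rV[R]_3 -> 'rV[R]_3 -> R) : set 'rV[R]_(1 + 3) :=
  [set p | H3 p /\
    (eq_form_at y w (fun _ _ => 0) \/
     exists s, [/\ 0 < s, asymptotic_curvature y s w & horoball y s p])].

End HyperbolicSpace.

Section ImmersedSurfaces.
Context {R : realType} {S : oriented_surface R}.
Variable e : S -> 'rV[R]_(1 + 3).

Definition immersion : Prop :=
  [/\ forall x, H3 (e x), smooth_map e & forall x, injective (differential e x)].

(* The tangent space mink p v = 0 of H3 at p is oriented so that (v1, v2, v3) is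
   positive when (p, v1, v2, v3) is positive in 'rV[R]_(1 + 3). *)
Definition positive_unit_normal (x : S) (v : 'rV[R]_(1 + 3)) : Prop :=
  [/\ mink (e x) v = 0, mink v v = 1,
      forall xi, mink (differential e x xi) v = 0 &
      0 < vol [tuple e x; differential e x frame0; differential e x frame1; v]].

Definition unit_normal (x : S) : 'rV[R]_(1 + 3) := xget 0 [set v | positive_unit_normal x v].

(* The Levi-Civita connection of H3 along e: the orthogonal projection to the
   tangent space of H3 of the derivative in 'rV[R]_(1 + 3). *)
Definition nabla (N : S -> 'rV[R]_(1 + 3)) (x : S) (xi : 'rV[R]_2) :
    'rV[R]_(1 + 3) :=
  differential N x xi + mink (differential N x xi) (e x) *: e x.

Definition fundamental1 : tensor2 S := fun x xi nu =>
  mink (differential e x xi) (differential e x nu).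
Definition fundamental2 : tensor2 S := fun x xi nu =>
  mink (nabla unit_normal x xi) (differential e x nu).
Definition fundamental3 : tensor2 S := fun x xi nu =>
  mink (nabla unit_normal x xi) (nabla unit_normal x nu).

Definition inf_strictly_convex : Prop :=
  forall (x : S) xi, xi != 0 -> 0 < fundamental2 x xi xi.

Definition quasicomplete : Prop :=
  complete_metric (fun x xi nu => fundamental1 x xi nu + fundamental3 x xi nu).

Definition asymptotic_gauss (x : S) : 'rV[R]_3 := horizon (e x) (unit_normal x).

End ImmersedSurfaces.

Section KulkarniPinkall.
Context {R : realType} {S : oriented_surface R}.
Variable phi : S -> 'rV[R]_3.

Definition moebius_disk (n : 'rV[R]_(1 + 3)) (alpha : 'rV[R]_3 -> S) : Prop :=
  [/\ spacelike_unit n, smooth_to (round_disk n) alpha &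
      forall u, round_disk n u -> phi (alpha u) = u].

(* The pullback by phi of hyperbolic_area n. *)
Definition pullback_area (n : 'rV[R]_(1 + 3)) : tensor2 S := fun x xi nu =>
  hyperbolic_area n (phi x) (differential phi x xi) (differential phi x nu).

(* The 2-forms on a tangent plane are the multiples of vol, and are ordered by
   their values on the positive frame (frame0, frame1). *)
Definition kulkarni_pinkall : tensor2 S := fun x xi nu =>
  vol [tuple xi; nu] *
  inf [set r | exists n alpha,
         [/\ moebius_disk n alpha, (alpha @` round_disk n) x &
             r = pullback_area n x frame0 frame1]].

(* The image by phi of a 2-form at x, when phi is a local diffeomorphism to the
   boundary; on the tangent plane of the boundary at phi x, multiplication by
   pinvmx (jacobian _ _) is then the inverse of differential phi x. *)
Definition push_form (w : tensor2 S) (x : S) (v1 v2 : 'rV[R]_3) : R :=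
  let J := jacobian (phi \o param x) (chart x x) in
  w x (v1 *m pinvmx J) (v2 *m pinvmx J).

End KulkarniPinkall.

(* Main.v *)
Require Import Defs.
From HB Require Import structures.
From mathcomp Require Import all_boot all_order all_algebra.
From mathcomp Require Import all_classical all_reals all_analysis.
From mathcomp Require Import measurable_realfun.
From mathcomp Require Import ring lra.
Import Order.TTheory GRing.Theory Num.Theory.
Import numFieldNormedType.Exports.
Local Open Scope classical_set_scope.
Local Open Scope ring_scope.

Set Implicit Arguments.
Unset Strict Implicit.
Unset Printing Implicit Defensive.

(* Let N be the unit normal and K = e + N, a positive multiple of the null vector
   light phi. Fix x. Among the forms whose infimum is omega (x) it suffices to
   find one bounded by the asymptotic curvature of the horoball centred at phi x
   whose boundary passes through e x. The hyperbolic area form of the round disk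
   of normal vector N x is exactly that curvature at phi x, so the point is to
   extend the local inverse of phi at phi x to this disk.

   In the frame (e x, N x, v1, v2), a null vector k is h (null_point z) for a height
   h and a coordinate z in R^2, and the disk is |z| < 2. The local inverse is
   continued along the rays t z: on such a lift h' is controlled by the
   Gauss equation |e' + N'|^2 = |z|^2 h^2, and <e', N'> > 0 turns this into a
   Riccati inequality, whose comparison gives 1 / h >= 1 - t^2 |z|^2 / 4. So the
   length of the lift for I + III, which is at most that of K, is finite as long as
   t |z| < 2; by quasicompleteness the lift has a limit, and the continuation
   never stops inside the disk. *)

(** The comparison function [1 - t^2 |z|^2 / 4] is [1 / h] in the extreme case of a constant normal,
    the totally geodesic plane through [e x] orthogonal to [N x]: if L is the ray of null points of
    height 1, then [h <L, N> = 1] and [<L, N> = 1 - t^2 |z|^2 / 4]. There [<e', N'>] vanishes and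
    the Riccati inequality is an equality. The plane has |z| = 2 as its ideal boundary, so the bound
    stays positive exactly on the required disk.

    K is preferred to phi because its scale remembers the horoball. If [K = lam light phi], the
    horosphere at phi through e has parameter [1 / lam], hence curvature factor [lam^2]; and
    [<K, N> = 1] makes N pair with [light phi] to [1 / lam], so that the area form of the disk of N
    carries the same factor.

    Continuation is confined to domains that are star-shaped about 0. Two of these meet in a
    star-shaped set, on which sections with the same value at 0 agree; hence the union of all of
    them carries a section, and no monodromy has to be discussed. *)

Section Differentiability.
Context {R : realType}.

Lemma differentiable_epsP (V W : normedModType R) (f : V -> W) x (A : {linear V -> W}) :
  continuous A ->
  (forall eps, 0 < eps ->
     \forall y \near x, `|f y - f x - A (y - x)| <= eps * `|y - x|) ->
  differentiable f x /\ ('d f x = A :> (V -> W)).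
Proof.
move=> cA H.
have fE : f \o shift x = cst (f x) + A +o_ 0 id.
  apply/eqaddoP => eps eps0.
  have /nbhs0P := H _ eps0; apply: filterS => h /=.
  have e : x + h - x = h by rewrite addrC addKr.
  by rewrite !fctE /= e opprD addrA [h + x]addrC.
have dE : 'd f x = A :> (V -> W) by apply: diff_unique.
by split => //; apply/diff_locallyP; rewrite dE.
Qed.

Lemma differentiable_eps (V W : normedModType R) (f : V -> W) x :
  differentiable f x -> forall eps, 0 < eps ->
     \forall y \near x, `|f y - f x - 'd f x (y - x)| <= eps * `|y - x|.
Proof.
move=> /diff_locallyP[_ /eqaddoP H] eps eps0.
apply/nbhs0P; have := H _ eps0; apply: filterS => h /=.
have e : x + h - x = h by rewrite addrC addKr.
by rewrite !fctE /= e opprD addrA [h + x]addrC.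
Qed.

Lemma near_differentiable (V W : normedModType R) (f g : V -> W) x :
  (\forall y \near x, f y = g y) -> differentiable f x ->
  differentiable g x /\ ('d g x = 'd f x :> (V -> W)).
Proof.
move=> fg df; apply: differentiable_epsP; first exact: diff_continuous.
move=> eps eps0; have fgx := nbhs_singleton fg.
have := differentiable_eps df eps0.
by apply: filterS2 fg => y <-; rewrite fgx.
Qed.

Lemma differentiable_rowP (V : normedModType R) n (f : V -> 'rV[R]_n) x :
  (forall i, differentiable (fun y => f y 0 i) x) -> differentiable f x.
Proof.
move=> df.
have -> : f = \sum_(i < n) (fun y => f y 0 i *: (delta_mx 0 i : 'rV[R]_n)).
  by apply/funext => y; rewrite fct_sumE {1}(row_sum_delta (f y)).
by apply: differentiable_sum => i; exact: differentiableZl.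
Qed.

Lemma differentiable_row (V : normedModType R) n (f : V -> 'rV[R]_n) x i :
  differentiable f x -> differentiable (fun y => f y 0 i) x.
Proof.
move=> df; apply: (@differentiable_comp _ _ _ _ f (fun M : 'rV[R]_n => M 0 i)) => //.
exact: differentiable_coord.
Qed.

Lemma derive_row (V : normedModType R) n (f : V -> 'rV[R]_n) x v i :
  differentiable f x -> ('D_v f x) 0 i = 'D_v (fun y => f y 0 i) x.
Proof. by move=> df; rewrite derive_mx ?mxE //; exact: diff_derivable. Qed.

Lemma continuous_rowP (T : topologicalType) n (f : T -> 'rV[R]_n) x :
  (forall i, {for x, continuous (fun y => f y 0 i)}) -> {for x, continuous f}.
Proof.
move=> cf; apply/cvgrPdist_le => e e0.
have : \forall t \near x, forall i, `|f x 0 i - f t 0 i| <= e.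
  by apply: filter_forall => i; have /cvgrPdist_le := cf i; apply.
apply: filterS => t H.
rewrite [leLHS]/Num.Def.normr/= mx_normrE (bigmax_le _ (ltW e0))//= => -[i j] _.
by rewrite !mxE/= ord1 H.
Qed.

Lemma continuous_row (T : topologicalType) n (f : T -> 'rV[R]_n) x i :
  {for x, continuous f} -> {for x, continuous (fun y => f y 0 i)}.
Proof.
move=> cf; apply: (@continuous_comp _ _ _ f (fun M : 'rV[R]_n => M 0 i)) => //.
exact: coord_continuous.
Qed.

End Differentiability.

(** * Calculus of functions of class C^k *)

Section CkCalculus.
Context {R : realType}.
Implicit Types V W : normedModType R.

Lemma Ck_sub V W k (U U' : set V) (f : V -> W) :
  U' `<=` U -> Ck k U f -> Ck k U' f.
Proof.
move=> s; elim: k f => [|k IH] f /=; first by move=> c x /s /c.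
by case=> d D; split=> [x /s /d|v] //; exact: IH.
Qed.

Lemma CkS_differentiable V W k (U : set V) (f : V -> W) x :
  Ck k.+1 U f -> U x -> differentiable f x.
Proof. by case=> d _ /d. Qed.

Lemma CkW V W k (U : set V) (f : V -> W) : Ck k.+1 U f -> Ck k U f.
Proof.
elim: k f => [|k IH] f; first by move=> [d _] x /d; exact: differentiable_continuous.
by move=> [d D]; split=> // v; apply: IH; exact: D.
Qed.

Lemma Ck_continuous V W k (U : set V) (f : V -> W) x :
  Ck k U f -> U x -> {for x, continuous f}.
Proof. by elim: k => [H Ux|k IH /CkW]; [exact: H|exact: IH]. Qed.

(** Openness of U turns agreement on U into agreement near each of its points, hence into equality
    of differentials. Most closure properties below rest on this: ['D_v] is given by a formula valid
    on U, and the induction runs on that formula. *)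
Lemma Ck_ext V W k (U : set V) (f g : V -> W) :
  open U -> (forall x, U x -> f x = g x) -> Ck k U f -> Ck k U g.
Proof.
move=> oU; elim: k f g => [|k IH] f g fg.
  move=> cf x Ux; have n : \forall y \near x, f y = g y.
    by have := open_nbhs_nbhs (conj oU Ux); apply: filterS => y /fg.
  rewrite /prop_for /continuous_at -(fg _ Ux).
  exact: cvg_trans (near_eq_cvg n) (cf x Ux).
case=> d D.
have n x : U x -> \forall y \near x, f y = g y.
  by move=> Ux; have := open_nbhs_nbhs (conj oU Ux); apply: filterS => y /fg.
split=> [x Ux|v]; first by case: (near_differentiable (n x Ux) (d x Ux)).
apply: IH (D v) => x Ux.
have [dg dge] := near_differentiable (n x Ux) (d x Ux).
by rewrite !deriveE ?dge//; exact: d.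
Qed.

Lemma Ck_cst V W k (U : set V) (a : W) : Ck k U (fun _ => a).
Proof.
elim: k a => [|k IH] a; first by move=> x _; exact: cvg_cst.
split=> [x _|v]; first exact: differentiable_cst.
have -> : (fun x => 'D_v (fun=> a) x) = fun _ : V => 0 :> W.
  by apply/funext => x; exact: derive_cst.
exact: IH.
Qed.

Lemma Ck_id V k (U : set V) : Ck k U (fun x : V => x).
Proof.
case: k => [|k]; first by move=> x _; exact: cvg_id.
split=> [x _|v]; first exact: ex_diff.
have -> : (fun x : V => 'D_v (fun x => x) x) = fun _ : V => v.
  by apply/funext => x; exact: derive_id.
exact: Ck_cst.
Qed.

Lemma CkD V W k (U : set V) (f g : V -> W) : open U ->
  Ck k U f -> Ck k U g -> Ck k U (fun x => f x + g x).
Proof.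
move=> oU; elim: k f g => [|k IH] f g.
  by move=> cf cg x Ux; apply: cvgD; [exact: cf|exact: cg].
move=> [df Df] [dg Dg]; split=> [x Ux|v].
  exact: differentiableD (df x Ux) (dg x Ux).
apply: Ck_ext (IH _ _ (Df v) (Dg v)) => // x Ux.
by rewrite -deriveD //; apply: diff_derivable; [exact: df|exact: dg].
Qed.

Lemma CkZc V W k (U : set V) (a : R) (f : V -> W) : open U ->
  Ck k U f -> Ck k U (fun x => a *: f x).
Proof.
move=> oU; elim: k f => [|k IH] f.
  by move=> cf x Ux; apply: cvgZr; exact: cf.
move=> [df Df]; split=> [x Ux|v]; first exact: differentiableZ (df x Ux).
apply: Ck_ext (IH _ (Df v)) => // x Ux.
by rewrite -deriveZ //; apply: diff_derivable; exact: df.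
Qed.

Lemma CkN V W k (U : set V) (f : V -> W) : open U ->
  Ck k U f -> Ck k U (fun x => - f x).
Proof.
by move=> oU /(CkZc (-1) oU); congr Ck; apply/funext => x; rewrite scaleN1r.
Qed.

Lemma CkB V W k (U : set V) (f g : V -> W) : open U ->
  Ck k U f -> Ck k U g -> Ck k U (fun x => f x - g x).
Proof. by move=> oU cf cg; apply: CkD => //; exact: CkN. Qed.

Lemma Ck_sum V W k (U : set V) (I : Type) (r : seq I) (P : pred I) (f : I -> V -> W) :
  open U -> (forall i, P i -> Ck k U (f i)) -> Ck k U (fun x => \sum_(i <- r | P i) f i x).
Proof.
move=> oU cf; elim: r => [|i r IH].
  rewrite [X in Ck _ _ X](_ : _ = fun=> 0); first exact: Ck_cst.
  by apply/funext => x; rewrite big_nil.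
rewrite [X in Ck _ _ X](_ : _ = fun x => (if P i then f i x else 0) +
    \sum_(j <- r | P j) f j x).
  by apply: CkD => //; case: (P i) (@cf i) => [/(_ isT)|_] //; exact: Ck_cst.
by apply/funext => x; rewrite big_cons; case: ifP => // _; rewrite add0r.
Qed.

Lemma CkM V k (U : set V) (f g : V -> R) : open U ->
  Ck k U f -> Ck k U g -> Ck k U (fun x => f x * g x).
Proof.
move=> oU; elim: k f g => [|k IH] f g.
  by move=> cf cg x Ux; apply: cvgM; [exact: cf|exact: cg].
move=> Cf Cg; have [df Df] := Cf; have [dg Dg] := Cg; split=> [x Ux|v].
  exact: differentiableM (df x Ux) (dg x Ux).
have := CkD oU (IH _ _ (CkW Cf) (Dg v)) (IH _ _ (CkW Cg) (Df v)).
apply: Ck_ext => // x Ux; rewrite deriveM //; apply: diff_derivable;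
  by [exact: df|exact: dg].
Qed.

Lemma Ck_prod V k (U : set V) (I : Type) (r : seq I) (P : pred I) (f : I -> V -> R) :
  open U -> (forall i, P i -> Ck k U (f i)) -> Ck k U (fun x => \prod_(i <- r | P i) f i x).
Proof.
move=> oU cf; elim: r => [|i r IH].
  rewrite [X in Ck _ _ X](_ : _ = fun=> 1); first exact: Ck_cst.
  by apply/funext => x; rewrite big_nil.
rewrite [X in Ck _ _ X](_ : _ = fun x => (if P i then f i x else 1) *
    \prod_(j <- r | P j) f j x).
  by apply: CkM => //; case: (P i) (@cf i) => [/(_ isT)|_] //; exact: Ck_cst.
by apply/funext => x; rewrite big_cons; case: ifP => // _; rewrite mul1r.
Qed.

(** The derivative is a polynomial in the inverse itself and ['D_v f], so order k of the inverse
    yields order k.+1. [Ck_sqrt] recurses in the same way. *)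
Lemma CkV V k (U : set V) (f : V -> R) : open U -> (forall x, U x -> f x != 0) ->
  Ck k U f -> Ck k U (fun x => (f x)^-1).
Proof.
move=> oU f0; elim: k => [|k IH].
  by move=> cf x Ux; apply: cvgV; [exact: f0|exact: cf].
move=> Cf; have [df Df] := Cf; split=> [x Ux|v].
  by apply: differentiableV; [exact: df|exact: f0].
have CV := IH (CkW Cf).
have := CkN oU (CkM oU (CkM oU CV CV) (Df v)).
apply: Ck_ext => // x Ux; rewrite deriveV ?f0 //; last exact/diff_derivable/df.
by rewrite /GRing.scale /= mulNr expr2 invfM.
Qed.

Lemma Ck_sqrt V k (U : set V) (f : V -> R) : open U -> (forall x, U x -> 0 < f x) ->
  Ck k U f -> Ck k U (fun x => Num.sqrt (f x)).
Proof.
move=> oU f0; elim: k => [|k IH].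
  move=> cf x Ux; apply: (@continuous_comp _ _ _ f (@Num.sqrt R)); first exact: cf.
  exact: sqrt_continuous.
move=> Cf; have [df Df] := Cf.
have ds x : U x -> differentiable (@Num.sqrt R) (f x).
  by move=> Ux; apply/derivable1_diffP; have [] := is_derive1_sqrt (f0 x Ux).
have dsf x : U x -> differentiable (fun x => Num.sqrt (f x)) x.
  by move=> Ux; exact: (differentiable_comp (df x Ux) (ds x Ux)).
split=> // v.
have CV : Ck k U (fun x => (2 * Num.sqrt (f x))^-1).
  apply: CkV => // [x Ux|]; first by rewrite mulf_neq0 // gt_eqF // sqrtr_gt0 f0.
  by apply: CkM => //; [exact: Ck_cst|exact: IH (CkW Cf)].
have := CkM oU (Df v) CV.
apply: Ck_ext => // x Ux.
rewrite [RHS]deriveE; last exact: dsf.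
rewrite -[fun x => _]/(@Num.sqrt R \o f) diff_comp //; [|exact: df|exact: ds].
rewrite /= deriv1E; last by have [] := is_derive1_sqrt (f0 x Ux).
rewrite derive1E; have [_ ->] := is_derive1_sqrt (f0 x Ux).
by rewrite deriveE //; exact: df.
Qed.

Lemma Ck_rowP V n k (U : set V) (f : V -> 'rV[R]_n) : open U ->
  (forall i, Ck k U (fun x => f x 0 i)) -> Ck k U f.
Proof.
move=> oU; elim: k f => [|k IH] f H.
  by move=> x Ux; apply: continuous_rowP => i; exact: (H i).
have df x : U x -> differentiable f x.
  by move=> Ux; apply: differentiable_rowP => i; case: (H i) => + _; exact.
split=> // v; apply: IH => i; case: (H i) => _ /(_ v).
by apply: Ck_ext => // x Ux; rewrite derive_row //; exact: df.
Qed.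

Lemma Ck_row V n k (U : set V) (f : V -> 'rV[R]_n) i : open U ->
  Ck k U f -> Ck k U (fun x => f x 0 i).
Proof.
move=> oU; elim: k f => [|k IH] f.
  by move=> cf x Ux; apply: continuous_row; exact: cf.
move=> [df Df]; split=> [x Ux|v]; first by apply: differentiable_row; exact: df.
by apply: Ck_ext (IH _ (Df v)) => // x Ux; rewrite derive_row //; exact: df.
Qed.

Lemma differential_row V n (f : 'rV[R]_n -> V) x v : differentiable f x ->
  'd f x v = \sum_(i < n) v 0 i *: 'D_(delta_mx 0 i) f x.
Proof.
move=> df; rewrite {1}(row_sum_delta v) linear_sum; apply: eq_bigr => i _.
by rewrite linearZ deriveE.
Qed.

(** The chain rule is written in coordinates, as the sum of the products of the entries of ['D_v f]
    with the partial derivatives of g composed with f. These are again compositions with f, of lower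
    order, to which the induction applies. *)
Lemma Ck_comp V n k (U : set V) (U' : set 'rV[R]_n) (f : V -> 'rV[R]_n)
    (g : 'rV[R]_n -> R) : open U -> (forall x, U x -> U' (f x)) ->
  Ck k U f -> Ck k U' g -> Ck k U (g \o f).
Proof.
move=> oU UU'; elim: k g => [|k IH] g.
  by move=> cf cg x Ux; apply: continuous_comp; [exact: cf|exact/cg/UU'].
move=> Cf Cg; have [df Df] := Cf; have [dg Dg] := Cg; split=> [x Ux|v].
  by apply: differentiable_comp; [exact: df|exact/dg/UU'].
have : Ck k U (fun x => \sum_(i < n) ('D_v f x) 0 i * ('D_(delta_mx 0 i) g (f x))).
  apply: Ck_sum => // i _; apply: CkM => //; first exact: (Ck_row i oU (Df v)).
  exact: IH (CkW Cf) (Dg _).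
apply: Ck_ext => // x Ux.
have dfx := df x Ux; have dgx := dg _ (UU' x Ux).
rewrite [RHS]deriveE; last exact: differentiable_comp.
rewrite diff_comp //= -(deriveE v dfx).
by rewrite differential_row.
Qed.

Lemma Ck_comp_row V m n k (U : set V) (U' : set 'rV[R]_n) (f : V -> 'rV[R]_n)
    (g : 'rV[R]_n -> 'rV[R]_m) : open U -> open U' -> (forall x, U x -> U' (f x)) ->
  Ck k U f -> Ck k U' g -> Ck k U (g \o f).
Proof.
move=> oU oU' UU' Cf Cg; apply: Ck_rowP => // i.
exact: (Ck_comp oU UU' Cf (Ck_row i oU' Cg)).
Qed.

Lemma Ck_det V n k (U : set V) (M : V -> 'M[R]_n) : open U ->
  (forall i j, Ck k U (fun x => M x i j)) -> Ck k U (fun x => \det (M x)).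
Proof.
move=> oU CM; rewrite /determinant; apply: Ck_sum => // s _.
by apply: CkM => //; [exact: Ck_cst|apply: Ck_prod].
Qed.

(** Every clause of [Ck] speaks of one point of the set at a time, so it may be checked on
    singletons; near each point, f is replaced by the extension that [smooth] provides. *)
Lemma smooth_open V W (U : set V) (f : V -> W) k : open U -> smooth U f -> Ck k U f.
Proof.
move=> oU sf.
suff H : forall x, U x -> Ck k [set x] f.
  elim: k f {sf} H => [|k IH] f H; first by move=> x Ux; exact: (H x Ux).
  split=> [x Ux|v]; first by have [dx _] := H x Ux; exact: dx.
  by apply: IH => x Ux; have [_ Dx] := H x Ux; exact: Dx.
move=> x Ux; have [A [F [oA Ax CF Ff]]] := sf x Ux.
apply: (@Ck_sub _ _ _ (U `&` A)); first by move=> _ ->.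
apply: (@Ck_ext _ _ _ _ F); [exact: openI|exact: Ff|].
by apply: Ck_sub (CF k) => y [].
Qed.

End CkCalculus.

(** Makes row vectors a complete normed space for [banach_fixed_point]. *)
HB.instance Definition _ (R : realType) m n := Complete.on 'M[R]_(m, n).

(** * The smooth inverse function theorem *)

Section InverseFunction.
Context {R : realType}.

Lemma is_derive_line (V W : normedModType R) (g : V -> W) (b v : V) (t : R) :
  differentiable g (b + t *: v) ->
  is_derive t 1 (fun t => g (b + t *: v)) ('d g (b + t *: v) v).
Proof.
move=> dg; have [dv /esym e] := derivableP (@diff_derivable _ _ _ _ _ v dg).
have E : (fun h : R => h^-1 *: (((fun t => g (b + t *: v)) \o shift t) (h *: 1) -
     g (b + t *: v))) =
   (fun h => h^-1 *: ((g \o shift (b + t *: v)) (h *: v) - g (b + t *: v))).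
  apply/funext => h /=; congr (_ *: (g _ - _)).
  by rewrite [h *: 1]mulr1 scalerDl addrCA.
apply: DeriveDef; first by rewrite /derivable E.
by rewrite -deriveE // /derive E.
Qed.

Lemma norm_rowE n (v : 'rV[R]_n) i : `|v 0 i| <= `|v|.
Proof.
by rewrite [leRHS]/Num.Def.normr/= mx_normrE (le_bigmax _ _ (0, i)).
Qed.

Lemma norm_row_le n (v : 'rV[R]_n) e : 0 <= e -> (forall i, `|v 0 i| <= e) -> `|v| <= e.
Proof.
move=> e0 H; rewrite [leLHS]/Num.Def.normr/= mx_normrE (bigmax_le _ e0)//= => -[i j] _.
by rewrite ord1 H.
Qed.

Lemma ball_segment (V : normedModType R) (q a b : V) (r t : R) :
  ball q r a -> ball q r b -> 0 <= t <= 1 -> ball q r (b + t *: (a - b)).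
Proof.
rewrite -!ball_normE /= => qa qb /andP[t0 t1].
have -> : q - (b + t *: (a - b)) = t *: (q - a) + (1 - t) *: (q - b).
  have e : q - a - (q - b) = - (a - b).
    by rewrite !opprB addrC addrA subrK.
  rewrite scalerBl scale1r addrCA -scalerBr e.
  by rewrite scalerN opprD addrA.
have [->|t0'] := eqVneq t 0; first by rewrite scale0r add0r subr0 scale1r.
apply: le_lt_trans (ler_normD _ _) _; rewrite !normrZ (ger0_norm t0) ger0_norm ?subr_ge0 //.
have -> : r = t * r + (1 - t) * r by ring.
by apply: ltr_leD; [rewrite ltr_pM2l // lt0r t0' t0|rewrite ler_wpM2l ?subr_ge0 // ltW].
Qed.

(* The differential at q0 vanishes and is continuous: apply the mean value
   theorem to each coordinate on a small ball. *)
Lemma C1_small_lipschitz n m (Om : set 'rV[R]_n) (g : 'rV[R]_n -> 'rV[R]_m) q0 eps :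
  open Om -> Om q0 -> Ck 1 Om g -> (forall v, 'D_v g q0 = 0) -> 0 < eps ->
  exists r, [/\ 0 < r, ball q0 r `<=` Om &
    forall a b, ball q0 r a -> ball q0 r b -> `|g a - g b| <= eps * `|a - b|].
Proof.
move=> oO Oq [dg Dg] g0 eps0.
pose e := eps / n.+1%:R.
have e0 : 0 < e by rewrite divr_gt0.
have near_small : \forall q \near q0, forall j : 'I_n, `|'D_(delta_mx 0 j) g q| <= e.
  apply: (@filter_forall _ _ (fun j : 'I_n => fun q => `|'D_(delta_mx 0 j) g q| <= e) _
    (nbhs_filter q0)) => j; have /cvgrPdist_le := Dg (delta_mx 0 j) _ Oq.
  move=> /(_ _ e0); apply: filterS => q; rewrite g0 sub0r normrN; exact.
have near_Om : \forall q \near q0, Om q by exact: open_nbhs_nbhs.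
have : nbhs q0 (fun q => Om q /\ forall j : 'I_n, `|'D_(delta_mx 0 j) g q| <= e).
  exact: filterI near_Om near_small.
move=> /nbhs_ballP[r /= r0 H]; exists r; split=> // [q /H[]//|a b ra rb].
apply: norm_row_le => [|i]; first by rewrite mulr_ge0 // ltW.
rewrite !mxE.
pose l (t : R) := b + t *: (a - b).
have lin (t : R) : t \in `[0, 1] -> ball q0 r (l t).
  by move=> /itvP t01; apply: ball_segment; rewrite // !t01.
pose gi q := g q 0 i.
have dgi q : Om q -> differentiable gi q.
  by move=> Oq'; apply: differentiable_row; exact: dg.
have dl (t : R) : t \in `[0, 1] -> is_derive t 1 (gi \o l) ('d gi (l t) (a - b)).
  by move=> /lin /H[Ol _]; apply: is_derive_line; exact: dgi.
pose G : R -> R := gi \o l; pose dG t : R := 'd gi (l t) (a - b).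
have dl' (t : R) : t \in `]0, 1[ -> is_derive t 1 G (dG t).
  by move=> t01; apply: dl; apply: subset_itv_oo_cc t01.
have cG : {within `[0, 1], continuous G}.
  by apply: derivable_within_continuous => t /dl[].
have [c c01] := MVT_segment ler01 dl' cG.
rewrite /G /dG /= /l scale0r addr0 scale1r subrKC subr0 mulr1 => ->.
have [Oc Hc] := H _ (lin _ c01).
rewrite differential_row; last exact: dgi.
apply: le_trans (ler_norm_sum _ _ _) _.
apply: (@le_trans _ _ (\sum_(j < n) e * `|a - b|)).
  apply: ler_sum => j _; rewrite normrM mulrC; apply: ler_pM => //; last exact: norm_rowE.
  by rewrite -derive_row; [exact: le_trans (norm_rowE _ _) (Hc j)|exact: dg].
rewrite sumr_const card_ord -mulr_natr mulrAC ler_wpM2r //.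
rewrite /e -mulrA ler_piMr ?(ltW eps0) // mulrC ler_pdivrMr // mul1r ler_nat //.
Qed.

Lemma mulmx_bounded m n (B : 'M[R]_(m, n)) :
  exists C, 0 < C /\ forall v : 'rV[R]_m, `|v *m B| <= C * `|v|.
Proof.
pose M := \sum_i \sum_j `|B i j| + 1.
have M0 : 0 <= \sum_i \sum_j `|B i j| by apply: sumr_ge0 => i _; apply: sumr_ge0.
have M1 : 0 < M by rewrite ltr_pwDr.
exists M; split => // v; apply: norm_row_le => [|j]; first by rewrite mulr_ge0 // ltW.
rewrite mxE; apply: le_trans (ler_norm_sum _ _ _) _.
apply: (@le_trans _ _ (\sum_i \sum_j `|B i j| * `|v|)).
  apply: ler_sum => i _; rewrite normrM mulrC (bigD1 j) //=.
  rewrite ler_wpDr //; first by apply: sumr_ge0 => k _; exact: mulr_ge0.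
  by rewrite ler_wpM2l // norm_rowE.
rewrite mulrDl mul1r ler_wpDr // mulr_suml le_eqVlt; apply/orP; left; apply/eqP.
by apply: eq_bigr => i _; rewrite mulr_suml.
Qed.

Lemma mulmxr_continuous m n (B : 'M[R]_(m, n)) :
  continuous (mulmxr B : 'rV[R]_m -> 'rV[R]_n).
Proof.
have [C [C0 HC]] := mulmx_bounded B.
move=> v; apply/(@cvgrPdist_lt _ _ _ _ (nbhs_filter v)) => e e0; apply/nbhs_ballP.
exists (C^-1 * e) => /= [|y]; first by rewrite mulr_gt0 // invr_gt0.
rewrite -ball_normE /= ltr_pdivlMl // => vy.
by rewrite -mulmxBl; exact: le_lt_trans (HC _) vy.
Qed.

Lemma Ck_mulmxr (V : normedModType R) m n k (U : set V) (f : V -> 'rV[R]_m)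
  (B : 'M[R]_(m, n)) : open U -> Ck k U f -> Ck k U (fun x => f x *m B).
Proof.
move=> oU Cf; apply: Ck_rowP => // i.
rewrite [X in Ck _ _ X](_ : _ = fun x => \sum_j f x 0 j * B j i); last first.
  by apply/funext => x; rewrite mxE.
by apply: Ck_sum => // j _; apply: CkM => //; [exact: Ck_row|exact: Ck_cst].
Qed.

Lemma derive_linear_comp (U V W : normedModType R) (A : {linear V -> W}) (f : U -> V) x v :
  continuous A -> differentiable f x -> 'D_v (A \o f) x = A ('D_v f x).
Proof.
move=> cA df; have dA : differentiable A (f x) by exact: linear_differentiable.
have AE : 'd A (f x) = A :> (_ -> _) := diff_lin (f x) cA.
rewrite deriveE; last exact: differentiable_comp.
by rewrite (diff_comp df dA) AE /= -(deriveE v df).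
Qed.

(* Newton iteration with the differential at q0 frozen contracts small balls. *)
Lemma open_image_ball n (f : 'rV[R]_n -> 'rV[R]_n) (B : 'M[R]_n) q0 r :
  B \in unitmx ->
  (forall a b, ball q0 r a -> ball q0 r b ->
     `|(a - f a *m B) - (b - f b *m B)| <= 2^-1 * `|a - b|) ->
  open (f @` ball q0 r).
Proof.
move=> uB H; rewrite openE => _ [q1 bq1 <-].
have [C [C0 HC]] := mulmx_bounded B.
have /nbhs_ballP[s /= s0 Hs] : nbhs q1 (ball q0 r).
  by apply: open_nbhs_nbhs; split => //; exact: ball_open.
pose rho := s / 2; have rho0 : 0 < rho by rewrite divr_gt0.
pose K : set 'rV[R]_n := closed_ball q1 rho.
have KE q : K q <-> `|q1 - q| <= rho by rewrite /K closed_ballE.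
have Kb q : K q -> ball q0 r q.
  move=> /KE kq; apply: Hs; rewrite -ball_normE /=; apply: le_lt_trans kq _.
  by rewrite /rho; lra.
apply/nbhs_ballP; exists (rho / (2 * C)) => /=; first by rewrite divr_gt0 // mulr_gt0.
move=> w; rewrite -ball_normE /= => wq1.
pose T (q : 'rV[R]_n) : 'rV[R]_n := q - f q *m B + w *m B.
have TK q : K q -> K (T q).
  move=> Kq; apply/KE.
  have -> : q1 - T q = ((q1 - f q1 *m B) - (q - f q *m B)) + (f q1 - w) *m B.
    rewrite /T mulmxBl; move: (f q1 *m B) (f q *m B) (w *m B) => x y z.
    by apply/rowP => i; rewrite !mxE; ring.
  have h1 := H _ _ bq1 (Kb _ Kq); move/KE: Kq => Kq.
  have h2 : `|(f q1 - w) *m B| <= rho / 2.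
    apply: le_trans (HC _) _; rewrite -ler_pdivlMl //; apply: ltW.
    by rewrite mulrC -mulrA -invfM.
  by apply: le_trans (ler_normD _ _) _; lra.
pose TF : {fun K >-> K} := mkfun_fun TK.
have ctr : is_contraction TF.
  exists (2^-1)%:nng; split => /=; first by rewrite invf_lt1 // ltr1n.
  move=> [a b] [/= Ka Kb'].
  rewrite /T opprD addrACA [w *m B - _]subrr addr0.
  by apply: H; [exact: (Kb _ Ka)|exact: (Kb _ Kb')].
have [||p Kp pE] := banach_fixed_point ctr.
- exact: closed_ball_closed.
- by exists q1; apply/KE; rewrite subrr normr0 ltW.
exists p; first by have := Kb _ Kp; rewrite -ball_normE.
have : (w - f p) *m B = 0.
  have pE' : p = p - f p *m B + w *m B := pE.
  rewrite mulmxBl; move: (f p *m B) (w *m B) pE' => x y /rowP pe.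
  by apply/rowP => i; move: (pe i); rewrite !mxE; lra.
move=> /(congr1 (fun x => x *m invmx B)).
by rewrite mulmxK // mul0mx => /eqP; rewrite subr_eq0 => /eqP.
Qed.

(** One ball W serves for all orders: smoothness of g is bootstrapped from the formula
    [v *m invmx (jacobian f (g w))] for its derivative, whose right-hand side is as regular as g. *)
Theorem inverse_function n (Om : set 'rV[R]_n) (f : 'rV[R]_n -> 'rV[R]_n) q0 :
  open Om -> Om q0 -> (forall k, Ck k Om f) -> jacobian f q0 \in unitmx ->
  exists W V g, [/\ open W, W q0, W `<=` Om, open V &
    [/\ forall q, W q -> V (f q) /\ g (f q) = q,
        forall w, V w -> W (g w) /\ f (g w) = w &
        forall k, Ck k V g]].
Proof.
move=> oO Oq0 Cf uJ; pose B := invmx (jacobian f q0).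
have uB : B \in unitmx by rewrite unitmx_inv.
have df q : Om q -> differentiable f q by exact: CkS_differentiable (Cf 1%N).
pose h q := q - f q *m B.
have Ch : Ck 1 Om h.
  by apply: CkB => //; [exact: Ck_id|apply: Ck_mulmxr].
have DB q v : Om q -> 'D_v (fun q => f q *m B) q = 'D_v f q *m B.
  by move=> Oq; apply: (@derive_linear_comp _ _ _ (mulmxr B)); [exact: mulmxr_continuous|exact: df].
have Dh v : 'D_v h q0 = 0.
  rewrite deriveB; last 2 first.
  - exact: derivable_id.
  - by apply: diff_derivable; exact: (CkS_differentiable (Ck_mulmxr B oO (Cf 1%N))).
  by rewrite derive_id DB // deriveEjacobian ?mulmxK ?subrr //; exact: df.
have [r [r0 rO Hr]] := C1_small_lipschitz oO Oq0 Ch Dh (ltac:(by rewrite invr_gt0) : 0 < 2^-1 :> R).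
have [C [C0 HC]] := mulmx_bounded B.
pose W := ball q0 r; pose V := f @` W.
have oV : open V by exact: (open_image_ball uB).
have oW : open W by exact: ball_open.
(* As [h] contracts by one half on W, half of [|a - b|] can be absorbed. So f is injective on W and
   its inverse is Lipschitz of constant [2 * C]. *)
have lip a b : W a -> W b -> `|a - b| <= 2 * C * `|f a - f b|.
  move=> Wa Wb; have := Hr _ _ Wa Wb.
  have e : a - b = (h a - h b) + (f a - f b) *m B.
    rewrite /h mulmxBl; move: (f a *m B) (f b *m B) => x y.
    by apply/rowP => i; rewrite !mxE; ring.
  have := ler_normD (h a - h b) ((f a - f b) *m B); rewrite -e.
  by have := HC (f a - f b); lra.
have inv w : exists q, V w -> W q /\ f q = w.
  have [[q Wq fq]|nV] := pselect (V w); first by exists q.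
  by exists 0 => /nV.
have [g gE] := choice inv.
have gK q : W q -> V (f q) /\ g (f q) = q.
  move=> Wq; have Vq : V (f q) by exists q.
  split=> //; have [Wg fg] := gE _ Vq; apply/eqP; rewrite -subr_eq0 -normr_le0.
  by apply: le_trans (lip _ _ Wg Wq) _; rewrite fg subrr normr0 mulr0.
exists W, V, g; split => //; first exact: ballxx.
split => //.
(* If the jacobian killed v, then for small t the map f would move by at most [(4 * C)^-1 * |t v|]
   between q and q + t v, and [lip] would make [|t v|] at most half of itself. *)
have uJq q : W q -> jacobian f q \in unitmx.
  move=> Wq; rewrite -row_free_unit; apply: inj_row_free => v.
  rewrite -deriveEjacobian; last exact/df/rO.
  rewrite deriveE; last exact/df/rO.
  move=> dv0.
  have e0 : 0 < (4 * C)^-1 by rewrite invr_gt0 mulr_gt0.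
  have near1 := differentiable_eps (df _ (rO _ Wq)) e0.
  have near2 : \forall y \near q, W y by exact: open_nbhs_nbhs.
  have near3 : \forall t \near (0 : R), 
     W (q + t *: v) /\ `|f (q + t *: v) - f q - 'd f q (q + t *: v - q)| <=
       (4 * C)^-1 * `|q + t *: v - q|.
    have c : {for 0, continuous (fun t : R => q + t *: v)}.
      by apply: cvgD; [exact: cvg_cst|exact: scalel_continuous].
    have cc : nbhs (q + 0 *: v) (fun y => W y /\ `|f y - f q - 'd f q (y - q)| <=
       (4 * C)^-1 * `|y - q|).
      by rewrite scale0r addr0; exact: filterI near2 near1.
    exact: (c _ cc).
  have [s /= s0 Hs] := near3.
  have bs : ball_ [eta Num.Def.normr] 0 s (s / 2).
    by rewrite /= sub0r normrN gtr0_norm ?divr_gt0 //; lra.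
  have [Ws] := Hs _ bs; rewrite [q + _ - q]addrC addKr linearZ /= dv0 scaler0 subr0.
  have := lip _ _ Ws Wq; rewrite [q + _ - q]addrC addKr.
  set x := `|f _ - _|; set y := `|_ *: v| => l1 l2.
  have : y <= 2^-1 * y.
    apply: le_trans l1 _; rewrite -mulrA.
    have -> : 2^-1 * y = 2 * (C * ((4 * C)^-1 * y)) by field; rewrite gt_eqF.
    by rewrite !ler_pM2l.
  move=> yy; have y0 : y <= 0 by lra.
  have : y == 0 by rewrite -normr_le0 normr_id.
  by rewrite normr_eq0 scaler_eq0 mulf_eq0 gt_eqF //= invr_eq0 pnatr_eq0 /= => /eqP.
have gcont w : V w -> {for w, continuous g}.
  move=> Vw; apply/(@cvgrPdist_lt _ _ _ _ (nbhs_filter w)) => e e0.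
  have nV : \forall y \near w, V y by exact: open_nbhs_nbhs.
  have e1 : 0 < (2 * C)^-1 * e by rewrite mulr_gt0 // invr_gt0 mulr_gt0.
  have [/= d d0 Hd] := (nbhs_ballP _ _).1 nV.
  apply/nbhs_ballP; exists (Num.min d ((2 * C)^-1 * e)) => /=; first by rewrite lt_min d0.
  move=> y; rewrite -ball_normE /= lt_min => /andP[yd ye].
  have Vy : V y by apply: Hd; rewrite -ball_normE.
  have [Wgw fgw] := gE _ Vw; have [Wgy fgy] := gE _ Vy.
  apply: le_lt_trans (lip _ _ Wgw Wgy) _.
  by rewrite fgw fgy -ltr_pdivlMl ?mulr_gt0.
(* Since the inverse is Lipschitz, an error small against [|g y - g w|] is small against
   [|y - w|]. *)
have dg w : V w -> differentiable g w /\
    ('d g w = (fun v => v *m invmx (jacobian f (g w))) :> (_ -> _)).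
  move=> Vw; have [Wgw fgw] := gE _ Vw; set M := jacobian f (g w).
  have uM : M \in unitmx by exact: uJq.
  apply: (@differentiable_epsP _ _ _ _ _ (mulmxr (invmx M))).
    exact: mulmxr_continuous.
  move=> eps eps0.
  have [C' [C'0 HC']] := mulmx_bounded (invmx M).
  pose e1 := eps / (C' * (2 * C)).
  have e10 : 0 < e1 by rewrite divr_gt0 // !mulr_gt0.
  have := gcont w Vw _ (differentiable_eps (df _ (rO _ Wgw)) e10).
  have nV : \forall y \near w, V y by exact: open_nbhs_nbhs.
  apply: filterS2 nV => y Vy /=.
  have [Wgy fgy] := gE _ Vy; rewrite fgy fgw.
  have -> : 'd f (g w) (g y - g w) = (g y - g w) *m M.
    by rewrite -deriveE ?deriveEjacobian //; exact/df/rO.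
  set D := _ - _ - _ => HD.
  have -> : g y - g w - (y - w) *m invmx M = - (D *m invmx M).
    by rewrite /D [in RHS]mulmxBl mulmxK // opprB.
  rewrite normrN; apply: le_trans (HC' _) _.
  have l := lip _ _ Wgy Wgw; rewrite fgy fgw in l.
  have -> : eps * `|y - w| = C' * (e1 * (2 * C * `|y - w|)).
    by rewrite /e1; field; rewrite !gt_eqF.
  rewrite ler_pM2l //; apply: le_trans HD _.
  by rewrite ler_pM2l.
elim=> [|k IH]; first by move=> w /gcont.
split=> [w /dg[]//|v].
have entry a b : Ck k V (fun w => jacobian f (g w) a b).
  have Ca : Ck k Om (fun q => ('D_(delta_mx 0 a) f q) 0 b).
    by apply: Ck_row => //; have [_ +] := Cf k.+1; apply.
  have Cc := Ck_comp oV (fun w Vw => rO _ (gE w Vw).1) IH Ca.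
  apply: Ck_ext Cc => // w Vw /=.
  by rewrite deriveEjacobian ?rowE -?rowE ?mxE //; exact/df/rO/(gE w Vw).1.
(* Cramer's rule expresses the inverse matrix by minors and the determinant, to which the [Ck]
   lemmas apply. *)
have Cinv : Ck k V (fun w => v *m ((\det (jacobian f (g w)))^-1 *: \adj (jacobian f (g w)))).
  apply: Ck_rowP => // i.
  rewrite [X in Ck _ _ X](_ : _ = fun w => \sum_j v 0 j *
     ((\det (jacobian f (g w)))^-1 * ((-1) ^+ (i + j) * \det (row' i (col' j (jacobian f (g w))))))); last first.
    by apply/funext => w; rewrite mxE; apply: eq_bigr => j _; rewrite !mxE.
  apply: Ck_sum => // j _; apply: CkM => //; first exact: Ck_cst.
  apply: CkM => //.
    apply: CkV => // [w Vw|]; last exact: Ck_det.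
    by rewrite -unitfE -unitmxE; exact/uJq/(gE w Vw).1.
  apply: CkM => //; first exact: Ck_cst.
  apply: Ck_det => // a b.
  rewrite [X in Ck _ _ X](_ : _ = fun w => jacobian f (g w) (lift i a) (lift j b)) //.
  by apply/funext => w; rewrite !mxE.
apply: Ck_ext Cinv => // w Vw.
rewrite deriveE; last exact: (dg w Vw).1.
by rewrite (dg w Vw).2 /= /invmx (uJq _ (gE w Vw).1).
Qed.

End InverseFunction.

(** * Explicit determinants and coordinates of Minkowski vectors *)

Section Determinants.
Context {R : comNzRingType}.
Implicit Types F : nat -> nat -> R.

(** Entries are functions of natural numbers so that the [bump] of a minor computes; each size then
    expands through the previous one. *)
Lemma det2F F : \det (\matrix_(i < 2, j < 2) F i j) = F 0%N 0%N * F 1%N 1%N - F 0%N 1%N * F 1%N 0%N.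
Proof.
rewrite (expand_det_row _ ord0) !big_ord_recl big_ord0 /cofactor !det_mx11 !mxE /=.
by rewrite /bump /=; ring.
Qed.

Lemma det3F F : \det (\matrix_(i < 3, j < 3) F i j) =
  F 0%N 0%N * (F 1%N 1%N * F 2%N 2%N - F 1%N 2%N * F 2%N 1%N)
  - F 0%N 1%N * (F 1%N 0%N * F 2%N 2%N - F 1%N 2%N * F 2%N 0%N)
  + F 0%N 2%N * (F 1%N 0%N * F 2%N 1%N - F 1%N 1%N * F 2%N 0%N).
Proof.
have E k : \det (row' ord0 (col' k (\matrix_(i < 3, j < 3) F i j))) =
  \det (\matrix_(i < 2, j < 2) F (bump 0 i) (bump k j)).
  by congr (\det _); apply/matrixP => i j; rewrite !mxE.
rewrite (expand_det_row _ ord0) !big_ord_recl big_ord0 /cofactor !E.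
rewrite !(det2F (fun i j => F (bump 0 i) (bump _ j))) !mxE /= /bump /=.
ring.
Qed.

Lemma det4F F : \det (\matrix_(i < 4, j < 4) F i j) =
  let m a b c := F 1%N a * (F 2%N b * F 3%N c - F 2%N c * F 3%N b)
    - F 1%N b * (F 2%N a * F 3%N c - F 2%N c * F 3%N a)
    + F 1%N c * (F 2%N a * F 3%N b - F 2%N b * F 3%N a) in
  F 0%N 0%N * m 1%N 2%N 3%N - F 0%N 1%N * m 0%N 2%N 3%N
  + F 0%N 2%N * m 0%N 1%N 3%N - F 0%N 3%N * m 0%N 1%N 2%N.
Proof.
have E k : \det (row' ord0 (col' k (\matrix_(i < 4, j < 4) F i j))) =
  \det (\matrix_(i < 3, j < 3) F (bump 0 i) (bump k j)).
  by congr (\det _); apply/matrixP => i j; rewrite !mxE.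
rewrite (expand_det_row _ ord0) !big_ord_recl big_ord0 /cofactor !E.
rewrite !(det3F (fun i j => F (bump 0 i) (bump _ j))) !mxE /= /bump /=.
ring.
Qed.

End Determinants.

Section Coordinates.
Context {R : realType}.

(** Indices are natural numbers, so that explicit coordinates need no ordinals and ['rV[R]_(1 + 3)]
    is read as ['rV[R]_4]. *)
Definition crd n (v : 'rV[R]_n.+1) (k : nat) : R := v 0 (inord k).

Lemma crdE n (v : 'rV[R]_n.+1) (i : 'I_n.+1) : v 0 i = crd v i.
Proof. by rewrite /crd inord_val. Qed.

Lemma rowP_crd n (u v : 'rV[R]_n.+1) :
  (forall k, (k < n.+1)%N -> crd u k = crd v k) -> u = v.
Proof. by move=> H; apply/rowP => i; rewrite !crdE H. Qed.

Lemma crdD n (u v : 'rV[R]_n.+1) k : crd (u + v) k = crd u k + crd v k.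
Proof. by rewrite /crd mxE. Qed.
Lemma crdN n (u : 'rV[R]_n.+1) k : crd (- u) k = - crd u k.
Proof. by rewrite /crd mxE. Qed.
Lemma crdZ n (u : 'rV[R]_n.+1) a k : crd (a *: u) k = a * crd u k.
Proof. by rewrite /crd mxE. Qed.
Lemma crd0 n k : crd (0 : 'rV[R]_n.+1) k = 0.
Proof. by rewrite /crd mxE. Qed.

Definition crdM := (crdD, crdN, crdZ, crd0).

Lemma dot3E (u v : 'rV[R]_3) : dot u v =
  crd u 0 * crd v 0 + crd u 1 * crd v 1 + crd u 2 * crd v 2.
Proof. by rewrite /dot !big_ord_recl big_ord0 !crdE /= /bump /= addr0 addrA. Qed.

Lemma crd_rsubmx (v : 'rV[R]_(1 + 3)) k : (k < 3)%N -> crd (rsubmx v) k = crd (v : 'rV_4) k.+1.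
Proof.
move=> k3; rewrite /crd mxE; congr (v 0 _); apply/val_inj => /=.
by rewrite !inordK // ltnS.
Qed.

Lemma crd_light (u : 'rV[R]_3) k : (k < 3)%N ->
  crd (light u : 'rV_4) k.+1 = crd u k.
Proof.
move=> k3; rewrite /crd /light.
have -> : inord k.+1 = rshift 1 (inord k : 'I_3).
  by apply/val_inj; rewrite /= !inordK // ltnS.
exact: (@row_mxEr R 1 1 3).
Qed.

Lemma crd_light0 (u : 'rV[R]_3) : crd (light u : 'rV_4) 0 = 1.
Proof.
rewrite /crd /light.
have -> : inord 0 = lshift 3 (0 : 'I_1) by apply/val_inj; rewrite /= inordK.
by rewrite (@row_mxEl R 1 1 3) mxE.
Qed.

Lemma crd_time (v : 'rV[R]_(1 + 3)) : v 0 0 = crd (v : 'rV_4) 0.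
Proof. by rewrite crdE. Qed.

Lemma minkE (v n : 'rV[R]_(1 + 3)) : mink v n =
  crd (v : 'rV_4) 1 * crd (n : 'rV_4) 1 + crd (v : 'rV_4) 2 * crd (n : 'rV_4) 2
  + crd (v : 'rV_4) 3 * crd (n : 'rV_4) 3 - crd (v : 'rV_4) 0 * crd (n : 'rV_4) 0.
Proof. by rewrite /mink dot3E !crd_rsubmx // !crd_time. Qed.

Lemma vol_crd n (s : n.+1.-tuple 'rV[R]_n.+1) :
  vol s = \det (\matrix_(i < n.+1, j < n.+1) crd (nth 0 s i) j).
Proof.
by congr (\det _); apply/matrixP => i j; rewrite !mxE crdE (tnth_nth 0).
Qed.

Lemma vol2E (a b : 'rV[R]_2) :
  vol [tuple a; b] = crd a 0 * crd b 1 - crd a 1 * crd b 0.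
Proof. by rewrite vol_crd (det2F (fun i j => crd (nth 0 [:: a; b] i) j)). Qed.

Lemma vol3E (a b c : 'rV[R]_3) : vol [tuple a; b; c] =
  crd a 0 * (crd b 1 * crd c 2 - crd b 2 * crd c 1)
  - crd a 1 * (crd b 0 * crd c 2 - crd b 2 * crd c 0)
  + crd a 2 * (crd b 0 * crd c 1 - crd b 1 * crd c 0).
Proof. by rewrite vol_crd (det3F (fun i j => crd (nth 0 [:: a; b; c] i) j)). Qed.

Lemma vol4E (a b c d : 'rV[R]_(1 + 3)) : vol [tuple a; b; c; d] =
  let F i j := crd (nth 0 [:: a : 'rV_4; b : 'rV_4; c : 'rV_4; d : 'rV_4] i) j in
  let m a b c := F 1%N a * (F 2%N b * F 3%N c - F 2%N c * F 3%N b)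
    - F 1%N b * (F 2%N a * F 3%N c - F 2%N c * F 3%N a)
    + F 1%N c * (F 2%N a * F 3%N b - F 2%N b * F 3%N a) in
  F 0%N 0%N * m 1%N 2%N 3%N - F 0%N 1%N * m 0%N 2%N 3%N
  + F 0%N 2%N * m 0%N 1%N 3%N - F 0%N 3%N * m 0%N 1%N 2%N.
Proof.
rewrite (@vol_crd 3).
exact: (det4F (fun i j => crd (nth 0 [:: a : 'rV_4; b : 'rV_4; c : 'rV_4; d : 'rV_4] i) j)).
Qed.

End Coordinates.

(** * Causality, Gram determinants and the Minkowski cross product *)

Section Minkowski.
Context {R : realType}.
Implicit Types (a b c d u v w p q n e k : 'rV[R]_(1 + 3)) (s t : R).

Lemma minkC a b : mink a b = mink b a.
Proof. by rewrite !minkE; ring. Qed.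
Lemma minkDl a b c : mink (a + b) c = mink a c + mink b c.
Proof. by rewrite !minkE !crdM; ring. Qed.
Lemma minkDr a b c : mink c (a + b) = mink c a + mink c b.
Proof. by rewrite !minkE !crdM; ring. Qed.
Lemma minkNl a c : mink (- a) c = - mink a c.
Proof. by rewrite !minkE !crdM; ring. Qed.
Lemma minkNr a c : mink c (- a) = - mink c a.
Proof. by rewrite !minkE !crdM; ring. Qed.
Lemma minkZl s a c : mink (s *: a) c = s * mink a c.
Proof. by rewrite !minkE !crdM; ring. Qed.
Lemma minkZr s a c : mink c (s *: a) = s * mink c a.
Proof. by rewrite !minkE !crdM; ring. Qed.
Lemma mink0l c : mink 0 c = 0.
Proof. by rewrite !minkE !crdM; ring. Qed.

Definition mink_lin := (minkDl, minkDr, minkNl, minkNr, minkZl, minkZr, mink0l).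

(** Cauchy-Schwarz on the spatial parts bounds [e0^2 v0^2] by the product of the spatial squares of
    e and v, and the spatial square of e is smaller than [e0^2]. *)
Lemma timelike_orthogonal_ge0 e v : mink e e < 0 -> mink e v = 0 ->
  0 <= mink v v /\ (mink v v = 0 -> v = 0).
Proof.
rewrite !minkE; set e0 := crd _ 0; set e1 := crd _ 1; set e2 := crd _ 2.
set e3 := crd _ 3; set v0 := crd (v : 'rV_4) 0; set v1 := crd (v : 'rV_4) 1.
set v2 := crd (v : 'rV_4) 2; set v3 := crd (v : 'rV_4) 3 => he hv.
have cs : (e1 * v1 + e2 * v2 + e3 * v3) ^+ 2 <=
   (e1 ^+ 2 + e2 ^+ 2 + e3 ^+ 2) * (v1 ^+ 2 + v2 ^+ 2 + v3 ^+ 2).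
  rewrite -subr_ge0 [leRHS](_ : _ = (e1 * v2 - e2 * v1) ^+ 2 + (e1 * v3 - e3 * v1) ^+ 2
    + (e2 * v3 - e3 * v2) ^+ 2); last by ring.
  by rewrite !addr_ge0 // sqr_ge0.
have hv' : e1 * v1 + e2 * v2 + e3 * v3 = e0 * v0 by lra.
rewrite hv' in cs.
pose E := e1 ^+ 2 + e2 ^+ 2 + e3 ^+ 2; pose V := v1 ^+ 2 + v2 ^+ 2 + v3 ^+ 2.
have E0 : 0 <= E by rewrite !addr_ge0 // sqr_ge0.
have V0 : 0 <= V by rewrite !addr_ge0 // sqr_ge0.
have eE : E < e0 ^+ 2 by rewrite /E !expr2; lra.
have VE : v1 * v1 + v2 * v2 + v3 * v3 - v0 * v0 = V - v0 ^+ 2 by rewrite /V; ring.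
have e00 : 0 < e0 ^+ 2 by exact: le_lt_trans E0 eE.
have key : e0 ^+ 2 * v0 ^+ 2 <= E * V by rewrite -exprMn.
have vV : v0 ^+ 2 <= V.
  rewrite -(ler_pM2l e00); apply: le_trans key _; exact: ler_wpM2r (ltW eE).
rewrite VE; split; first by rewrite subr_ge0.
move=> /eqP; rewrite subr_eq0 => /eqP V0'.
have VV : V = 0.
  apply/eqP; rewrite eq_le V0 andbT leNgt; apply/negP => Vp.
  by move: key; rewrite -V0' ler_pM2r // leNgt eE.
have sq0 : v0 ^+ 2 = 0 by rewrite -V0'.
have s1 := sqr_ge0 v1; have s2 := sqr_ge0 v2; have s3 := sqr_ge0 v3.
have q1 : v1 ^+ 2 = 0 by rewrite /V in VV; lra.
have q2 : v2 ^+ 2 = 0 by rewrite /V in VV; lra.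
have q3 : v3 ^+ 2 = 0 by rewrite /V in VV; lra.
apply: (@rowP_crd R 3) => -[|[|[|[|//]]]] _; rewrite crd0; apply/eqP;
  by rewrite -sqrf_eq0 ?sq0 ?q1 ?q2 ?q3.
Qed.

(** Cauchy-Schwarz on the spatial parts, whose lengths are at most the time coordinates. *)
Lemma causal_le0 a b : mink a a <= 0 -> mink b b <= 0 ->
  0 <= crd (a : 'rV_4) 0 -> 0 <= crd (b : 'rV_4) 0 -> mink a b <= 0.
Proof.
rewrite !minkE; set a0 := crd _ 0; set a1 := crd _ 1; set a2 := crd _ 2.
set a3 := crd _ 3; set b0 := crd (b : 'rV_4) 0; set b1 := crd (b : 'rV_4) 1.
set b2 := crd (b : 'rV_4) 2; set b3 := crd (b : 'rV_4) 3 => ha hb ha0 hb0.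
have cs : (a1 * b1 + a2 * b2 + a3 * b3) ^+ 2 <=
   (a1 ^+ 2 + a2 ^+ 2 + a3 ^+ 2) * (b1 ^+ 2 + b2 ^+ 2 + b3 ^+ 2).
  rewrite -subr_ge0 [leRHS](_ : _ = (a1 * b2 - a2 * b1) ^+ 2 + (a1 * b3 - a3 * b1) ^+ 2
    + (a2 * b3 - a3 * b2) ^+ 2); last by ring.
  by rewrite !addr_ge0 // sqr_ge0.
rewrite subr_le0; apply: le_trans (ler_norm _) _.
rewrite -(@ler_pXn2r _ 2) ?nnegrE ?normr_ge0 ?mulr_ge0 // real_normK ?num_real //.
apply: le_trans cs _; rewrite exprMn; apply: ler_pM.
- by rewrite !addr_ge0 // sqr_ge0.
- by rewrite !addr_ge0 // sqr_ge0.
- by rewrite !expr2; lra.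
- by rewrite !expr2; lra.
Qed.

Lemma H3_time_gt0 p : H3 p -> 0 < crd (p : 'rV_4) 0.
Proof. by case=> _; rewrite crd_time. Qed.

Lemma H3_null_time p k : H3 p -> mink k k = 0 -> mink p k < 0 -> 0 < crd (k : 'rV_4) 0.
Proof.
move=> Hp kk pk; have pt := H3_time_gt0 Hp; case: Hp => pp _.
rewrite ltNge; apply/negP => k0.
have : mink p (- k) <= 0.
  apply: causal_le0; [by rewrite pp; lra| |exact: ltW|by rewrite crdN; lra].
  by rewrite !mink_lin kk; lra.
by rewrite mink_lin; lra.
Qed.

Lemma H3_null_lt0 p k : H3 p -> mink k k = 0 -> 0 < crd (k : 'rV_4) 0 -> mink p k < 0.
Proof.
move=> Hp kk k0; have pt := H3_time_gt0 Hp; case: Hp => pp _.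
have pk0 : mink p k <= 0.
  by apply: causal_le0; [rewrite pp; lra|rewrite kk|exact: ltW|exact: ltW].
rewrite lt_neqAle pk0 andbT.
apply/eqP => pk; have pp0 : mink p p < 0 by rewrite pp; lra.
have [_ /(_ kk) kz] := timelike_orthogonal_ge0 pp0 pk.
by move: k0; rewrite kz crd0 ltxx.
Qed.

(** The component [q + <p, q> p] of q orthogonal to p has square [<p, q>^2 - 1], which is
    nonnegative; the sign is that of causal vectors of the same time orientation. *)
Lemma H3_mink_le p q : H3 p -> H3 q -> mink p q <= -1.
Proof.
move=> Hp Hq; have pt := H3_time_gt0 Hp; have qt := H3_time_gt0 Hq.
have [pp _] := Hp; have [qq _] := Hq.
have pq : mink p q <= 0 by apply: causal_le0; [rewrite pp; lra|rewrite qq; lra|exact: ltW|exact: ltW].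
have pp0 : mink p p < 0 by rewrite pp; lra.
have [|] := @timelike_orthogonal_ge0 p (q + mink p q *: p) pp0.
  by rewrite !mink_lin pp; lra.
rewrite !mink_lin pp qq [mink q p]minkC => h _.
by set x := mink p q in h pq *; nra.
Qed.

(** The sign is the determinant of the matrix [diag(-1, 1, 1, 1)] of the form. *)
Lemma vol_gram (x y : 4.-tuple 'rV[R]_(1 + 3)) :
  vol x * vol y = - \det (\matrix_(i < 4, j < 4) mink (tnth x i) (tnth y j)).
Proof.
pose g : 'rV[R]_4 := \row_j (if j == 0 :> nat then -1 else 1).
have dG : \det (diag_mx g) = -1.
  by rewrite det_diag !big_ord_recl big_ord0 !mxE /= !mulr1.
pose A : 'M[R]_4 := \matrix_i tnth x i; pose B : 'M[R]_4 := \matrix_i tnth y i.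
have -> : \matrix_(i < 4, j < 4) mink (tnth x i) (tnth y j) = A *m diag_mx g *m B^T.
  apply/matrixP => i j; rewrite mul_mx_diag !mxE !big_ord_recl big_ord0 !mxE minkE.
  by rewrite !crdE /= /bump /=; ring.
by rewrite !det_mulmx det_tr dG mulrN1 mulNr opprK.
Qed.

Lemma mink_nondegenerate a b c d w : vol [tuple a; b; c; d] != 0 ->
  mink a w = 0 -> mink b w = 0 -> mink c w = 0 -> mink d w = 0 -> w = 0.
Proof.
move=> v0 aw bw cw dw.
pose A : 'M[R]_4 := \matrix_i tnth [tuple a; b; c; d] i.
pose g : 'rV[R]_4 := \row_j (if j == 0 :> nat then -1 else 1).
have uA : A \in unitmx by rewrite unitmxE unitfE.
have Aw : A *m (diag_mx g *m (w : 'rV_4)^T) = 0.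
  apply/matrixP => i j; rewrite ord1 mulmxA mul_mx_diag !mxE.
  rewrite (_ : \sum_(k < 4) _ = mink (tnth [tuple a; b; c; d] i) w).
    by case: i => -[|[|[|[|//]]]] hi.
  rewrite !big_ord_recl big_ord0 !mxE minkE !crdE /= /bump /=; ring.
have : diag_mx g *m (w : 'rV_4)^T = 0.
  by rewrite -[LHS](mulKmx uA) Aw mulmx0.
move=> /matrixP Dw; apply: (@rowP_crd R 3) => k k4.
have := Dw (Ordinal k4) 0; rewrite mul_diag_mx !mxE crd0 crdE /=.
by case: ifP => _; lra.
Qed.

Definition minor3 (a b c : 'rV[R]_4) (i j k : nat) : R :=
  crd a i * (crd b j * crd c k - crd b k * crd c j)
  - crd a j * (crd b i * crd c k - crd b k * crd c i)
  + crd a k * (crd b i * crd c j - crd b j * crd c i).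

(** The signs are those for which pairing with this vector is [vol] ([mink_cross]): the minors of
    the last row of a determinant, the time entry absorbing the minus sign of [mink]. *)
Definition cross (a b c : 'rV[R]_4) : 'rV[R]_(1 + 3) := \row_(j < 4)
  nth 0 [:: minor3 a b c 1 2 3; minor3 a b c 0 2 3;
           - minor3 a b c 0 1 3; minor3 a b c 0 1 2] j.

Lemma crd_cross (a b c : 'rV[R]_4) (k : nat) : (k < 4)%N -> crd (cross a b c : 'rV_4) k =
  nth 0 [:: minor3 a b c 1 2 3; minor3 a b c 0 2 3;
           - minor3 a b c 0 1 3; minor3 a b c 0 1 2] k.
Proof. by move=> k4; rewrite /crd mxE inordK. Qed.

Lemma mink_cross a b c d : mink d (cross a b c) = vol [tuple a; b; c; d].
Proof. by rewrite vol4E minkE !crd_cross //= /minor3; ring. Qed.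

Lemma mink_cross_cross a b c : mink (cross a b c) (cross a b c) =
  - (mink a a * (mink b b * mink c c - mink b c ^+ 2)
     - mink a b * (mink a b * mink c c - mink b c * mink a c)
     + mink a c * (mink a b * mink b c - mink b b * mink a c)).
Proof. by rewrite !minkE !crd_cross //= /minor3; ring. Qed.

End Minkowski.

(** * Adapted frames, horoballs and their asymptotic curvature *)

Section HyperbolicGeometry.
Context {R : realType}.
Implicit Types (a b p q n v : 'rV[R]_(1 + 3)) (y : 'rV[R]_3).

Definition orthonormal_frame p n v1 v2 : Prop :=
  [/\ mink p p = -1, mink n n = 1, mink v1 v1 = 1 & mink v2 v2 = 1] /\
  [/\ mink p n = 0, mink p v1 = 0 & mink p v2 = 0] /\
  [/\ mink n v1 = 0, mink n v2 = 0 & mink v1 v2 = 0].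

(** The Gram determinant of the frame is -1, so the frame is a basis and a vector orthogonal to it
    vanishes. *)
Lemma frame_expand p n v1 v2 a : orthonormal_frame p n v1 v2 ->
  a = - mink a p *: p + mink a n *: n + mink a v1 *: v1 + mink a v2 *: v2.
Proof.
case=> [[pp nn v11 v22] [[pn p1 p2] [n1 n2 v12]]].
have v0 : vol [tuple p; n; v1; v2] != 0.
  have := vol_gram [tuple p; n; v1; v2] [tuple p; n; v1; v2].
  pose t := [:: p; n; v1; v2].
  rewrite (_ : (\matrix_(i, j) _) = \matrix_(i < 4, j < 4) mink (nth 0 t i) (nth 0 t j)); last first.
    by apply/matrixP => i j; rewrite !mxE !(tnth_nth 0).
  rewrite (det4F (fun i j => mink (nth 0 t i) (nth 0 t j))) /=.
  rewrite pp nn v11 v22 pn p1 p2 n1 n2 v12 ![mink _ p]minkC [mink v1 n]minkC ![mink v2 _]minkC.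
  rewrite pn p1 p2 n1 n2 v12 => H; apply/eqP => v0; move: H; rewrite v0; lra.
apply/eqP; rewrite -subr_eq0; apply/eqP.
by apply: (mink_nondegenerate v0); rewrite !mink_lin ?(minkC n p) ?(minkC v1 p)
  ?(minkC v1 n) ?(minkC v2 p) ?(minkC v2 n) ?(minkC v2 v1)
  ?pp ?nn ?v11 ?v22 ?pn ?p1 ?p2 ?n1 ?n2 ?v12 ?[mink _ a]minkC; ring.
Qed.

(** Gram-Schmidt on d0 and d1, which lie in the spacelike orthogonal complement of p; the nonzero
    volume keeps both resulting vectors nonzero. It is applied to the images of a tangent basis. *)
Lemma exists_frame p n d0 d1 : H3 p -> mink n n = 1 -> mink p n = 0 ->
  mink p d0 = 0 -> mink p d1 = 0 -> mink n d0 = 0 -> mink n d1 = 0 ->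
  vol [tuple p; d0; d1; n] != 0 ->
  exists v1 v2, orthonormal_frame p n v1 v2.
Proof.
move=> [pp _] nn pn p0 p1 n0 n1 v0.
have pp0 : mink p p < 0 by rewrite pp; lra.
have volM (s : R) : vol [tuple p; d0; s *: d0; n] = 0.
  by rewrite vol4E /= !crdM; ring.
have [d00 d00'] := timelike_orthogonal_ge0 pp0 p0.
have d0n : 0 < mink d0 d0.
  rewrite lt_neqAle d00 andbT eq_sym; apply/eqP => /d00' d0z.
  by move/eqP: v0; apply; rewrite vol4E /= d0z !crdM; ring.
pose c := mink d1 d0 / mink d0 d0; pose w := d1 - c *: d0.
have wd0 : mink w d0 = 0 by rewrite !mink_lin /c divfK ?gt_eqF // subrr.
have pw : mink p w = 0 by rewrite !mink_lin p0 p1; ring.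
have nw : mink n w = 0 by rewrite !mink_lin n0 n1; ring.
have [w0 w0'] := timelike_orthogonal_ge0 pp0 pw.
have wn : 0 < mink w w.
  rewrite lt_neqAle w0 andbT eq_sym; apply/eqP => /w0' /eqP; rewrite subr_eq0 => /eqP wz.
  by move/eqP: v0; apply; rewrite wz.
have sq x : 0 < x -> (Num.sqrt x)^-1 * ((Num.sqrt x)^-1 * x) = 1 :> R.
  move=> x0; rewrite mulrA -invfM -expr2 sqr_sqrtr ?ltW // mulVf // gt_eqF //.
exists ((Num.sqrt (mink d0 d0))^-1 *: d0), ((Num.sqrt (mink w w))^-1 *: w).
by split; [|split]; split; rewrite // ?(minkZl, minkZr) ?sq // ?p0 ?n0 ?pw ?nw ?mulr0 //
  (minkC d0 w) wd0 !mulr0.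
Qed.

Lemma cosh_sinh (t : R) : cosh t ^+ 2 - sinh t ^+ 2 = 1.
Proof.
have E : expR t * expR (- t) = 1 by exact: expRxMexpNx_1.
by rewrite /cosh /sinh; field: E.
Qed.

Lemma cosh_gt0 (t : R) : 0 < cosh t.
Proof. by rewrite divr_gt0 // addr_gt0 // expR_gt0. Qed.

Lemma H3_geodesic p v t : H3 p -> mink v v = 1 -> mink p v = 0 -> H3 (geodesic p v t).
Proof.
move=> Hp vv pv; have pt := H3_time_gt0 Hp; have [pp _] := Hp.
have gg : mink (geodesic p v t) (geodesic p v t) = -1.
  have E := cosh_sinh t; rewrite /geodesic !mink_lin [mink v p]minkC pp vv pv.
  by move: (cosh t) (sinh t) E => x z E; lra.
split; first exact: gg.
rewrite crd_time ltNge; apply/negP => g0.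
have : mink p (- geodesic p v t) <= 0.
  apply: causal_le0; [by rewrite pp; lra|by rewrite minkNl minkNr opprK gg; lra|exact: ltW|].
  by rewrite crdN; lra.
have := cosh_gt0 t; rewrite /geodesic !mink_lin pp pv; lra.
Qed.

Lemma mink_geodesic_null p v k t : mink p k + mink v k = 0 ->
  mink (geodesic p v t) k = expR (- t) * mink p k.
Proof.
move=> /eqP; rewrite addr_eq0 => /eqP E.
rewrite /geodesic !mink_lin (_ : mink v k = - mink p k); last by rewrite E opprK.
by rewrite /cosh /sinh; field.
Qed.

Lemma light_null y : boundary y -> mink (light y) (light y) = 0.
Proof. by rewrite /boundary /= dot3E minkE !crd_light // !crd_light0 /= => ->; lra. Qed.

(** The half-space tangent at p has unit normal [s^-1 *: light y - p], which pairs with [light y] to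
    s wherever p lies on the horosphere; hence the factor [s ^+ 2]. It contains the horoball because
    [mink q p <= -1] for q in H3. *)
Lemma asymptotic_curvature_point y p s w : boundary y -> H3 p -> 0 < s ->
  - mink p (light y) = s ->
  eq_form_at y w (fun x1 x2 => vol [tuple y; x1; x2] / s ^+ 2) ->
  asymptotic_curvature y s w.
Proof.
move=> by_ Hp s0 ps ww; have ll := light_null by_; have [pp _] := Hp.
have lp : mink p (light y) = - s by lra.
exists (s^-1 *: light y - p); split.
- rewrite /spacelike_unit !mink_lin ll pp [mink (light y) p]minkC lp; field.
  by rewrite gt_eqF.
- move=> q [Hq qs]; split=> //; rewrite !mink_lin.
  have := H3_mink_le Hq Hp.
  have : -1 < s^-1 * mink q (light y) by rewrite ltr_pdivlMl // mulrN1; lra.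
  by lra.
- exists p; split => //; first by rewrite !mink_lin lp pp; field; rewrite gt_eqF.
  move=> v vp; rewrite !mink_lin vp subr0; split => [/eqP|->]; last by rewrite mulr0.
  by rewrite mulf_eq0 invr_eq0 gt_eqF //= => /eqP.
- move=> v1 v2 yv1 yv2; rewrite ww // /hyperbolic_area; congr (_ / _ ^+ 2).
  by rewrite !mink_lin ll [mink (light y) p]minkC lp; ring.
Qed.

(** The horosphere at y through p has parameter [lam^-1], and the horoball of curvature factor c has
    parameter [1 / sqrt c], at least as large. So the geodesic from p to y is inside this horoball
    at all positive times, and p is the limit of its points. When c is 0 the horoball is all of H3
    by convention. *)
Lemma closure_horoball_of y p v lam c w : boundary y -> H3 p -> mink v v = 1 ->
  mink p v = 0 -> 0 < lam -> p + v = lam *: light y ->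
  0 <= c -> c <= lam ^+ 2 ->
  eq_form_at y w (fun x1 x2 => vol [tuple y; x1; x2] * c) ->
  closure (horoball_of y w) p.
Proof.
move=> by_ Hp vv pv l0 pvl c0 cl ww.
have [pp _] := Hp; have ll := light_null by_.
have lpE : light y = lam^-1 *: (p + v) by rewrite pvl scalerA mulVf ?gt_eqF // scale1r.
have pl : mink p (light y) = - lam^-1 by rewrite lpE !mink_lin pp pv; ring.
have vl : mink v (light y) = lam^-1 by rewrite lpE !mink_lin vv minkC pv; ring.
have pvl0 : mink p (light y) + mink v (light y) = 0 by rewrite pl vl addNr.
have gc : {for 0, continuous (geodesic p v)}.
  have cN : {for 0, continuous (fun t : R => expR (- t))}.
    apply: (@continuous_comp _ _ _ (fun t : R => - t) (@expR R)).
      by apply: cvgN; exact: cvg_id.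
    exact: continuous_expR.
  have ce : {for 0, continuous (@expR R)} by exact: continuous_expR.
  by apply: cvgD; apply: cvgZl; apply: cvgMl; [apply: cvgD|apply: cvgB].
have g0 : geodesic p v 0 = p.
  by rewrite /geodesic /cosh /sinh oppr0 expR0 subrr mul0r scale0r addr0 -mulr2n -mulr_natl
    mulr1 divff // scale1r.
have [c00|c00] := eqVneq c 0.
  apply: subset_closure; split => //; left => v1 v2 h1 h2.
  by rewrite ww // c00 mulr0.
have cp : 0 < c by rewrite lt_neqAle eq_sym c00.
pose s := (Num.sqrt c)^-1.
have sc0 : 0 < Num.sqrt c by rewrite sqrtr_gt0.
have s0 : 0 < s by rewrite invr_gt0.
have ls : lam^-1 <= s.
  by rewrite lef_pV2 ?posrE // -(gtr0_norm l0) -sqrtr_sqr ler_wsqrtr.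
move=> B; rewrite -g0 => /gc [d /= d0 Hd].
have gd : B (geodesic p v (d / 2)).
  by apply: Hd; rewrite /= sub0r normrN gtr0_norm ?divr_gt0 //; lra.
exists (geodesic p v (d / 2)); split => //; split; first exact: H3_geodesic.
right; exists s; split => //.
  (* Moving back from p by t along the geodesic to y multiplies [- mink _ (light y)], which is
     [lam^-1] at p, by [expR t]. It becomes s, so the point reached is a tangency point on the
     horosphere of parameter s. *)
  pose t := ln (s * lam).
  have ls0 : 0 < s * lam by exact: mulr_gt0.
  apply: (@asymptotic_curvature_point _ (geodesic p v (- t))) => //.
  - exact: H3_geodesic.
  - rewrite mink_geodesic_null // opprK pl /t lnK ?posrE //.
    by rewrite mulrN opprK mulfK // gt_eqF.
  - move=> x1 x2 h1 h2; rewrite ww // /s exprVn invrK sqr_sqrtr //.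
split; first exact: H3_geodesic.
rewrite mink_geodesic_null // pl mulrN opprK.
apply: lt_le_trans ls; rewrite gtr_pMl ?invr_gt0 //.
by rewrite -[ltRHS]expR0 ltr_expR oppr_lt0 divr_gt0.
Qed.
End HyperbolicGeometry.

Lemma near_comp_differentiable (R : realType) (U V W : normedModType R) (T : U -> V)
    (g : V -> W) (h : U -> W) p b v :
  T p = b -> differentiable T p -> differentiable g b ->
  (\forall q \near p, g (T q) = h q) ->
  differentiable h p /\ 'd h p v = 'd g b ('D_v T p).
Proof.
move=> Tp dT; rewrite -Tp => dg n.
have [d dE] := near_differentiable n (differentiable_comp dT dg).
by split=> //; rewrite dE (diff_comp dT dg) /= -(deriveE v dT).
Qed.

(** * Differentials and velocities read in charts *)

Section Charts.
Context {R : realType} {S : oriented_surface R}.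
Implicit Types (x y z : S) (q : 'rV[R]_2).

Definition chart_img x : set 'rV[R]_2 := chart x @` chart_dom x.

Lemma chart_img_open x : open (chart_img x).
Proof. exact: chart_open. Qed.

Lemma chart_imgP x z : chart_dom x z -> chart_img x (chart x z).
Proof. by move=> zx; exists z. Qed.

Lemma paramK x q : chart_img x q -> chart_dom x (param x q) /\ chart x (param x q) = q.
Proof. by case=> z zx <-; rewrite chartK. Qed.

Lemma open_param_preimage x (U : set S) : open U ->
  open (chart_img x `&` param x @^-1` U).
Proof.
move=> oU; rewrite openE => q [xq Uq]; apply: filterI.
  by apply: open_nbhs_nbhs; split => //; exact: chart_img_open.
by apply: (param_continuous xq); exact: open_nbhs_nbhs.
Qed.

Lemma open_chart_preimage x (U : set 'rV[R]_2) : open U ->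
  open (chart_dom x `&` chart x @^-1` U).
Proof.
move=> oU; rewrite openE => z [xz Uz]; apply: filterI.
  by apply: open_nbhs_nbhs; split => //; exact: dom_open.
by apply: (chart_continuous xz); exact: open_nbhs_nbhs.
Qed.

Definition overlap x y : set 'rV[R]_2 := chart_img x `&` param x @^-1` chart_dom y.

Lemma overlap_open x y : open (overlap x y).
Proof. by apply: open_param_preimage; exact: dom_open. Qed.

Lemma overlapE x y : chart x @` (chart_dom x `&` chart_dom y) = overlap x y.
Proof.
apply/seteqP; split=> [_ [z [xz yz] <-]|q [xq yq]].
  by split; [exact: chart_imgP|rewrite /= chartK].
by have [xp <-] := paramK xq; exists (param x q).
Qed.

Lemma transition_Ck x y k : Ck k (overlap x y) (chart y \o param x).
Proof.
apply: smooth_open; first exact: overlap_open.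
by rewrite -overlapE; exact: transition_smooth.
Qed.

Definition transition_jac x z : 'M[R]_2 := jacobian (chart x \o param z) (chart z z).

Lemma overlap_center x z : chart_dom x z -> overlap z x (chart z z).
Proof.
move=> xz; have zz := @dom_center _ _ z.
by split; [exact: chart_imgP|rewrite /= chartK].
Qed.

Lemma transition_jac_gt0 x z : chart_dom x z -> 0 < \det (transition_jac x z).
Proof.
move=> xz; apply: transition_oriented; rewrite overlapE; exact: overlap_center.
Qed.

Lemma transition_differentiable x z : chart_dom x z ->
  differentiable (chart x \o param z) (chart z z).
Proof. by move=> xz; exact: CkS_differentiable (transition_Ck z x 1) (overlap_center xz). Qed.

Lemma near_transition (T : Type) (f : S -> T) x z : chart_dom x z ->
  \forall q \near chart z z, (f \o param x) ((chart x \o param z) q) = (f \o param z) q.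
Proof.
move=> xz; have := open_nbhs_nbhs (conj (@overlap_open z x) (overlap_center xz)).
by apply: filterS => q [zq xq] /=; rewrite chartK.
Qed.

(** The tangent space at z is read in the chart indexed by z; computing in a fixed chart x costs the
    factor [transition_jac x z]. *)
Lemma differential_chart m (f : S -> 'rV[R]_m) x z v : chart_dom x z ->
  differentiable (f \o param x) (chart x z) ->
  differentiable (f \o param z) (chart z z) /\
  differential f z v = 'd (f \o param x) (chart x z) (v *m transition_jac x z).
Proof.
move=> xz dg; have dT := transition_differentiable xz.
have Tz : (chart x \o param z) (chart z z) = chart x z.
  by rewrite /= chartK //; exact: dom_center.
have [d dE] := near_comp_differentiable v Tz dT dg (near_transition f xz).
split; first exact: d.
rewrite (deriveEjacobian v dT) in dE.
exact: dE.
Qed.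

Lemma smooth_map_Ck m (f : S -> 'rV[R]_m) x k : smooth_map f ->
  Ck k (chart_img x) (f \o param x).
Proof. by move=> sf; apply: smooth_open; [exact: chart_img_open|exact: sf]. Qed.

Section CurveVelocity.
Variables (c : R -> S) (t : R).
Hypothesis c_cont : {for t, continuous c}.

Lemma near_chart_dom x : chart_dom x (c t) -> \forall s \near t, chart_dom x (c s).
Proof.
by move=> xt; apply: c_cont; apply: open_nbhs_nbhs; split => //; exact: dom_open.
Qed.

Lemma curve_differentiable x y : chart_dom x (c t) -> chart_dom y (c t) ->
  differentiable (chart x \o c : R -> _) t -> differentiable (chart y \o c : R -> _) t.
Proof.
move=> xt yt dx.
have ov : overlap x y (chart x (c t)).
  by split; [exact: chart_imgP|rewrite /= chartK].
have dT : differentiable (chart y \o param x) ((chart x \o c) t).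
  exact: CkS_differentiable (transition_Ck x y 1) ov.
have n : \forall s \near t, (chart y \o param x) ((chart x \o c) s) = (chart y \o c) s.
  by apply: filterS (near_chart_dom xt) => s xs /=; rewrite chartK.
by have [] := near_differentiable n (differentiable_comp dx dT).
Qed.

(** [velocity] and [differential] are both read in the chart indexed by [c t], which changes along
    the curve. The chart x only supplies the differentiability of c. *)
Lemma is_derive_along m (f : S -> 'rV[R]_m) x : chart_dom x (c t) ->
  differentiable (chart x \o c : R -> _) t ->
  differentiable (f \o param (c t)) (chart (c t) (c t)) ->
  is_derive t 1 (f \o c) (differential f (c t) (velocity c t)).
Proof.
move=> xt dx df; set z := c t in df *.
have zz : chart_dom z (c t) by exact: dom_center.
have dz : differentiable (chart z \o c : R -> _) t by exact: curve_differentiable xt zz dx.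
have n : \forall s \near t, (f \o param z) ((chart z \o c) s) = (f \o c) s.
  by apply: filterS (near_chart_dom zz) => s zs /=; rewrite chartK.
have [dfc dE] := @near_comp_differentiable R R _ _ _ _ _ _ _ 1 erefl dz df n.
apply: DeriveDef; first exact: diff_derivable.
rewrite (deriveE _ dfc); rewrite dE; rewrite /velocity derive1E; exact: erefl.
Qed.

End CurveVelocity.

End Charts.

(** * Differentiation of Minkowski products *)

Section MinkowskiCalculus.
Context {R : realType}.
Implicit Types V : normedModType R.

Lemma Ck_crd V n k (U : set V) (f : V -> 'rV[R]_n.+1) (i : nat) : open U ->
  Ck k U f -> Ck k U (fun x => crd (f x) i).
Proof. by move=> oU Cf; exact: Ck_row. Qed.

Lemma Ck_mink V k (U : set V) (f g : V -> 'rV[R]_(1 + 3)) : open U ->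
  Ck k U f -> Ck k U g -> Ck k U (fun x => mink (f x) (g x)).
Proof.
move=> oU Cf Cg; under [X in Ck _ _ X]eq_fun do rewrite minkE.
have H i : Ck k U (fun x => crd (f x : 'rV_4) i * crd (g x : 'rV_4) i).
  by apply: CkM => //; exact: (@Ck_crd _ 3).
by apply: CkB => //; apply: CkD => //; apply: CkD.
Qed.

Lemma Ck_minor3 V k (U : set V) (f g h : V -> 'rV[R]_4) (a b c : nat) : open U ->
  Ck k U f -> Ck k U g -> Ck k U h -> Ck k U (fun x => minor3 (f x) (g x) (h x) a b c).
Proof.
move=> oU Cf Cg Ch; rewrite /minor3.
have Hf i := Ck_crd i oU Cf; have Hg i := Ck_crd i oU Cg; have Hh i := Ck_crd i oU Ch.
have H2 i j : Ck k U (fun x => crd (g x) i * crd (h x) j - crd (g x) j * crd (h x) i).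
  by apply: CkB => //; apply: CkM.
by apply: CkD => //; [apply: CkB => //|]; apply: CkM.
Qed.

Lemma Ck_cross V k (U : set V) (f g h : V -> 'rV[R]_4) : open U ->
  Ck k U f -> Ck k U g -> Ck k U h -> Ck k U (fun x => cross (f x) (g x) (h x)).
Proof.
move=> oU Cf Cg Ch; apply: (@Ck_rowP _ _ 4) => // i.
under [X in Ck _ _ X]eq_fun do rewrite mxE.
have M a b c := Ck_minor3 a b c oU Cf Cg Ch.
case: i => -[|[|[|[|//]]]] _ /=; [exact: M|exact: M|by apply: CkN => //; exact: M|exact: M].
Qed.

Lemma is_derive_crd V n (f : V -> 'rV[R]_n.+1) x v df (i : nat) :
  is_derive x v f df -> is_derive x v (fun y => crd (f y) i) (crd df i).
Proof.
move=> [d e]; have /derivable_mxP /(_ 0 (inord i)) di := d.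
by apply: DeriveDef => //; rewrite -e derive_mx // /crd mxE.
Qed.

Lemma is_derive_mink V (f g : V -> 'rV[R]_(1 + 3)) x v df dg :
  is_derive x v f df -> is_derive x v g dg ->
  is_derive x v (fun y => mink (f y) (g y)) (mink df (g x) + mink (f x) dg).
Proof.
move=> Df Dg; under eq_fun do rewrite minkE.
have Hf (i : nat) := @is_derive_crd _ 3 _ _ _ _ i Df.
have Hg (i : nat) := @is_derive_crd _ 3 _ _ _ _ i Dg.
have H i := @is_deriveM _ _ _ _ _ _ _ _ (Hf i) (Hg i).
have := is_deriveB (is_deriveD (is_deriveD (H 1%N) (H 2%N)) (H 3%N)) (H 0%N).
case=> d dE; apply: DeriveDef; first exact: d.
by apply: etrans dE _; rewrite !minkE /GRing.scale /=; ring.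
Qed.

Lemma is_derive_near_cst V (W : normedModType R) (f : V -> W) (c : W) x v df :
  (\forall y \near x, f y = c) -> is_derive x v f df -> df = 0.
Proof.
move=> n [_ <-].
have n' : \forall y \near x, c = f y by apply: filterS n => y ->.
have [d dE] := near_differentiable n' (differentiable_cst c x).
by rewrite deriveE // dE diff_cst.
Qed.

Lemma differential_row2 (V : normedModType R) (f : 'rV[R]_2 -> V) q v : differentiable f q ->
  'd f q v = v 0 0 *: 'D_(delta_mx 0 0) f q + v 0 1 *: 'D_(delta_mx 0 1) f q.
Proof.
have sum2 (g : 'I_2 -> V) : \sum_(i < 2) v 0 i *: g i = v 0 0 *: g 0 + v 0 1 *: g 1.
  rewrite 2!big_ord_recl big_ord0 addr0.
  by have -> : lift ord0 ord0 = 1 :> 'I_2 by apply/val_inj.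
move=> df; exact: etrans (differential_row v df) (sum2 _).
Qed.

Lemma near_forall (T : topologicalType) (p : T) (P : T -> Prop) :
  (forall q, P q) -> \forall q \near p, P q.
Proof. by move=> H; apply: nearW. Qed.

End MinkowskiCalculus.

(** * The unit normal and its smoothness *)

Section CrossProduct.
Context {R : realType}.

(** The square is the Gram determinant of b and c, positive because [mink] is positive definite on
    the orthogonal complement of the timelike vector a. *)
Lemma cross_spacelike (a b c : 'rV[R]_(1 + 3)) :
  mink a a = -1 -> mink a b = 0 -> mink a c = 0 ->
  (forall s t : R, s *: b + t *: c = 0 -> s = 0 /\ t = 0) ->
  0 < mink (cross a b c) (cross a b c).
Proof.
move=> aa ab ac indep.
have aa0 : mink a a < 0 by rewrite aa; lra.
have orth (s t : R) : mink a (s *: b + t *: c) = 0 by rewrite !mink_lin ab ac; ring.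
have pos (s t : R) : mink (s *: b + t *: c) (s *: b + t *: c) = 0 -> s = 0 /\ t = 0.
  by have [_ H] := timelike_orthogonal_ge0 aa0 (orth s t); move=> /H /indep.
have ge0 (s t : R) : 0 <= mink (s *: b + t *: c) (s *: b + t *: c).
  by have [H _] := timelike_orthogonal_ge0 aa0 (orth s t).
rewrite mink_cross_cross ab ac aa.
have gE (s t : R) : mink (s *: b + t *: c) (s *: b + t *: c) =
    s ^+ 2 * mink b b + 2 * s * t * mink b c + t ^+ 2 * mink c c.
  by rewrite !mink_lin [mink c b]minkC; ring.
have {}pos s t := pos s t; have {}ge0 s t := ge0 s t.
move: gE pos ge0; set G := mink b b; set F := mink b c; set H := mink c c => gE pos ge0.
have g00 : 0 < G.
  have h := ge0 1 0; rewrite gE in h; have p := pos 1 0; rewrite gE in p.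
  rewrite lt_neqAle; apply/andP; split; last by lra.
  apply/eqP => h0; have [] : (1 : R) = 0 /\ (0 : R) = 0 by apply: p; rewrite -h0; ring.
  by move=> /eqP; rewrite oner_eq0.
(* The vector [- F b + G c] is G times the component of c orthogonal to b, and its square is G times
   the Gram determinant. *)
have e1 : (- F) ^+ 2 * G + 2 * (- F) * G * F + G ^+ 2 * H = G * (G * H - F ^+ 2) by ring.
have := ge0 (- F) G; rewrite gE e1 pmulr_rge0 // => h.
have hn : G * H - F ^+ 2 != 0.
  apply/eqP => h0; have [] := pos (- F) G; first by rewrite gE e1 h0 mulr0.
  by move=> _ /eqP; rewrite gt_eqF.
rewrite [ltRHS](_ : _ = G * H - F ^+ 2); last by ring.
by rewrite lt_neqAle eq_sym hn.
Qed.

End CrossProduct.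

Section Normal.
Context {R : realType} {S : oriented_surface R}.
Variable e : S -> 'rV[R]_(1 + 3).
Hypothesis e_imm : immersion e.
Implicit Types (x y z : S) (q : 'rV[R]_2).

Let E x : 'rV[R]_2 -> 'rV[R]_(1 + 3) := e \o param x.
Let D x (i : 'I_2) q : 'rV[R]_(1 + 3) := 'D_(delta_mx 0 i) (E x) q.

Lemma immersion_Ck x k : Ck k (chart_img x) (E x).
Proof. by case: e_imm => _ sm _; exact: smooth_map_Ck. Qed.

Lemma immersion_differentiable x q : chart_img x q -> differentiable (E x) q.
Proof. exact: CkS_differentiable (immersion_Ck x 1). Qed.

Lemma immersion_D_Ck x i k : Ck k (chart_img x) (D x i).
Proof. by case: (immersion_Ck x k.+1) => _; exact. Qed.

Lemma immersion_H3 z : H3 (e z). Proof. by case: e_imm. Qed.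

Lemma immersion_differential x z v : chart_dom x z ->
  differential e z v =
   (v *m transition_jac x z) 0 0 *: D x 0 (chart x z) + (v *m transition_jac x z) 0 1 *: D x 1 (chart x z).
Proof.
move=> xz; have dE := immersion_differentiable (chart_imgP xz).
have [_ ->] := differential_chart v xz dE.
exact: differential_row2.
Qed.

Lemma mink_tangent x z v : chart_dom x z -> mink (e z) ('d (E x) (chart x z) v) = 0.
Proof.
move=> xz; have dE := immersion_differentiable (chart_imgP xz).
have DE := derivableP (@diff_derivable _ _ _ _ _ v dE).
have := is_derive_mink DE DE.
have n : \forall q \near chart x z, mink (E x q) (E x q) = -1.
  by apply: near_forall => q; case: (immersion_H3 (param x q)).
move=> /(is_derive_near_cst n).
rewrite deriveE // /E /= chartK // [mink ('d _ _ _) _]minkC; lra.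
Qed.

(** [unit_normal] is selected by [xget], which gives no regularity. This formula is smooth in the
    chart, and [unit_normalE] identifies the two. *)
Definition chart_normal x q : 'rV[R]_(1 + 3) :=
  let nu := cross (E x q) (D x 0 q) (D x 1 q) in (Num.sqrt (mink nu nu))^-1 *: nu.

Lemma cross_gt0 x q : chart_img x q ->
  0 < mink (cross (E x q) (D x 0 q) (D x 1 q)) (cross (E x q) (D x 0 q) (D x 1 q)).
Proof.
case=> z xz <-; have dE := immersion_differentiable (chart_imgP xz).
have tang i : mink (e z) (D x i (chart x z)) = 0.
  by rewrite -(mink_tangent (delta_mx 0 i) xz) /D (deriveE _ dE).
have EE : E x (chart x z) = e z by rewrite /E /= chartK.
rewrite EE; have [ee _] := immersion_H3 z.
apply: cross_spacelike; [exact: ee|exact: tang|exact: tang|move=> s t st].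
(* The partial derivatives are taken in chart x, while injectivity is known in the chart of z;
   [invmx T] carries a linear relation from one to the other. *)
pose u : 'rV[R]_2 := \row_j (if j == 0 then s else t).
have uT := transition_jac_gt0 xz; set T := transition_jac x z in uT.
have uT' : T \in unitmx by rewrite unitmxE unitfE gt_eqF.
have uE : u *m invmx T *m T = u by exact: mulmxKV.
have us : (u *m invmx T *m T) 0 0 = s by rewrite uE mxE.
have ut : (u *m invmx T *m T) 0 1 = t by rewrite uE mxE.
have : differential e z (u *m invmx T) = differential e z 0.
  apply: etrans (immersion_differential _ xz) _; apply: etrans _ (esym (linear0 _)).
  exact: (etrans (congr2 (fun s t => s *: D x 0 (chart x z) + t *: D x 1 (chart x z)) us ut) st).
have [_ _ inj] := e_imm.
by move=> /(inj z) u0; move: us ut; rewrite u0 !mul0mx !mxE => <- <-.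
Qed.

Lemma chart_normal_Ck x k : Ck k (chart_img x) (chart_normal x).
Proof.
have oI := @chart_img_open _ _ x.
have Cc : Ck k (chart_img x) (fun q => cross (E x q) (D x 0 q) (D x 1 q)).
  by apply: Ck_cross => //; [exact: immersion_Ck|exact: immersion_D_Ck|exact: immersion_D_Ck].
have Cs : Ck k (chart_img x) (fun q => (Num.sqrt (mink (cross (E x q) (D x 0 q) (D x 1 q))
    (cross (E x q) (D x 0 q) (D x 1 q))))^-1).
  apply: CkV => // [q xq|].
    by rewrite gt_eqF // sqrtr_gt0 cross_gt0.
  by apply: Ck_sqrt => // [q xq|]; [exact: cross_gt0|exact: Ck_mink].
apply: Ck_rowP => // i; under [X in Ck _ _ X]eq_fun do rewrite mxE.
by apply: CkM => //; exact: Ck_row.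
Qed.

End Normal.

Section CrossLemmas.
Context {R : realType}.
Implicit Types a b c d : 'rV[R]_(1 + 3).

Lemma cross_orth a b c : [/\ mink a (cross a b c) = 0, mink b (cross a b c) = 0 &
  mink c (cross a b c) = 0].
Proof. by split; rewrite minkE !crd_cross //= /minor3; ring. Qed.

Lemma vol4_comb a b c d (s0 t0 s1 t1 k : R) :
  vol [tuple a; s0 *: b + t0 *: c; s1 *: b + t1 *: c; k *: d] =
  k * (s0 * t1 - t0 * s1) * vol [tuple a; b; c; d].
Proof. by rewrite !vol4E /= !crdM; ring. Qed.

Lemma det2E (T : 'M[R]_2) : \det T = T 0 0 * T 1 1 - T 0 1 * T 1 0.
Proof.
rewrite (expand_det_row _ ord0) 2!big_ord_recl big_ord0 /cofactor !det_mx11 !mxE /=.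
have l0 (j : 'I_1) : lift ord0 j = 1 :> 'I_2 by apply/val_inj; rewrite ord1.
have l1 (j : 'I_1) : lift 1 j = 0 :> 'I_2 by apply/val_inj; rewrite ord1.
by rewrite !l0 l1 /=; ring.
Qed.

Lemma normalized_cross a b c (T : 'M[R]_2) :
  let nu := cross a b c in let n := (Num.sqrt (mink nu nu))^-1 *: nu in
  0 < mink nu nu -> 0 < \det T ->
  [/\ mink a n = 0, mink n n = 1, forall s t : R, mink (s *: b + t *: c) n = 0 &
    0 < vol [tuple a; T 0 0 *: b + T 0 1 *: c; T 1 0 *: b + T 1 1 *: c; n]].
Proof.
move=> nu n nn0 T0; have [h1 h2 h3] := cross_orth a b c.
have s0 : 0 < Num.sqrt (mink nu nu) by rewrite sqrtr_gt0.
split.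
- by rewrite minkZr h1 mulr0.
- by rewrite minkZr minkZl mulrA -invfM -expr2 sqr_sqrtr ?ltW // mulVf // gt_eqF.
- by move=> s t; rewrite minkZr minkDl !minkZl h2 h3; ring.
- rewrite vol4_comb -mink_cross -/nu -det2E.
  by apply: mulr_gt0 => //; apply: mulr_gt0 => //; rewrite invr_gt0.
Qed.

Lemma delta_mulmx m n (T : 'M[R]_(m, n)) i j : ((delta_mx 0 i : 'rV[R]_m) *m T) 0 j = T i j.
Proof. by rewrite -rowE mxE. Qed.

(** Nondegeneracy makes w a multiple r of v; the unit length gives [r * r = 1] and the orientation
    gives [0 < r]. *)
Lemma unique_positive_normal a b c v w :
  mink a v = 0 -> mink b v = 0 -> mink c v = 0 -> mink v v = 1 ->
  mink a w = 0 -> mink b w = 0 -> mink c w = 0 -> mink w w = 1 ->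
  0 < vol [tuple a; b; c; v] -> 0 < vol [tuple a; b; c; w] -> w = v.
Proof.
move=> av bv cv vv aw bw cw ww vol_v vol_w.
have vn : vol [tuple a; b; c; v] != 0 by rewrite gt_eqF.
have : w - mink w v *: v = 0.
  by apply: (mink_nondegenerate vn); rewrite !mink_lin ?av ?bv ?cv ?vv ?aw ?bw ?cw
    ?[mink v w]minkC; ring.
move=> /eqP; rewrite subr_eq0 => /eqP wE.
move: wE; set r := mink w v => wE.
have := vol4_comb a b c v 1 0 0 1 r.
rewrite !scale1r !scale0r addr0 add0r -wE => volE.
have c0 : 0 < r by move: vol_w; rewrite volE; nra.
have c1 : r * r = 1 by have := ww; rewrite wE !mink_lin vv mulr1.
have -> : w = r *: v by [].
have -> : r = 1 by nra.
by rewrite scale1r.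
Qed.

End CrossLemmas.

Section UnitNormal.
Context {R : realType} {S : oriented_surface R}.
Variable e : S -> 'rV[R]_(1 + 3).
Hypothesis e_imm : immersion e.
Implicit Types (x y z : S) (q : 'rV[R]_2).

Let N := unit_normal e.

Lemma chart_normal_positive x z : chart_dom x z ->
  positive_unit_normal e z (chart_normal e x (chart x z)).
Proof.
move=> xz; have nn0 := cross_gt0 e_imm (chart_imgP xz).
have dif v := immersion_differential e_imm v xz.
have EE : (e \o param x) (chart x z) = e z by rewrite /= chartK.
rewrite /chart_normal; move: nn0 dif; rewrite EE.
set d0 := 'D_(delta_mx 0 0) (e \o param x) (chart x z).
set d1 := 'D_(delta_mx 0 1) (e \o param x) (chart x z).
move=> nn0 dif; set T := transition_jac x z in dif.
have [a1 a2 a3 a4] := normalized_cross nn0 (transition_jac_gt0 xz : 0 < \det T).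
have fr (i : 'I_2) : differential e z (delta_mx 0 i) = T i 0 *: d0 + T i 1 *: d1 :=
  etrans (dif _) (congr2 (fun s t => s *: d0 + t *: d1) (delta_mulmx T i 0) (delta_mulmx T i 1)).
split; [exact: a1|exact: a2|by move=> xi; rewrite dif; exact: a3|].
by move: a4; rewrite -(fr 0) -(fr 1).
Qed.

Lemma unit_normalE x z : chart_dom x z -> N z = chart_normal e x (chart x z).
Proof.
move=> xz; have P := chart_normal_positive xz.
have P' : positive_unit_normal e z (N z).
  by apply: (@xgetPex _ 0 [set v | positive_unit_normal e z v]); exists (chart_normal e x (chart x z)).
case: P => [a1 a2 a3 a4]; case: P' => [b1 b2 b3 b4].
by apply: (@unique_positive_normal _ (e z) (differential e z (frame0 : 'rV[R]_2))
  (differential e z (frame1 : 'rV[R]_2))).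
Qed.

Lemma unit_normal_positive z : positive_unit_normal e z (N z).
Proof.
by rewrite (unit_normalE (dom_center z)); exact: chart_normal_positive (dom_center z).
Qed.

Lemma unit_normal_Ck x k : Ck k (chart_img x) (N \o param x).
Proof.
have oI := @chart_img_open _ _ x.
apply: Ck_ext (chart_normal_Ck e_imm x k) => // q xq.
by have [xp pE] := paramK xq; rewrite /= (unit_normalE xp) pE.
Qed.

Lemma immersion_diff z : differentiable (e \o param z) (chart z z).
Proof. exact: (immersion_differentiable e_imm (chart_imgP (dom_center z))). Qed.

Lemma unit_normal_diff z : differentiable (N \o param z) (chart z z).
Proof. exact: CkS_differentiable (unit_normal_Ck z 1) (chart_imgP (dom_center z)). Qed.

Lemma near_mink_cst (V : normedModType R) (f g : V -> 'rV[R]_(1 + 3)) p v c :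
  differentiable f p -> differentiable g p -> (forall w, mink (f w) (g w) = c) ->
  mink ('d f p v) (g p) + mink (f p) ('d g p v) = 0.
Proof.
move=> df dg fg.
have Df := derivableP (@diff_derivable _ _ _ _ _ v df).
have Dg := derivableP (@diff_derivable _ _ _ _ _ v dg).
have := is_derive_near_cst (near_forall _ fg) (is_derive_mink Df Dg).
by rewrite !deriveE.
Qed.

(** The relations come from differentiating the constants [<e, e>], [<N, N>] and [<e, N>]. As N' is
    orthogonal to e, the projection to the tangent space of H3 changes nothing, and [nabla] is the
    plain differential. *)
Lemma normal_facts z (xi : 'rV[R]_2) :
  let de := differential e z xi in let dN := differential N z xi in
  [/\ mink (e z) (e z) = -1, mink (N z) (N z) = 1 & mink (e z) (N z) = 0] /\
  [/\ mink de (e z) = 0, mink de (N z) = 0, mink dN (N z) = 0 & mink dN (e z) = 0] /\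
  nabla e N z xi = dN.
Proof.
move=> de dN; have [a1 a2 a3 _] := unit_normal_positive z.
have [ee _] := immersion_H3 e_imm z.
have ze : (e \o param z) (chart z z) = e z by rewrite /= chartK //; exact: dom_center.
have zN : (N \o param z) (chart z z) = N z by rewrite /= chartK //; exact: dom_center.
have Hee : mink de (e z) + mink (e z) de = 0.
  have := near_mink_cst xi (immersion_diff z) (immersion_diff z)
    (fun q => (immersion_H3 e_imm (param z q)).1).
  by rewrite ze; exact.
have HNN : mink dN (N z) + mink (N z) dN = 0.
  have := near_mink_cst xi (unit_normal_diff z) (unit_normal_diff z)
    (fun q => let: And4 _ h _ _ := unit_normal_positive (param z q) in h).
  by rewrite zN; exact.
have HeN : mink de (N z) + mink (e z) dN = 0.
  have := near_mink_cst xi (immersion_diff z) (unit_normal_diff z)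
    (fun q => let: And4 h _ _ _ := unit_normal_positive (param z q) in h).
  by rewrite ze zN; exact.
have d2 : mink de (N z) = 0 := a3 xi.
have nE : nabla e N z xi = dN + mink dN (e z) *: e z by [].
clearbody de dN; rewrite [mink (e z) de]minkC in Hee; rewrite [mink (N z) dN]minkC in HNN.
rewrite [mink (e z) dN]minkC in HeN.
have d4 : mink dN (e z) = 0 by lra.
split; first by split.
have d1 : mink de (e z) = 0 by lra.
have d3 : mink dN (N z) = 0 by lra.
split; first exact: And4 d1 d2 d3 d4.
by rewrite nE d4 scale0r addr0.
Qed.

End UnitNormal.

(** * The end point of a geodesic *)

Section Horizon.
Context {R : realType}.
Implicit Types (p v k : 'rV[R]_(1 + 3)).

Lemma rsubmxE k : 0 < k 0 0 -> k = k 0 0 *: light (klein k).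
Proof.
move=> k0; apply: (@rowP_crd R 3) => -[|i] i4; rewrite crdZ.
  by rewrite crd_light0 mulr1 crd_time.
rewrite crd_light // /klein crdZ crd_rsubmx // mulrA divff ?mul1r //.
by rewrite gt_eqF.
Qed.

Lemma kleinZ (s : R) k : s != 0 -> klein (s *: k) = klein k.
Proof.
move=> s0; apply: (@rowP_crd R 2) => i i3.
rewrite /klein !crdZ !crd_rsubmx // crdZ mxE invfM.
by rewrite mulrACA mulVf // mul1r.
Qed.

Lemma klein_null_boundary k : mink k k = 0 -> 0 < k 0 0 -> boundary (klein k).
Proof.
move=> kk k0; have E0 := rsubmxE k0; move: E0 k0; set s := k 0 0; set w := klein k => E s0.
have : mink (s *: light w) (s *: light w) = 0 by rewrite -E.
rewrite minkZl minkZr => /eqP; rewrite !mulf_eq0 gt_eqF //= => /eqP.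
by rewrite minkE !crd_light // crd_light0 /boundary /= dot3E; lra.
Qed.

Lemma klein_continuous k : 0 < k 0 0 -> {for k, continuous (@klein R)}.
Proof.
move=> k0; apply: differentiable_continuous; apply: differentiable_rowP => i; rewrite /klein.
have -> : (fun y : 'rV[R]_(1 + 3) => ((y 0 0)^-1 *: rsubmx y) 0 i) =
    fun y : 'rV[R]_(1 + 3) => (y 0 0)^-1 * y 0 (rshift 1 i).
  by apply/funext => y; rewrite !mxE.
apply: differentiableM; last exact: differentiable_coord.
by apply: differentiableV; [exact: differentiable_coord|rewrite gt_eqF].
Qed.

(** The geodesic at t is [expR t / 2] times [(p + v) + expR (- t)^2 (p - v)]. The map [klein]
    forgets the scale, and the second term tends to 0. *)
Lemma horizonE p v : H3 p -> mink v v = 1 -> mink p v = 0 -> horizon p v = klein (p + v).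
Proof.
move=> Hp vv pv; have [pp _] := Hp.
have kk : mink (p + v) (p + v) = 0 by rewrite !mink_lin [mink v p]minkC pp vv pv; lra.
have k0 : 0 < (p + v) 0 0.
  by rewrite crd_time; apply: H3_null_time Hp kk _; rewrite mink_lin pp pv; lra.
have gE t : klein (geodesic p v t) = klein ((p + v) + (expR (- t) * expR (- t)) *: (p - v)).
  have e0 : expR t / 2 != 0 by rewrite gt_eqF // divr_gt0 // expR_gt0.
  rewrite -(kleinZ ((p + v) + _) e0); congr klein.
  have E : expR t * expR (- t) = 1 by exact: expRxMexpNx_1.
  apply/rowP => i; rewrite /geodesic /cosh /sinh !mxE.
  move: (expR t) (expR (- t)) E => x z E.
  by have -> : x / 2 * (p 0 i + v 0 i + z * z * (p 0 i - v 0 i)) =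
    x / 2 * (p 0 i + v 0 i) + (x * z) * z / 2 * (p 0 i - v 0 i) by [ring]; rewrite E; field.
have lim_k : ((p + v) + (expR (- t) * expR (- t)) *: (p - v)) @[t --> +oo] -->
    (p + v) + (0 * 0) *: (p - v).
  apply: cvgD; first exact: cvg_cst.
  by apply: cvgZl; apply: cvgM; exact: cvgr_expR.
rewrite mulr0 scale0r addr0 in lim_k.
rewrite /horizon; apply: cvg_lim; first exact: norm_hausdorff.
under eq_fun do rewrite gE.
apply: cvg_comp lim_k _; exact: klein_continuous k0.
Qed.

End Horizon.

(** * Stereographic coordinates on the light cone *)

Section NullCoordinates.
Context {R : realType}.
Variables p n v1 v2 : 'rV[R]_(1 + 3).
Hypothesis F : orthonormal_frame p n v1 v2.
Implicit Types (a b k : 'rV[R]_(1 + 3)) (z : 'rV[R]_2).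

Let kk := p + n.
(** The null direction of the plane of p and n other than [p + n], scaled so that the two pair to
    -1. *)
Definition null_axis : 'rV[R]_(1 + 3) := 2^-1 *: (p - n).
Let mm := null_axis.

Definition height k : R := - mink k mm.

(** The section of the light cone at height 1, a paraboloid isometric to the Euclidean plane.
    Nullity imposes the coefficient of the last term. *)
Definition null_point z : 'rV[R]_(1 + 3) :=
  kk + z 0 0 *: v1 + z 0 1 *: v2 + (dot z z / 2) *: mm.

Definition null_proj k : 'rV[R]_2 :=
  (height k)^-1 *: \row_(i < 2) (if i == 0 then mink k v1 else mink k v2).

Lemma dot2_sum z z' : dot z z' = z 0 0 * z' 0 0 + z 0 1 * z' 0 1.
Proof.
rewrite /dot 2!big_ord_recl big_ord0 addr0.
by have -> : lift ord0 ord0 = 1 :> 'I_2 by apply/val_inj.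
Qed.

Lemma frame_mink : [/\ mink kk kk = 0, mink mm mm = 0 & mink kk mm = -1] /\
  [/\ mink kk v1 = 0, mink kk v2 = 0, mink mm v1 = 0 & mink mm v2 = 0] /\
  [/\ mink v1 v1 = 1, mink v2 v2 = 1 & mink v1 v2 = 0].
Proof.
case: F => [[pp nn v11 v22] [[pn p1 p2] [n1 n2 v12]]].
rewrite /kk /mm /null_axis !mink_lin [mink n p]minkC pp nn pn p1 p2 n1 n2 v11 v22 v12.
by split; [|split]; split; lra.
Qed.

Lemma frame_sym : [/\ mink mm kk = -1, mink v1 kk = 0 & mink v2 kk = 0] /\
  [/\ mink v1 mm = 0, mink v2 mm = 0 & mink v2 v1 = 0].
Proof.
have [[k0 m0 km] [[k1 k2 m1 m2] [v11 v22 v12]]] := frame_mink.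
by split; split; rewrite minkC.
Qed.

Lemma frame_expand_null a : a = - mink a mm *: kk - mink a kk *: mm + mink a v1 *: v1 + mink a v2 *: v2.
Proof.
rewrite {1}(frame_expand a F) /mm /kk /null_axis !mink_lin.
move: (mink a p) (mink a n) (mink a v1) (mink a v2) => x y s t.
by apply/rowP => i; rewrite !mxE; field.
Qed.

Lemma mink_frame_null a b : mink a b = - mink a mm * mink b kk - mink a kk * mink b mm
  + mink a v1 * mink b v1 + mink a v2 * mink b v2.
Proof.
by rewrite {1}(frame_expand_null a) !mink_lin ![mink _ b]minkC; ring.
Qed.

Lemma null_point_mink a z : mink a (null_point z) =
  mink a kk + z 0 0 * mink a v1 + z 0 1 * mink a v2 + dot z z / 2 * mink a mm.
Proof. by rewrite /null_point !mink_lin. Qed.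

Lemma height_null_point z : height (null_point z) = 1.
Proof.
have [[k0 m0 km] [[k1 k2 m1 m2] _]] := frame_mink.
by rewrite /height minkC null_point_mink m0 m1 m2 minkC km; ring.
Qed.

Lemma null_point_proj k : mink k k = 0 -> height k != 0 ->
  k = height k *: null_point (null_proj k).
Proof.
move=> k0 h0; have := mink_frame_null k k; rewrite k0 => e.
have hE : mink k mm = - height k by rewrite /height opprK.
rewrite {1}(frame_expand_null k) /null_point dot2_sum /null_proj !mxE /= hE.
rewrite hE in e; move: (height k) h0 (mink k v1) (mink k v2) (mink k kk) e => h h0 s t u e.
have e' : 2 * h * u = - (s ^+ 2 + t ^+ 2) by lra.
have uE : u = - (s ^+ 2 + t ^+ 2) / (2 * h) by rewrite -e'; field.
rewrite uE; apply/rowP => i; rewrite !mxE; field; exact: h0.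
Qed.

Lemma height_null_proj k (i : 'I_2) : height k != 0 ->
  height k * crd (null_proj k) i = mink k (if i == 0 then v1 else v2).
Proof.
by move=> h0; rewrite -crdE !mxE mulrA divff // mul1r; case: ifP.
Qed.

Lemma null_proj_point (s : R) z : s != 0 -> null_proj (s *: null_point z) = z.
Proof.
move=> s0; have [[k0 m0 km] [[k1 k2 m1 m2] [v11 v22 v12]]] := frame_mink.
have [[mk sk1 sk2] [sm1 sm2 v21]] := frame_sym.
have h : height (s *: null_point z) = s.
  by rewrite -[RHS]mulr1 -(height_null_point z) /height minkZl mulrN.
apply/rowP => i; rewrite /null_proj h !mxE !minkZl.
have e1 : mink (null_point z) v1 = z 0 0.
  by rewrite minkC null_point_mink sk1 v11 v12 sm1; ring.
have e2 : mink (null_point z) v2 = z 0 1.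
  by rewrite minkC null_point_mink sk2 v22 v21 sm2; ring.
by case: i => -[|[|//]] hi; rewrite /= ?e1 ?e2 mulrA mulVf // mul1r; congr (z 0 _); apply/val_inj.
Qed.

(** The cone metric is conformal to that of the coordinate z: [<a, a> = h^2 |dz|^2] for a variation
    a of k. Each bracket is [h^2] times the variation of one coordinate, the height varying by
    [- mink a mm]. *)
Lemma null_differential a k : mink k k = 0 -> mink a k = 0 -> height k != 0 ->
  height k ^+ 2 * mink a a =
    (height k * mink a v1 + mink a mm * mink k v1) ^+ 2
    + (height k * mink a v2 + mink a mm * mink k v2) ^+ 2.
Proof.
move=> kk0 ak h0; rewrite (mink_frame_null a a).
have := mink_frame_null a k; have := mink_frame_null k k; rewrite kk0 ak.
have -> : mink k mm = - height k by rewrite /height opprK.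
move: (height k) h0 (mink k kk) (mink k v1) (mink k v2) => h h0 ku ks kt.
move: (mink a mm) (mink a kk) (mink a v1) (mink a v2) => am au s t e1 e2.
have e1' : 2 * h * ku = - (ks ^+ 2 + kt ^+ 2) by lra.
have ku1 : ku = - (ks ^+ 2 + kt ^+ 2) / (2 * h) by rewrite -e1'; field.
have au1 : au * h = am * ku - ks * s - kt * t by lra.
have -> : h ^+ 2 * (- am * au - au * am + s * s + t * t) =
   - 2 * am * h * (au * h) + h ^+ 2 * (s * s + t * t) by ring.
by rewrite au1 ku1; field.
Qed.

End NullCoordinates.

Section MoreDerivatives.
Context {R : realType}.

Lemma is_derive_mink_cst (V : normedModType R) (f : V -> 'rV[R]_(1 + 3)) x v df w :
  is_derive x v f df -> is_derive x v (fun y => mink (f y) w) (mink df w).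
Proof.
move=> Df; have [d dE] := is_derive_mink Df (is_derive_cst w x v).
apply: DeriveDef; first exact: d.
by apply: etrans dE _; rewrite [mink _ 0]minkC mink0l addr0.
Qed.

Lemma is_derive_prod_stationary (V : normedModType R) (f g h : V -> R) x v df dh :
  is_derive x v f df -> is_derive x v h dh -> is_derive x v g 0 ->
  (\forall y \near x, f y = h y * g y) -> df = g x * dh.
Proof.
move=> Df Dh Dg n0.
have D := is_deriveB Df (is_deriveM Dh Dg).
have n1 : \forall y \near x, (f - h * g) y = 0.
  by apply: filterS n0 => y /= E; rewrite !fctE E subrr.
have := is_derive_near_cst n1 D; rewrite scaler0 add0r => /eqP.
by rewrite subr_eq0 => /eqP.
Qed.

End MoreDerivatives.

(** * The null Gauss map and its coordinate *)

Section NullGauss.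
Context {R : realType} {S : oriented_surface R}.
Variable e : S -> 'rV[R]_(1 + 3).
Hypothesis e_imm : immersion e.
Implicit Types (x y z : S) (q : 'rV[R]_2).

Let N := unit_normal e.
Definition null_gauss z : 'rV[R]_(1 + 3) := e z + unit_normal e z.
Let K := null_gauss.

Lemma null_gauss_null z : mink (K z) (K z) = 0.
Proof.
have [[ee nn en] _] := normal_facts e_imm z 0.
by rewrite /K /null_gauss !mink_lin [mink (unit_normal e z) (e z)]minkC ee nn en; lra.
Qed.

Lemma mink_null_gauss z : mink (e z) (K z) = -1.
Proof.
have [[ee nn en] _] := normal_facts e_imm z 0.
by rewrite /K /null_gauss mink_lin ee en; lra.
Qed.

Lemma null_gauss_time z : 0 < K z 0 0.
Proof.
rewrite crd_time; apply: (H3_null_time (immersion_H3 e_imm z) (null_gauss_null z)).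
by rewrite mink_null_gauss; lra.
Qed.

Lemma asymptotic_gaussE z : asymptotic_gauss e z = klein (K z).
Proof.
have [[ee nn en] _] := normal_facts e_imm z 0.
exact: horizonE (immersion_H3 e_imm z) nn en.
Qed.

Lemma null_gauss_light z : K z = K z 0 0 *: light (asymptotic_gauss e z).
Proof. by rewrite asymptotic_gaussE; exact: rsubmxE (null_gauss_time z). Qed.

Lemma asymptotic_gauss_boundary z : boundary (asymptotic_gauss e z).
Proof. rewrite asymptotic_gaussE; exact: klein_null_boundary (null_gauss_null z) (null_gauss_time z). Qed.

Lemma null_gauss_Ck x k : Ck k (chart_img x) (K \o param x).
Proof.
apply: CkD; first exact: chart_img_open.
  exact: immersion_Ck e_imm x k.
exact: unit_normal_Ck e_imm x k.
Qed.

Lemma null_gauss_differential z xi :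
  differential K z xi = differential e z xi + differential N z xi.
Proof.
have d1 := immersion_diff e_imm z; have d2 := unit_normal_diff e_imm z.
exact: (congr1 (fun f => f xi) (diffD d1 d2)).
Qed.

Lemma fundamental_sum z xi :
  fundamental1 e z xi xi + fundamental3 e z xi xi + 2 * fundamental2 e z xi xi =
    mink (differential K z xi) (differential K z xi).
Proof.
have [_ [_ nE]] := normal_facts e_imm z xi.
rewrite null_gauss_differential /fundamental1 /fundamental2 /fundamental3 nE.
move: (differential e z xi) (differential N z xi) => a b.
by rewrite !mink_lin [mink a b]minkC; ring.
Qed.

Lemma fundamental_ge0 z xi : 0 <= fundamental1 e z xi xi /\ 0 <= fundamental3 e z xi xi.
Proof.
have [[ee _ _] [[h1 _ _ h4] nE]] := normal_facts e_imm z xi.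
have ee0 : mink (e z) (e z) < 0 by rewrite ee ltrN10.
have g1 := timelike_orthogonal_ge0 ee0 (etrans (minkC _ _) h1).
have g4 := timelike_orthogonal_ge0 ee0 (etrans (minkC _ _) h4).
by rewrite /fundamental1 /fundamental3 nE; split; [exact: g1.1|exact: g4.1].
Qed.

Hypothesis e_isc : inf_strictly_convex e.

Lemma null_gauss_spacelike z xi : xi != 0 ->
  0 < mink (differential K z xi) (differential K z xi).
Proof.
move=> xi0; have := e_isc z xi0; have [] := fundamental_ge0 z xi; clear xi0.
rewrite -fundamental_sum; move: (fundamental1 _ _ _ _) (fundamental2 _ _ _ _) (fundamental3 _ _ _ _).
by move=> a b c h1 h2 h3; lra.
Qed.

Variables p n v1 v2 : 'rV[R]_(1 + 3).
Hypothesis F : orthonormal_frame p n v1 v2.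

Definition gauss_height z : R := height p n (null_gauss z).
Definition gauss_proj z : 'rV[R]_2 := null_proj p n v1 v2 (null_gauss z).
Let hgt := gauss_height.
Let psi := gauss_proj.

Definition height_pos x : set 'rV[R]_2 :=
  chart_img x `&` (hgt \o param x) @^-1` [set h | 0 < h].

Lemma gauss_height_Ck x k : Ck k (chart_img x) (hgt \o param x).
Proof.
have oI := @chart_img_open _ _ x.
apply: CkN => //; apply: Ck_mink => //; [exact: null_gauss_Ck|exact: Ck_cst].
Qed.

Lemma height_pos_open x : open (height_pos x).
Proof.
rewrite openE => q [xq hq]; apply: filterI.
  by apply: open_nbhs_nbhs; split => //; exact: chart_img_open.
apply: (Ck_continuous (gauss_height_Ck x 0) xq).
by apply: open_nbhs_nbhs; split => //; exact: open_gt.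
Qed.

Lemma gauss_proj_Ck x k : Ck k (height_pos x) (psi \o param x).
Proof.
have oI := @height_pos_open x.
have sub : height_pos x `<=` chart_img x by move=> q [].
have CK := Ck_sub sub (null_gauss_Ck x k).
apply: Ck_rowP => // i.
have -> : (fun q => (psi \o param x) q 0 i) = fun q =>
    (hgt (param x q))^-1 * mink (K (param x q)) (if i == 0 then v1 else v2).
  by apply/funext => q; rewrite /psi /= /gauss_proj /null_proj !mxE; case: ifP.
apply: CkM => //.
  apply: CkV => // [q [_ hq]|]; first by rewrite gt_eqF.
  exact: Ck_sub sub (gauss_height_Ck x k).
apply: Ck_mink => //; exact: Ck_cst.
Qed.

(** A kernel vector would leave the coordinate stationary; by [null_differential] its image under
    the differential of K would be null, whereas convexity makes it spacelike. *)
Lemma gauss_proj_unit y : 0 < hgt y -> jacobian (psi \o param y) (chart y y) \in unitmx.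
Proof.
move=> hy; rewrite -row_free_unit; apply: inj_row_free => v.
have yy := @dom_center _ _ y; have yK : param y (chart y y) = y by exact: chartK.
have hp : height_pos y (chart y y) by split; [exact: chart_imgP|rewrite /= yK].
have dpsi := CkS_differentiable (gauss_proj_Ck y 1) hp.
have dK := CkS_differentiable (null_gauss_Ck y 1) hp.1.
have dh := CkS_differentiable (gauss_height_Ck y 1) hp.1.
rewrite -(deriveEjacobian v dpsi) => Dpsi0.
apply/eqP/negPn/negP => v0.
have := null_gauss_spacelike y v0.
rewrite /differential -(deriveE v dK).
have iK := derivableP (@diff_derivable _ _ _ _ _ v dK).
have ih := derivableP (@diff_derivable _ _ _ _ _ v dh).
have ip := derivableP (@diff_derivable _ _ _ _ _ v dpsi).
rewrite Dpsi0 in ip.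
have KE : (K \o param y) (chart y y) = K y by rewrite /= yK.
move: iK; set a := 'D_v _ _ => iK.
have aK : mink a (K y) = 0.
  have := is_derive_near_cst (near_forall _ (fun q => null_gauss_null (param y q))) (is_derive_mink iK iK).
  by rewrite KE [mink (K y) a]minkC; lra.
have ih' : is_derive (chart y y) v (hgt \o param y) (- mink a (null_axis p n)).
  exact: is_deriveN (is_derive_mink_cst (null_axis p n) iK).
(* The product rule for [<K, w> = h psi_i], with psi stationary along v, makes one bracket of
   [null_differential] vanish. *)
have projE (i : 'I_2) w : (forall q, height_pos y q -> mink ((K \o param y) q) w =
      (hgt \o param y) q * crd ((psi \o param y) q) i) ->
    hgt y * mink a w + mink a (null_axis p n) * mink (K y) w = 0.
  move=> H; have ipi := is_derive_crd i ip; rewrite crd0 in ipi.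
  have n0 : \forall q \near chart y y, mink ((K \o param y) q) w =
      (hgt \o param y) q * crd ((psi \o param y) q) i.
    have := open_nbhs_nbhs (conj (@height_pos_open y) hp).
    by apply: filterS => q /H.
  have E := is_derive_prod_stationary (is_derive_mink_cst w iK) ih' ipi n0.
  have Kw := H _ hp; rewrite /= yK in Kw E.
  rewrite E Kw; move: (crd _ _) (mink a _) (hgt y) => s t h; ring.
have hneq : hgt y != 0 by rewrite gt_eqF.
have KpE q (i : 'I_2) : height_pos y q ->
    (hgt \o param y) q * crd ((psi \o param y) q) i = mink (K (param y q)) (if i == 0 then v1 else v2).
  move=> [_ hq]; have hq0 : hgt (param y q) != 0 by rewrite gt_eqF.
  exact: (height_null_proj v1 v2 i hq0).
have E1 := projE 0 v1 (fun q hq => esym (KpE q 0 hq)).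
have E2 := projE 1 v2 (fun q hq => esym (KpE q 1 hq)).
have ND := null_differential F (null_gauss_null y) aK hneq.
have ND0 : hgt y ^+ 2 * mink a a = 0.
  apply: (etrans ND); apply: etrans (congr2 (fun s t => s ^+ 2 + t ^+ 2) E1 E2) _.
  by rewrite expr0n addr0.
move: hneq ND0; clear; move: (hgt y) (mink a a) => h t h0 /eqP.
by rewrite mulf_eq0 expf_eq0 /= (negPf h0) /= => /eqP ->; rewrite ltxx.
Qed.

End NullGauss.

(** * Local inverses of the Gauss coordinate *)

Section CkLocal.
Context {R : realType} {V W : normedModType R}.

Lemma Ck_local k (U : set V) (f : V -> W) :
  (forall x, U x -> exists A, [/\ open A, A x & Ck k A f]) -> Ck k U f.
Proof.
move=> H.
have H1 : forall x, U x -> Ck k [set x] f.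
  by move=> x /H[A [_ Ax CA]]; apply: Ck_sub CA => _ ->.
elim: k f {H} H1 => [|k IH] f H; first by move=> x Ux; exact: (H x Ux).
split=> [x Ux|v]; first by have [dx _] := H x Ux; exact: dx.
by apply: IH => x Ux; have [_ Dx] := H x Ux; exact: Dx.
Qed.

End CkLocal.

Section LocalSection.
Context {R : realType} {S : oriented_surface R}.
Variable e : S -> 'rV[R]_(1 + 3).
Hypothesis e_imm : immersion e.
Hypothesis e_isc : inf_strictly_convex e.
Variables p n v1 v2 : 'rV[R]_(1 + 3).
Hypothesis F : orthonormal_frame p n v1 v2.
Let hgt := gauss_height e p n.
Let psi := gauss_proj e p n v1 v2.

Lemma local_section y : 0 < hgt y -> exists W V (sg : 'rV[R]_2 -> S),
  [/\ open W, W y, open V & W `<=` chart_dom y] /\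
  [/\ forall z, W z -> [/\ 0 < hgt z, V (psi z) & sg (psi z) = z],
      forall w, V w -> W (sg w) /\ psi (sg w) = w &
      forall k, Ck k V (chart y \o sg)].
Proof.
move=> hy; pose Om := height_pos e p n y.
have yy := @dom_center _ _ y; have yK : param y (chart y y) = y by exact: chartK.
have hp : Om (chart y y) by split; [exact: chart_imgP|rewrite /= yK].
have [W0 [V [g [oW0 W0y W0O oV [gW gV gC]]]]] := inverse_function
  (@height_pos_open _ _ _ e_imm p n y) hp (@gauss_proj_Ck _ _ _ e_imm p n v1 v2 y)
  (gauss_proj_unit e_imm e_isc F hy).
exists (chart_dom y `&` chart y @^-1` W0), V, (param y \o g); split; split.
- exact: open_chart_preimage.
- by split; [exact: yy|exact: W0y].
- exact: oV.
- by move=> z [].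
- move=> z [yz Wz]; have [Vz gz] := gW _ Wz.
  have zK : param y (chart y z) = z by exact: chartK.
  rewrite /= zK in Vz gz; have [_ hz] := W0O _ Wz; rewrite /= zK in hz.
  by split; [exact: hz|exact: Vz|rewrite /= gz zK].
- move=> w Vw; have [Wg fg] := gV _ Vw; split; last exact: fg.
  by have [gp gq] := paramK (W0O _ Wg).1; split; [exact: gp|rewrite /= gq].
- move=> k; apply: Ck_ext oV _ (gC k) => w Vw /=.
  by have [Wg _] := gV _ Vw; have [_ ->] := paramK (W0O _ Wg).1.
Qed.

(** By continuity, b takes its values near each point in the domain W of a local inverse, and
    [psi (b w) = w] forces it to be this inverse. So the continuation only has to track
    continuity. *)
Lemma section_smooth (U : set 'rV[R]_2) (b : 'rV[R]_2 -> S) x k :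
  open U -> (forall z, U z -> {for z, continuous b}) ->
  (forall z, U z -> 0 < hgt (b z) /\ psi (b z) = z) ->
  Ck k (U `&` b @^-1` chart_dom x) (chart x \o b).
Proof.
move=> oU cb bP; apply: Ck_local => z [Uz xz]; have [hz pz] := bP z Uz.
have [W [V [sg [[oW Wz oV Wd] [sW sV sC]]]]] := local_section hz.
have : nbhs z (fun w => U w /\ b w \in (W `&` chart_dom x)).
  have nU : nbhs z U by exact: open_nbhs_nbhs.
  have nW : nbhs (b z) (W `&` chart_dom x).
    apply: open_nbhs_nbhs; split; last by split; [exact: Wz|exact: xz].
    by apply: openI; [exact: oW|exact: dom_open].
  have := @filterI _ _ (nbhs_filter z) _ _ nU (cb z Uz _ nW).
  apply: (@filterS _ _ (nbhs_filter z)) => w [Uw Ww].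
  by split; [exact: Uw|rewrite inE].
rewrite nbhsE => -[A [oA Az] AS].
have bs w : A w -> V w /\ b w = sg w.
  move=> /AS[Uw]; rewrite inE => -[Ww _]; have [_ pw] := bP w Uw.
  by have [_ Vw <-] := sW _ Ww; rewrite pw in Vw *.
exists A; split=> //.
have CA : Ck k A (chart (b z) \o sg) by apply: Ck_sub (sC k) => w /bs[].
have ov w : A w -> overlap (b z) x ((chart (b z) \o sg) w).
  move=> Aw; have [_ bw] := bs w Aw; have [_] := AS w Aw; rewrite inE => -[Ww xw].
  have zw : chart_dom (b z) (sg w) by rewrite -bw; exact: Wd.
  split; first exact: chart_imgP.
  by rewrite /= chartK // -bw.
have CC := Ck_comp_row oA (@overlap_open _ _ (b z) x) ov CA (transition_Ck (b z) x k).
apply: Ck_ext oA _ CC => w Aw /=; have [_ bw] := bs w Aw; have [_] := AS w Aw.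
by rewrite inE => -[Ww xw]; rewrite bw chartK //; apply: Wd; rewrite -bw.
Qed.

End LocalSection.

(** * Comparison for a second-order differential inequality *)

Section Comparison.
Context {R : realType}.

(** The derivative H1 is positive just to the right of s. Only that side enters for H, so that a
    maximum at the left end of an interval is excluded too. *)
Lemma increase_right (H H1 : R -> R) (s d H2 : R) : 0 < d ->
  (forall t, s <= t < s + d -> is_derive t 1 H (H1 t)) ->
  is_derive s 1 H1 H2 -> H1 s = 0 -> 0 < H2 ->
  exists u, s < u < s + d /\ H s < H u.
Proof.
move=> d0 dH dH1 H1s H20.
have df : differentiable H1 s by case: dH1 => + _ => /derivable1_diffP.
have e0 : 0 < H2 / 2 by rewrite divr_gt0.
have DE : 'D_1 H1 s = H2 by case: dH1.
have /nbhs_ballP[r /= r0 Hr] := differentiable_eps df e0.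
pose u := s + Num.min (r / 2) (d / 2).
have m0 : 0 < Num.min (r / 2) (d / 2) by rewrite lt_min !divr_gt0.
have mr : Num.min (r / 2) (d / 2) <= r / 2 by rewrite ge_min lexx.
have md : Num.min (r / 2) (d / 2) <= d / 2 by rewrite ge_min lexx orbT.
have su : s < u by rewrite ltrDl.
have ud : u < s + d by rewrite /u; lra.
exists u; split; first by rewrite su.
have dHu t : t \in `]s, u[ -> is_derive t 1 H (H1 t).
  by rewrite in_itv /= => /andP[st tu]; apply: dH; lra.
have cH : {within `[s, u], continuous H}.
  apply: derivable_within_continuous => t; rewrite in_itv /= => /andP[st tu].
  by have [] : is_derive t 1 H (H1 t) by apply: dH; lra.
have [c cu E] := MVT su dHu cH.
move: cu; rewrite in_itv /= => /andP[sc cu].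
have cs0 : 0 < c - s by rewrite subr_gt0.
have bc : ball s r c.
  by rewrite -ball_normE /= distrC gtr0_norm //; rewrite /u in cu; lra.
have := Hr c bc; rewrite H1s subr0 (gtr0_norm cs0).
have -> : 'd H1 s (c - s) = (c - s) * H2.
  by rewrite -[c - s in LHS]mulr1 [X in 'd H1 s X](_ : _ = (c - s) *: 1) // linearZ /= -deriveE // DE.
rewrite ler_norml => /andP[h _].
have H1c : 0 < H1 c by nra.
by rewrite -subr_gt0 E mulr_gt0 // subr_gt0.
Qed.

(* With H = F - (1 - r t^2 / 4), the differential inequality forces H'' > 0
   wherever H >= 0 and H' = 0, so H has no nonnegative maximum on [0, t]. *)
Lemma riccati_comparison (T r : R) (F G G1 : R -> R) :
  0 <= r -> F 0 = 1 -> G 0 = 0 ->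
  (forall t, 0 <= t < T -> [/\ is_derive t 1 F (G t), is_derive t 1 G (G1 t),
     0 < F t & (G t ^+ 2 - r) / (2 * F t) < G1 t]) ->
  forall t, 0 <= t < T -> 1 - r * t ^+ 2 / 4 <= F t.
Proof.
move=> r0 F0 G0 HH t1 /andP[t10 t1T]; rewrite leNgt; apply/negP => Ft1.
pose H t := F t - 1 + r / 4 * (t * t).
pose H1 t := G t + r / 2 * t.
have dH t : 0 <= t < T -> is_derive t 1 H (H1 t).
  move=> /HH[dF _ _ _].
  have D := is_deriveD (is_deriveB dF (is_derive_cst (1 : R) t 1))
    (is_deriveZ (r / 4) (is_deriveM (is_derive_id t 1) (is_derive_id t 1))).
  case: D => d dE; apply: DeriveDef; first exact: d.
  by apply: etrans dE _; rewrite /H1 /GRing.scale /=; field.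
have dH1 t : 0 <= t < T -> is_derive t 1 H1 (G1 t + r / 2).
  move=> /HH[_ dG _ _].
  have D := is_deriveD dG (is_deriveZ (r / 2) (is_derive_id t 1)).
  case: D => d dE; apply: DeriveDef; first exact: d.
  by apply: etrans dE _; rewrite /GRing.scale /= mulr1.
have H0 : H 0 = 0 by rewrite /H F0; ring.
have Ht1 : H t1 < 0 by rewrite /H; lra.
have t1n : 0 < t1.
  by rewrite lt_neqAle t10 andbT; apply/eqP => E; move: Ht1; rewrite -E H0 ltxx.
have cH : {within `[0, t1], continuous H}.
  apply: derivable_within_continuous => t; rewrite in_itv /= => /andP[st tu].
  by have [] : is_derive t 1 H (H1 t) by apply: dH; lra.
have [s s01 smax] := EVT_max t10 cH.
move: (s01); rewrite in_itv /= => /andP[s0 st1].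
have Hs : 0 <= H s by rewrite -H0; apply: smax; rewrite in_itv /= lexx.
have sn : s < t1.
  by rewrite lt_neqAle st1 andbT; apply/eqP => E; move: Hs; rewrite E leNgt Ht1.
have sT : 0 <= s < T by lra.
have H1s : H1 s = 0.
  have [s00|s00] := eqVneq s 0; first by rewrite s00 /H1 G0; ring.
  have s0' : 0 < s by rewrite lt_neqAle eq_sym s00.
  have [_ <-] := dH s sT.
  have := @derive1_at_max _ H 0 t1 s t10.
  have dd t : t \in `]0, t1[ -> derivable H t 1.
    by rewrite in_itv /= => /andP[st tu]; have [] : is_derive t 1 H (H1 t) by apply: dH; lra.
  move=> /(_ dd); rewrite in_itv /= s0' sn => /(_ isT).
  have m t : t \in `]0, t1[ -> H t <= H s.
    by move=> h; apply: smax; exact: subset_itv_oo_cc h.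
  by move=> /(_ m) [].
have [_ _ Fs ineq] := HH s sT.
have H2s : 0 < G1 s + r / 2.
  have Gs : G s = - (r / 2 * s) by move: H1s; rewrite /H1; lra.
  have FE : F s = H s + 1 - r / 4 * (s * s) by rewrite /H; ring.
  suff : - (r / 2) <= (G s ^+ 2 - r) / (2 * F s) by lra.
  rewrite ler_pdivlMr ?mulr_gt0 // Gs.
  have : 0 <= r * H s by exact: mulr_ge0.
  have -> : - (r / 2) * (2 * F s) = - r * F s by field.
  by rewrite FE; lra.
have d0 : 0 < t1 - s by rewrite subr_gt0.
have dHs t : s <= t < s + (t1 - s) -> is_derive t 1 H (H1 t).
  by move=> /andP[h1 h2]; apply: dH; lra.
have [u [/andP[su ut] Hu]] := increase_right d0 dHs (dH1 s sT) H1s H2s.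
have : H u <= H s by apply: smax; rewrite in_itv /=; lra.
by rewrite leNgt Hu.
Qed.

End Comparison.

(** * The Riccati inequality along the lift of a ray *)

Section GaussCurve.
Context {R : realType}.

(** The component w of a orthogonal to l, m and d is orthogonal to the timelike vector [l + m], so
    its square [-1 + 2 <a, l> <a, m> - <a, d>^2 / r] is nonnegative. *)
Lemma null_frame_timelike (a l m d : 'rV[R]_(1 + 3)) (r : R) : 0 < r ->
  mink a a = -1 -> mink l l = 0 -> mink m m = 0 -> mink l m = -1 ->
  mink l d = 0 -> mink m d = 0 -> mink d d = r ->
  r + mink a d ^+ 2 <= 2 * mink a l * mink a m * r.
Proof.
move=> r0 aa ll mm lm ld md dd; have rn : r != 0 by rewrite gt_eqF.
pose w := a + mink a m *: l + mink a l *: m - (mink a d / r) *: d.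
have lm0 : mink (l + m) (l + m) < 0.
  by rewrite !mink_lin ll mm [mink m l]minkC lm; lra.
have lw : mink (l + m) w = 0.
  rewrite /w !mink_lin ll mm [mink m l]minkC lm ld md [mink l a]minkC [mink m a]minkC; ring.
have [+ _] := timelike_orthogonal_ge0 lm0 lw.
have -> : mink w w = -1 + 2 * mink a m * mink a l - mink a d ^+ 2 / r.
  rewrite /w !mink_lin aa ll mm dd [mink m l]minkC lm [mink d l]minkC [mink d m]minkC ld md.
  rewrite [mink l a]minkC [mink m a]minkC [mink d a]minkC; field; exact: rn.
move=> H; have := mulr_ge0 (ltW r0) H; rewrite mulrBr mulrDr mulrN1 [r * (_ / r)]mulrC divfK //.
by lra.
Qed.

(* F = 1 / h, where h is the height of K along the lift of a ray, and
   E, ne, nn are <e', e'>, <e', N'>, <N', N'>. *)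
Lemma riccati_inequality (F x nn ne E g C r : R) : 0 < F -> 0 <= nn -> 0 < ne ->
  E + ne + (ne + nn) = r * F^-1 ^+ 2 -> E + ne = F^-1 * x ->
  r + g ^+ 2 <= 2 * - F * C * r -> (g ^+ 2 - r) / (2 * F) < - x - r * C.
Proof.
move=> F0 nn0 ne0 e1 e2 ineq; have Fn : F != 0 by rewrite gt_eqF.
have xE : x = F * (E + ne) by rewrite e2; field.
have e3 : r = F * F * (E + ne + (ne + nn)) by rewrite e1; field.
have xr : F * x < r.
  rewrite xE e3 -subr_gt0.
  have -> : F * F * (E + ne + (ne + nn)) - F * (F * (E + ne)) = F * F * (ne + nn) by ring.
  by rewrite !mulr_gt0 // ltr_pwDl.
rewrite ltr_pdivrMr ?mulr_gt0 //.
have -> : (- x - r * C) * (2 * F) = - 2 * (F * x) + 2 * - F * C * r by ring.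
by lra.
Qed.

Lemma ray_mink_abs (kk mm v1 v2 : 'rV[R]_(1 + 3)) (z t r : R) (y : R) :
  [/\ mink kk kk = 0, mink mm mm = 0 & mink kk mm = -1] /\
  [/\ mink kk v1 = 0, mink kk v2 = 0, mink mm v1 = 0 & mink mm v2 = 0] /\
  [/\ mink v1 v1 = 1, mink v2 v2 = 1 & mink v1 v2 = 0] -> r = z * z + y * y ->
  let ev := z *: v1 + y *: v2 in
  let lp := kk + t *: ev + (t * t * (r / 2)) *: mm in let lv := ev + (t * r) *: mm in
  [/\ mink lp lp = 0, mink lp lv = 0, mink lv lv = r, mink lp mm = -1 & mink lv mm = 0].
Proof.
move=> [[k0 m0 km] [[k1 k2 m1 m2] [v11 v22 v12]]] rE ev lp lv.
rewrite /lp /lv /ev !mink_lin k0 m0 km ?[mink mm kk]minkC ?km !(minkC v1 kk) !(minkC v2 kk) !(minkC v1 mm)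
  !(minkC v2 mm) (minkC v2 v1) k1 k2 m1 m2 v11 v22 v12 rE.
by split; field.
Qed.

Variables p n v1 v2 : 'rV[R]_(1 + 3).
Hypothesis F : orthonormal_frame p n v1 v2.
Variable zeta : 'rV[R]_2.
Let r : R := dot zeta zeta.
Let kk := p + n.
Let mm := null_axis p n.
Let ev := zeta 0 0 *: v1 + zeta 0 1 *: v2.

Definition ray_point (t : R) : 'rV[R]_(1 + 3) := null_point p n v1 v2 (t *: zeta).
Let Lp := ray_point.
(** The derivative of [ray_point] in t. *)
Definition ray_vel (t : R) : 'rV[R]_(1 + 3) := ev + (t * r) *: mm.
Let Lv := ray_vel.

Lemma ray_pointE t : Lp t = kk + t *: ev + (t * t * (r / 2)) *: mm.
Proof.
rewrite /Lp /ray_point /null_point /r /ev !dot2_sum.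
by apply/rowP => i; rewrite !mxE; field.
Qed.

Lemma mink_ray_point t w :
  mink w (Lp t) = mink w kk + t * mink w ev + (t * t * (r / 2)) * mink w mm.
Proof.
by rewrite ray_pointE [LHS]minkDr [X in X + _ = _]minkDr
  (minkZr t ev w) (minkZr (t * t * (r / 2)) mm w).
Qed.

Lemma mink_ray_vel t w : mink w (Lv t) = mink w ev + t * r * mink w mm.
Proof. by rewrite /Lv /ray_vel [LHS]minkDr (minkZr (t * r) mm w). Qed.

Lemma ray_mink t : [/\ mink (Lp t) (Lp t) = 0, mink (Lp t) (Lv t) = 0, mink (Lv t) (Lv t) = r,
  mink (Lp t) mm = -1 & mink (Lv t) mm = 0].
Proof.
by rewrite ray_pointE; apply: (ray_mink_abs t (frame_mink F)); exact: dot2_sum.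
Qed.

(** The interval starts at some a < 0 so that two-sided derivatives are available at time 0. *)
Variables (a T : R) (ec Nc e' N' : R -> 'rV[R]_(1 + 3)).
Hypothesis r0 : 0 < r.
Hypothesis a0 : a < 0.
Let h t := height p n (ec t + Nc t).
Hypothesis curve_derive : forall t, a < t < T ->
  is_derive t 1 ec (e' t) /\ is_derive t 1 Nc (N' t).
Hypothesis curve_mink : forall t, a < t < T ->
  [/\ mink (ec t) (ec t) = -1, mink (ec t) (Nc t) = 0, mink (e' t) (ec t) = 0,
      mink (e' t) (Nc t) = 0 & mink (N' t) (ec t) = 0].
Hypothesis curve_ray : forall t, a < t < T -> 0 < h t /\ ec t + Nc t = h t *: Lp t.

(** This is [K = h L] differentiated, with [h' = - <K', mm>]; pairing with a fixed w keeps every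
    derivative scalar. *)
Lemma curve_pairing t w : a < t < T ->
  mink (e' t + N' t) w = - mink (e' t + N' t) mm * mink (Lp t) w + h t * mink (Lv t) w.
Proof.
move=> tT; have [de dN] := curve_derive tT; have dK := is_deriveD de dN.
have dKw := is_derive_mink_cst w dK.
have dh := is_deriveN (is_derive_mink_cst mm dK).
pose Q s := mink kk w + s * mink ev w + (s * s * (r / 2)) * mink mm w.
have dQ : is_derive t 1 Q (mink ev w + t * r * mink mm w).
  have D := is_deriveD (is_deriveD (is_derive_cst (mink kk w) t 1)
    (is_deriveZ (mink ev w) (is_derive_id t 1)))
    (is_deriveZ (r / 2 * mink mm w) (is_deriveM (is_derive_id t 1) (is_derive_id t 1))).
  case: D => d dE.
  have QE : Q = cst (mink kk w) + mink ev w *: id + (r / 2 * mink mm w) *: (id * id).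
    by apply/funext => s; rewrite /Q !fctE /GRing.scale /=; ring.
  rewrite QE; apply: DeriveDef; first exact: d.
  by apply: etrans dE _; rewrite /GRing.scale /=; field.
have QL s : Q s = mink (Lp s) w.
  by rewrite [RHS]minkC mink_ray_point /Q ![mink w _]minkC.
have LvE : mink ev w + t * r * mink mm w = mink (Lv t) w.
  by rewrite [RHS]minkC mink_ray_vel ![mink w _]minkC.
have nt : \forall s \near t, a < s < T.
  have := open_nbhs_nbhs (conj (@interval_open R (BRight a) (BLeft T) isT isT) _ : open_nbhs t _).
  by rewrite /= in_itv /= => /(_ tT); apply: filterS => s; rewrite /= in_itv.
have D := is_deriveB dKw (is_deriveM dh dQ).
have n1 : \forall s \near t, ((fun s => mink ((ec + Nc) s) w) -
    (- (fun s => mink ((ec + Nc) s) mm)) * Q) s = 0.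
  apply: filterS nt => s /curve_ray[_ E]; rewrite !fctE QL {1}E minkZl.
  by rewrite /h /height subrr.
have := is_derive_near_cst n1 D; rewrite !fctE QL LvE /GRing.scale /= => /eqP.
by rewrite subr_eq0 => /eqP ->; rewrite /h /height; ring.
Qed.

Lemma curve_speed t : a < t < T ->
  mink (e' t + N' t) (e' t + N' t) = r * h t ^+ 2.
Proof.
move=> tT; have [ll lv vv lm vm] := ray_mink t.
rewrite {1}(curve_pairing _ tT) [mink (Lp t) _]minkC [mink (Lv t) _]minkC.
rewrite (curve_pairing (Lp t) tT) (curve_pairing (Lv t) tT) ll vv lv [mink (Lv t) (Lp t)]minkC lv.
by ring.
Qed.

Hypothesis curve_convex : forall t, a < t < T -> 0 < mink (N' t) (e' t).

Lemma curve_N'_ge0 t : a < t < T -> 0 <= mink (N' t) (N' t).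
Proof.
move=> tT; have [ee _ _ _ h4] := curve_mink tT.
have ee0 : mink (ec t) (ec t) < 0 by rewrite ee ltrN10.
by have [] := timelike_orthogonal_ge0 ee0 (etrans (minkC _ _) h4).
Qed.

Hypothesis curve_start : ec 0 = p.

(** [FF] is [1 / h] because [<e, K> = -1]. Its derivative is [G] alone because e' is orthogonal to
    K, hence to L ([e'L]), and [G1] uses that the second derivative of L is [r mm]. Thus the
    second-order comparison involves only first derivatives of the curve. *)
Lemma curve_height_bound t : 0 <= t < T -> 1 - r * t ^+ 2 / 4 <= (h t)^-1.
Proof.
have sub s : 0 <= s < T -> a < s < T by move=> /andP[s0 ->]; rewrite andbT (lt_le_trans a0).
have [[k0 m0 km] [[k1 k2 m1 m2] [v11 v22 v12]]] := frame_mink F.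
pose FF s := - mink (ec s) (Lp s); pose G s := - mink (ec s) (Lv s).
pose G1 s := - mink (e' s) (Lv s) - r * mink (ec s) mm.
have FE s : a < s < T -> FF s = (h s)^-1.
  move=> sT; have [hs E] := curve_ray sT; have [ee en _ _ _] := curve_mink sT.
  have : mink (ec s) (ec s + Nc s) = -1 by rewrite mink_lin ee en addr0.
  rewrite E minkZr => H; apply: (mulfI (lt0r_neq0 hs)); rewrite divff ?lt0r_neq0 //.
  by rewrite /FF mulrN H opprK.
have e'L s : a < s < T -> mink (e' s) (Lp s) = 0.
  move=> sT; have [hs E] := curve_ray sT; have [_ _ h1 h2 _] := curve_mink sT.
  have : mink (e' s) (ec s + Nc s) = 0 by rewrite mink_lin h1 h2 addr0.
  by rewrite E minkZr => /eqP; rewrite mulf_eq0 (negPf (lt0r_neq0 hs)) /= => /eqP.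
have FpE : FF 0 = 1.
  have [[pp nn _ _] [[pn p1 p2] _]] := F.
  rewrite /FF curve_start ray_pointE /kk !mink_lin pp pn; ring.
have GpE : G 0 = 0.
  have [[pp nn _ _] [[pn p1 p2] _]] := F.
  by rewrite /G curve_start /Lv /ray_vel /ev !mink_lin p1 p2; ring.
move=> tT; rewrite -(FE t (sub _ tT)).
move: t tT; apply: (@riccati_comparison _ T r FF G G1) => //; first exact: ltW.
move=> t tT'; have tT := sub _ tT'; have [de _] := curve_derive tT.
have [hs E] := curve_ray tT; have [ee en _ _ _] := curve_mink tT.
have [ll lv vv lm vm] := ray_mink t.
have Fp : 0 < FF t by rewrite FE // invr_gt0.
have dw w := is_derive_mink_cst w de.
split; last 2 first.
- exact: Fp.
- have ineq := null_frame_timelike r0 ee ll m0 lm lv (etrans (minkC _ _) vm) vv.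
  have pair := curve_pairing (e' t) tT.
  rewrite minkDl [mink (Lp t) _]minkC (e'L _ tT) mulr0 add0r [mink (Lv t) _]minkC in pair.
  have sp := curve_speed tT.
  rewrite !mink_lin [mink (e' t) (N' t)]minkC in sp.
  have := curve_convex tT; have := curve_N'_ge0 tT.
  have hF : h t = (FF t)^-1 by rewrite FE // invrK.
  rewrite hF in sp pair; rewrite /G1.
  have FL : mink (ec t) (Lp t) = - FF t by rewrite /FF opprK.
  rewrite FL in ineq; rewrite /G sqrrN.
  move=> c1 c2; apply: (riccati_inequality Fp c1 c2 _ pair ineq).
  by rewrite -sp addrA.
- pose A s := mink (ec s) kk; pose B s := mink (ec s) ev; pose C s := mink (ec s) mm.
  have FFE : FF = - (A + id * B + ((r / 2) *: (id * id)) * C).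
    apply/funext => s; rewrite !fctE /FF mink_ray_point /A /B /C /GRing.scale /=; ring.
  have D := is_deriveN (is_deriveD (is_deriveD (dw kk) (is_deriveM (is_derive_id t 1) (dw ev)))
    (is_deriveM (is_deriveZ (r / 2) (is_deriveM (is_derive_id t 1) (is_derive_id t 1))) (dw mm))).
  have e'L0 := e'L _ tT; rewrite mink_ray_point in e'L0.
  rewrite FFE; case: D => d dE; apply: DeriveDef; first exact: d.
  apply: etrans dE _; rewrite !fctE /G mink_ray_vel /GRing.scale /=.
  move: (mink (e' t) kk) (mink (e' t) ev) (mink (e' t) mm) (mink (ec t) ev) (mink (ec t) mm) e'L0.
  move=> k b c s u H.
  have -> : k = - (t * b + t * t * (r / 2) * c) by lra.
  by rewrite (_ : (r / 2) *: (t * t) = r / 2 * (t * t)) //; field.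
- pose B s := mink (ec s) ev; pose C s := mink (ec s) mm.
  have GE : G = - (B + (r *: id) * C).
    apply/funext => s; rewrite !fctE /G mink_ray_vel /B /C /GRing.scale /=; ring.
  have D := is_deriveN (is_deriveD (dw ev) (is_deriveM (is_deriveZ r (is_derive_id t 1)) (dw mm))).
  rewrite GE; case: D => d dE; apply: DeriveDef; first exact: d.
  apply: etrans dE _; rewrite /G1 mink_ray_vel /GRing.scale /= (_ : r *: t = r * t) //; ring.
Qed.

End GaussCurve.

(** * Lengths as integrals *)

Section Integrals.
Context {R : realType}.
Let mu := @lebesgue_measure R.

(* No measurability is needed: the integral of a nonnegative function is a
   supremum over the simple functions below it. *)
Lemma ge0_le_integral_subset (D E : set R) (f g : R -> \bar R) :
  (forall x, D x -> (0 <= f x)%E /\ (f x <= g x)%E) ->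
  (forall x, E x -> (0 <= g x)%E) -> D `<=` E ->
  (\int[mu]_(x in D) f x <= \int[mu]_(x in E) g x)%E.
Proof.
move=> fg g0 DE; rewrite !ge0_integralE //; last by move=> x /fg[].
apply: le_ereal_sup => _ [h hf <-]; exists h => // x.
apply: le_trans (hf x) _; rewrite !patchE.
have [|nD] := boolP (x \in D).
  rewrite inE => Dx; rewrite ifT; last by rewrite inE; exact: DE.
  by case: (fg x Dx).
by case: ifPn => //; rewrite inE => /g0.
Qed.

(** The fundamental theorem of calculus bounds the increment by the integral of [|'D_1 F|]; the
    function s, a speed in the application, enters by pointwise comparison. *)
Lemma increment_le_integral (F s : R -> R) (a b K : R) : a <= b -> 0 < K ->
  (forall t, a <= t <= b -> derivable F t 1) ->
  (forall t, a <= t <= b -> {for t, continuous (fun t => 'D_1 F t)}) ->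
  (forall t, a <= t <= b -> `|'D_1 F t| <= K * s t) ->
  ((`|F b - F a| / K)%:E <= \int[mu]_(t in `[a, b]) (s t)%:E)%E.
Proof.
move=> ab K0 dF cF Fs.
have s0 t : [set` `[a, b]] t -> (0 <= (s t)%:E)%E.
  rewrite /= in_itv /= => tab; rewrite lee_fin -(pmulr_rge0 _ K0).
  exact: le_trans (Fs t tab).
have [E|nab] := eqVneq a b.
  rewrite -E subrr normr0 mul0r; apply: integral_ge0 => t tab.
  by apply: s0; rewrite -E.
have ab' : a < b by rewrite lt_neqAle nab.
pose f : R -> R := fun t => 'D_1 F t / K.
have cf : {within `[a, b], continuous f}.
  apply: continuous_in_subspaceT => t; rewrite inE /= in_itv /= => tab.
  apply: cvgM; last exact: cvg_cst.
  exact: cF.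
have dFK t : a <= t <= b -> is_derive t 1 (fun t => F t / K) (f t).
  move=> tab.
  have [d dE] := is_deriveZ K^-1 (derivableP (dF t tab)).
  have E : (fun t => F t / K) = K^-1 *: F.
    by apply/funext => u; rewrite fctE /GRing.scale /= mulrC.
  rewrite E; apply: DeriveDef; first exact: d.
  by apply: etrans dE _; rewrite /f /GRing.scale /= mulrC.
have cFK t : a <= t <= b -> {for t, continuous (fun t => F t / K)}.
  by move=> /dFK[/derivable1_diffP d _]; exact: differentiable_continuous.
have dLR : derivable_oo_LRcontinuous (fun t => F t / K) a b.
  split.
  - move=> t; rewrite in_itv /= => /andP[t1 t2].
    by have [] : is_derive t 1 (fun t => F t / K) (f t) by apply: dFK; rewrite !ltW.
  - by apply: cvg_at_right_filter; apply: cFK; rewrite lexx ltW.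
  - by apply: cvg_at_left_filter; apply: cFK; rewrite lexx ltW.
have dE : {in `]a, b[, derive1 (fun t => F t / K) =1 f}.
  move=> t; rewrite in_itv /= => /andP[t1 t2]; rewrite derive1E.
  by have [_ ->] : is_derive t 1 (fun t => F t / K) (f t) by apply: dFK; rewrite !ltW.
have FTC := continuous_FTC2 ab' cf dLR dE.
have mf0 : measurable_fun [set` `[a, b]] f by exact: subspace_continuous_measurable_fun.
have mf := (measurable_EFinP _ _).2 mf0.
have -> : (`|F b - F a| / K)%:E = (`| \int[mu]_(x in `[a, b]) (f x)%:E |)%E.
  rewrite (_ : (\int[mu]_(x in `[a, b]) (f x)%:E)%E = (F b / K)%:E - (F a / K)%:E)%E //.
  by rewrite -EFinB /= -mulrBl normrM [`|K^-1|]gtr0_norm ?invr_gt0.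
have ineq := le_abse_integral mu (measurable_itv `[a, b]) mf.
apply: (le_trans ineq).
apply: ge0_le_integral_subset => // t tab; split; first exact: abse_ge0.
move: tab; rewrite /= in_itv /= => tab.
rewrite lee_fin /f normrM [`|K^-1|]gtr0_norm ?invr_gt0 // ler_pdivrMr // mulrC.
exact: Fs.
Qed.

End Integrals.

(** * The distance of I + III against the topology of the surface *)

Section Distance.
Context {R : realType} {S : oriented_surface R}.

Lemma riemannian_dist_le (g : tensor2 S) (c : R -> S) (a b K : R) :
  a <= b -> C1_curve c a b -> 0 <= K ->
  (forall t, a <= t <= b -> g (c t) (velocity c t) (velocity c t) <= K ^+ 2) ->
  (riemannian_dist g (c a) (c b) <= (K * (b - a))%:E)%E.
Proof.
move=> ab Cc K0 gK; apply: le_trans (_ : (curve_length g c a b <= _)%E).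
  by apply: ereal_inf_lbound; exists c, a, b; split.
rewrite /curve_length.
apply: (@le_trans _ _ (\int[lebesgue_measure]_(t in `[a, b]) (cst K%:E) t)%E).
  apply: ge0_le_integral_subset; [move=> t|by move=> t _; rewrite lee_fin|by []].
  rewrite /= in_itv /= => tab; split; first by rewrite lee_fin sqrtr_ge0.
  by rewrite lee_fin -[leRHS]ger0_norm // -sqrtr_sqr ler_wsqrtr // gK.
rewrite integral_cst //= lebesgue_measure_itv /=.
have [E|nab] := eqVneq a b; first by rewrite E ltxx mule0 subrr mulr0.
by rewrite lte_fin lt_neqAle nab ab EFinM EFinB.
Qed.

Variable e : S -> 'rV[R]_(1 + 3).
Hypothesis e_imm : immersion e.
Implicit Types (x y z : S) (q : 'rV[R]_2).

Let gsum : tensor2 S := fun x xi nu => fundamental1 e x xi nu + fundamental3 e x xi nu.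

Lemma gram_lower_bound (G F H s t : R) : 0 < G * H - F ^+ 2 ->
  let Q := s ^+ 2 * G + 2 * s * t * F + t ^+ 2 * H in
  (G * H - F ^+ 2) * t ^+ 2 <= G * Q /\ (G * H - F ^+ 2) * s ^+ 2 <= H * Q.
Proof.
move=> D0 Q; split; rewrite -subr_ge0.
  have -> : G * Q - (G * H - F ^+ 2) * t ^+ 2 = (s * G + t * F) ^+ 2 by rewrite /Q; ring.
  exact: sqr_ge0.
have -> : H * Q - (G * H - F ^+ 2) * s ^+ 2 = (t * H + s * F) ^+ 2 by rewrite /Q; ring.
exact: sqr_ge0.
Qed.

Lemma near_gt (T : topologicalType) (f : T -> R) p c :
  {for p, continuous f} -> c < f p -> \forall y \near p, c < f y.
Proof. by move=> cf fp; exact: (cvgr_gt _ cf). Qed.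

Lemma near_lt (T : topologicalType) (f : T -> R) p c :
  {for p, continuous f} -> f p < c -> \forall y \near p, f y < c.
Proof. by move=> cf fp; exact: (cvgr_lt _ cf). Qed.

(** [gram_lower_bound] bounds each squared entry of v by Q times a diagonal entry over the
    determinant, and [(g + h) / d] dominates both quotients. *)
Lemma metric_bound_aux (G F H d g h Q : R) (v : 'rV[R]_2) : 0 < d -> 0 < G -> 0 < H ->
  d < G * H - F ^+ 2 -> G < g -> H < h ->
  Q = v 0 0 ^+ 2 * G + 2 * v 0 0 * v 0 1 * F + v 0 1 ^+ 2 * H ->
  `|v| <= Num.sqrt ((g + h) / d) * Num.sqrt Q.
Proof.
move=> d0 G0 H0 dD Gg Hh QE.
have D0 : 0 < G * H - F ^+ 2 by exact: lt_trans dD.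
have [] := gram_lower_bound (v 0 0) (v 0 1) D0; rewrite -QE => b1 b2.
have Q0 : 0 <= Q by rewrite -(pmulr_rge0 _ G0); apply: le_trans b1; rewrite mulr_ge0 ?sqr_ge0 // ltW.
have M0 : 0 <= (g + h) / d.
  by rewrite divr_ge0 // ?ltW // addr_gt0 // (lt_trans _ Gg, lt_trans _ Hh).
rewrite -sqrtrM //.
have bound (x w : R) : w <= g + h -> (G * H - F ^+ 2) * x ^+ 2 <= w * Q ->
    x ^+ 2 <= (g + h) / d * Q.
  move=> wg xQ; rewrite mulrAC ler_pdivlMr //.
  apply: (@le_trans _ _ (w * Q)); last exact: ler_wpM2r.
  by apply: le_trans xQ; rewrite mulrC ler_wpM2r ?sqr_ge0 // ltW.
apply: norm_row_le => [|i]; first exact: sqrtr_ge0.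
rewrite -sqrtr_sqr ler_wsqrtr //.
case: i => -[|[|//]] hi.
  rewrite (_ : Ordinal hi = 0); last exact/val_inj.
  by apply: bound b2; rewrite ler_wpDl ?ltW // (lt_trans G0).
rewrite (_ : Ordinal hi = 1); last exact/val_inj.
by apply: bound b1; rewrite ler_wpDr ?ltW // (lt_trans H0).
Qed.

(** The first fundamental form is positive definite at x. By continuity, on a small ball its
    determinant stays above half its value at x and its diagonal entries below their values plus 1,
    as [metric_bound_aux] asks. *)
Lemma metric_lower_bound x : exists r K : R, [/\ 0 < r, 0 < K,
  ball (chart x x) r `<=` chart_img x &
  forall q v, ball (chart x x) r q ->
    `|v| <= K * Num.sqrt (mink ('d (e \o param x) q v) ('d (e \o param x) q v))].
Proof.
pose E := e \o param x; pose D (i : 'I_2) q := 'D_(delta_mx 0 i) E q.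
pose G q := mink (D 0 q) (D 0 q); pose FF q := mink (D 0 q) (D 1 q); pose H q := mink (D 1 q) (D 1 q).
have xx := @dom_center _ _ x; have oI := @chart_img_open _ _ x.
have qx := chart_imgP xx; set q0 := chart x x in qx *.
have QE q v : chart_img x q -> mink ('d E q v) ('d E q v) =
    (v 0 0) ^+ 2 * G q + 2 * v 0 0 * v 0 1 * FF q + (v 0 1) ^+ 2 * H q.
  move=> xq; have dE := immersion_differentiable e_imm xq.
  have E2 := differential_row2 v dE.
  transitivity (mink (v 0 0 *: D 0 q + v 0 1 *: D 1 q) (v 0 0 *: D 0 q + v 0 1 *: D 1 q)).
    exact: (congr2 (@mink R) E2 E2).
  rewrite /G /FF /H; move: (D 0 q) (D 1 q) (v 0 0) (v 0 1) => d0 d1 s t.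
  by rewrite !mink_lin [mink d1 d0]minkC; ring.
have Qpos v : v != 0 -> 0 < mink ('d E q0 v) ('d E q0 v).
  move=> v0; have [ee _] := immersion_H3 e_imm x.
  have ee0 : mink (e x) (e x) < 0 by rewrite ee ltrN10.
  have [g0 g1] := timelike_orthogonal_ge0 ee0 (mink_tangent e_imm v xx).
  rewrite lt_neqAle g0 andbT eq_sym; apply/eqP => /g1 z.
  have [_ _ inj] := e_imm.
  by move/eqP: v0; apply; apply: (inj x); rewrite /differential z linear0.
have G0 : 0 < G q0.
  pose v : 'rV[R]_2 := \row_(j < 2) (if j == 0 then 1 else 0).
  have [w0 w1] : v 0 0 = 1 /\ v 0 1 = 0 by rewrite !mxE.
  have vn : v != 0.
    by apply/eqP => /rowP/(_ 0); rewrite w0 mxE => /eqP; rewrite oner_eq0.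
  have := Qpos _ vn; rewrite (QE _ v qx) w0 w1.
  have -> : 1 ^+ 2 * G q0 + 2 * 1 * 0 * FF q0 + 0 ^+ 2 * H q0 = G q0 by ring.
  exact.
have det0 : 0 < G q0 * H q0 - FF q0 ^+ 2.
  pose v : 'rV[R]_2 := \row_(j < 2) (if j == 0 then - FF q0 else G q0).
  have [w0 w1] : v 0 0 = - FF q0 /\ v 0 1 = G q0 by rewrite !mxE.
  have vn : v != 0.
    by apply/eqP => /rowP/(_ 1); rewrite w1 mxE => /eqP; rewrite gt_eqF.
  have := Qpos _ vn; rewrite (QE _ v qx) w0 w1.
  have -> : (- FF q0) ^+ 2 * G q0 + 2 * - FF q0 * G q0 * FF q0 + G q0 ^+ 2 * H q0 =
    G q0 * (G q0 * H q0 - FF q0 ^+ 2) by ring.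
  by rewrite pmulr_rgt0.
have CD i : Ck 0 (chart_img x) (D i) by exact: immersion_D_Ck e_imm x i 0.
have CG : Ck 0 (chart_img x) G by exact: Ck_mink.
have CF : Ck 0 (chart_img x) FF by exact: Ck_mink.
have CH : Ck 0 (chart_img x) H by exact: Ck_mink.
have Cdet : Ck 0 (chart_img x) (fun q => G q * H q - FF q * FF q).
  by apply: CkB => //; exact: CkM.
pose d0 := (G q0 * H q0 - FF q0 ^+ 2) / 2.
have dp : 0 < d0 by rewrite divr_gt0.
have n1 : \forall q \near q0, d0 < G q * H q - FF q * FF q.
  apply: near_gt (Cdet q0 qx) _.
  by rewrite /d0; rewrite expr2 in det0 *; move: (_ - _) det0 => w w0; lra.
have n2 : \forall q \near q0, G q < G q0 + 1 by apply: near_lt (CG q0 qx) _; rewrite ltrDl.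
have n3 : \forall q \near q0, H q < H q0 + 1 by apply: near_lt (CH q0 qx) _; rewrite ltrDl.
have H0 : 0 < H q0 by move: det0 G0 (sqr_ge0 (FF q0)); move: (G q0) (H q0) (FF q0) => a b c; nra.
have n4 : \forall q \near q0, chart_img x q by exact: open_nbhs_nbhs.
have n5 : \forall q \near q0, 0 < G q by exact: near_gt (CG q0 qx) G0.
have n6 : \forall q \near q0, 0 < H q by exact: near_gt (CH q0 qx) H0.
have FI := @filterI _ _ (nbhs_filter q0).
have /nbhs_ballP[r /= r0 Hr] := FI _ _ (FI _ _ (FI _ _ n1 n2) (FI _ _ n3 n4)) (FI _ _ n5 n6).
pose M := (G q0 + 1 + (H q0 + 1)) / d0.
have M0 : 0 < M := divr_gt0 (addr_gt0 (addr_gt0 G0 ltr01) (addr_gt0 H0 ltr01)) dp.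
exists r, (Num.sqrt M); split.
- exact: r0.
- by rewrite sqrtr_gt0.
- by move=> q /Hr[[_ []]].
move=> q v /Hr[[[h1 h2] [h3 xq]] [h5 h6]].
have h1' : d0 < G q * H q - FF q ^+ 2 by exact: h1.
exact: metric_bound_aux dp h5 h6 h1' h2 h3 (QE q v xq).
Qed.

Lemma chart_velocity (c : R -> S) t x : {for t, continuous c} -> chart_dom x (c t) ->
  differentiable (chart x \o c : R -> 'rV[R]_2) t ->
  differential e (c t) (velocity c t) =
    'd (e \o param x) (chart x (c t)) ('D_1 (chart x \o c : R -> 'rV[R]_2) t).
Proof.
move=> cc xt dX.
have dEx : differentiable (e \o param x) ((chart x \o c) t).
  exact: (immersion_differentiable e_imm (chart_imgP xt)).
have n : \forall s \near t, (e \o param x) ((chart x \o c) s) = (e \o c) s.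
  by apply: filterS (near_chart_dom cc xt) => s xs /=; rewrite chartK.
have [d dE] := @near_comp_differentiable R R _ _ _ _ _ _ _ 1 erefl dX dEx n.
have [d' dE'] := is_derive_along cc xt dX (immersion_diff e_imm (c t)).
by rewrite -dE'; apply: etrans (deriveE _ d) dE.
Qed.

Lemma closed_ball_compact n (q : 'rV[R]_n) r : 0 < r -> compact (closed_ball q r).
Proof.
move=> r0; apply: bounded_closed_compact; last exact: closed_ball_closed.
exists (`|q| + r); split; first exact: num_real.
move=> M hM u; rewrite closed_ballE // /closed_ball_ /= => qu.
apply: ltW; apply: le_lt_trans hM.
have -> : u = q - (q - u) by rewrite opprB addrC subrK.
by apply: le_trans (ler_normB _ _) _; rewrite lerD2l.
Qed.

(** [complete_metric] yields limits for the distance only; this turns them into limits in S. Suppose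
    that a short curve to x starts outside a coordinate ball A, and let s be its last time outside
    A. After s its length keeps it in a smaller closed ball C, so [c s] is in C as well, hence in A,
    a contradiction. *)
Lemma dist_neighborhood x (W : set S) : open W -> W x ->
  exists d : R, 0 < d /\ forall y, (riemannian_dist gsum y x < d%:E)%E -> W y.
Proof.
move=> oW Wx; have xx := @dom_center _ _ x.
have [r [K [r0 K0 rI lowb]]] := metric_lower_bound x.
set q0 := chart x x in rI lowb.
have : nbhs q0 (ball q0 r `&` (chart_img x `&` param x @^-1` W)).
  apply: open_nbhs_nbhs; split; last first.
    by split; [exact: ballxx|split; [exact: chart_imgP|rewrite /= chartK]].
  by apply: openI; [exact: ball_open|exact: open_param_preimage].
move=> /nbhs_ballP[r' /= r'0 Hr'].
pose A := chart_dom x `&` chart x @^-1` ball q0 r'.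
have oA : open A by apply: open_chart_preimage; exact: ball_open.
have AW z : A z -> W z.
  by move=> [xz zr]; have [_ [_]] := Hr' _ zr; rewrite /= chartK.
pose rho := r' / 2; have rho0 : 0 < rho by rewrite divr_gt0.
have rho' : rho < r' by rewrite /rho; lra.
(* The image of a compact ball is closed because S is Hausdorff, so a curve cannot leave it in the
   limit. *)
pose C := param x @` closed_ball q0 rho.
have subC : closed_ball q0 rho `<=` ball q0 r' by exact: closed_ball_subset.
have cC : closed C.
  apply: compact_closed; first exact: surface_hausdorff.
  apply: continuous_compact; last exact: closed_ball_compact.
  apply: continuous_in_subspaceT => q; rewrite inE => /subC /Hr'[_ [xq _]].
  exact: param_continuous.
have CA z : C z -> A z.
  move=> [q /subC qr <-]; have [_ [xq _]] := Hr' _ qr.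
  by have [h1 h2] := paramK xq; split; [exact: h1|rewrite /= h2].
exists (rho / K); split; first exact: divr_gt0.
move=> y /ereal_inf_lt[l [c [a [b [ab Cc ca cb lE]]]]]; rewrite {l}lE => ldelta.
have [U [oU abU cU CU]] := Cc.
have inU t : a <= t <= b -> U t by move=> tab; apply: abU; rewrite /= in_itv.
apply: AW; rewrite -ca; apply: contrapT => nAa.
pose Bad := [set t | a <= t <= b /\ ~ A (c t)].
have Ba : Bad a by split; [rewrite lexx|exact: nAa].
have hs : has_sup Bad by split; [exists a|exists b => t [/andP[]]].
(* The last time outside A; [nAs] shows that it is attained, because A is open. *)
pose s := sup Bad.
have as_ : a <= s by apply: ub_le_sup => //; case: hs.
have sb : s <= b by apply: ge_sup; [exists a|move=> t [/andP[]]].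
have sab : a <= s <= b by rewrite as_.
have nAs : ~ A (c s).
  move=> As; have nA : nbhs (c s) A by apply: open_nbhs_nbhs; split; [exact: oA|exact: As].
  have : nbhs s (c @^-1` A) by exact: (cU s (inU s sab) A nA).
  move=> /nbhs_ballP[eps eps0' He]; have eps0 : 0 < eps := eps0'.
  have [t Bt st] := sup_adherent eps0 hs.
  have ts : t <= s by apply: ub_le_sup => //; case: hs.
  by case: Bt => _; apply; apply: He; rewrite -ball_normE /= ger0_norm ?subr_ge0 //; rewrite -/s in st; lra.
have Agt t : s < t -> t <= b -> A (c t).
  move=> st tb; apply: contrapT => nA.
  have : t <= s by apply: ub_le_sup; [case: hs|split => //; rewrite tb andbT; lra].
  by rewrite leNgt st.
have sb' : s < b.
  rewrite lt_neqAle sb andbT; apply/eqP => E; apply: nAs; rewrite E cb.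
  by split; [exact: xx|exact: ballxx].
pose X : R -> 'rV[R]_2 := chart x \o c.
pose O1 := U `&` c @^-1` chart_dom x.
have oO1 : open O1.
  rewrite openE => u [Uu xu]; apply: filterI; first exact: open_nbhs_nbhs.
  by apply: (cU u Uu); apply: open_nbhs_nbhs; split; [exact: dom_open|exact: xu].
have CX : Ck 1 O1 X := CU x.
(* After s the curve stays in one chart, where I alone, a lower bound of the metric, controls the
   displacement: each coordinate moves by at most K times the length, hence by at most rho. *)
have est t : s < t -> t <= b -> C (c t).
  move=> st tb; have [xt tr] := Agt t st tb.
  have Xb : X b = q0 by rewrite /X /= cb.
  exists (X t); last by rewrite /X /= chartK.
  rewrite closed_ballE // /closed_ball_ /= -Xb.
  apply: norm_row_le => [|i]; first exact: ltW.
  rewrite !mxE.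
  have tbO u : t <= u <= b -> [/\ O1 u, A (c u) & a <= u <= b].
    move=> /andP[tu ub]; have su : s < u by exact: lt_le_trans tu.
    have uab : a <= u <= b by rewrite ub andbT; lra.
    have Au := Agt u su ub.
    by split; [split; [exact: inU|exact: Au.1]|exact: Au|exact: uab].
  pose Xi : R -> R := fun u => X u 0 i.
  have [dXi DXi] : Ck 1 O1 Xi := Ck_row i oO1 CX.
  have H1 u : t <= u <= b -> derivable Xi u 1.
    by move=> /tbO[Ou _ _]; apply: diff_derivable; exact: dXi.
  have H2 u : t <= u <= b -> {for u, continuous (fun t => 'D_1 Xi t)}.
    by move=> /tbO[Ou _ _]; exact: DXi.
  have H3 u : t <= u <= b ->
      `|'D_1 Xi u| <= K * Num.sqrt (gsum (c u) (velocity c u) (velocity c u)).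
    move=> /tbO[Ou Au uab]; have dX : differentiable X u by exact: CkS_differentiable CX Ou.
    have vE := chart_velocity (cU u Ou.1) Au.1 dX.
    rewrite /Xi -(@derive_row R R 2 X u 1 i dX); apply: le_trans (norm_rowE _ _) _.
    apply: le_trans (lowb _ _ (Hr' _ Au.2).1) _.
    rewrite ler_pM2l //; apply: ler_wsqrtr; rewrite /gsum /fundamental1 vE.
    by rewrite lerDl; have [_ h3] := fundamental_ge0 e_imm (c u) (velocity c u).
  have := increment_le_integral tb K0 H1 H2 H3 => inc.
  have le2 : (\int[lebesgue_measure]_(u in `[t, b])
      (Num.sqrt (gsum (c u) (velocity c u) (velocity c u)))%:E <= curve_length gsum c a b)%E.
    apply: ge0_le_integral_subset => u; first by split => //; rewrite lee_fin sqrtr_ge0.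
      by rewrite lee_fin sqrtr_ge0.
    by rewrite /= !in_itv /= => /tbO[].
  have := le_lt_trans (le_trans inc le2) ldelta.
  by rewrite lte_fin ltr_pM2r ?invr_gt0 // => /ltW.
have nCs : ~ C (c s) by move=> /CA.
have : nbhs s (c @^-1` ~` C) := cU s (inU s sab) _ (open_nbhs_nbhs (conj (closed_openC cC) nCs)).
move=> /nbhs_ballP[eps eps0' He]; have eps0 : 0 < eps := eps0'.
pose t := s + Num.min (eps / 2) (b - s).
have m0 : 0 < Num.min (eps / 2) (b - s) by rewrite lt_min subr_gt0 sb' andbT divr_gt0.
have me : Num.min (eps / 2) (b - s) <= eps / 2 by rewrite ge_min lexx.
have mb : Num.min (eps / 2) (b - s) <= b - s by rewrite ge_min lexx orbT.
have st : s < t by rewrite ltrDl.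
have tb : t <= b by rewrite /t; lra.
have bt : ball s eps t.
  by rewrite -ball_normE /= /t opprD addrA subrr add0r normrN gtr0_norm //; lra.
exact: He bt (est t st tb).
Qed.

End Distance.

(** * Sections over star-shaped domains *)

Section StarSections.
Context {R : realType}.

(** Connectedness of [[0, 1]]: both P and its negation are open there, and the infimum of the
    counterexamples can satisfy neither. *)
Lemma unit_interval_induction (P : R -> Prop) : P 0 ->
  (forall t, 0 <= t <= 1 -> P t -> \forall s \near t, 0 <= s <= 1 -> P s) ->
  (forall t, 0 <= t <= 1 -> ~ P t -> \forall s \near t, 0 <= s <= 1 -> ~ P s) ->
  forall t, 0 <= t <= 1 -> P t.
Proof.
move=> P0 oP cP t1 t101; apply: contrapT => nP1.
pose B := [set t | 0 <= t <= 1 /\ ~ P t].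
have hB : has_inf B by split; [exists t1|exists 0 => t [/andP[]]].
pose s := inf B.
have lbs t : B t -> s <= t by move=> Bt; apply: ge_inf => //; case: hB.
have s0 : 0 <= s by apply: lb_le_inf; [case: hB|move=> t [/andP[]]].
have s1 : s <= 1 by apply: le_trans (lbs t1 _) _; [by split|by case/andP: t101].
have s01 : 0 <= s <= 1 by rewrite s0.
have [Ps|nPs] := pselect (P s).
  have /nbhs_ballP[d d0' Hd] := oP s s01 Ps; have d0 : 0 < d := d0'.
  have [t Bt ts] := inf_adherent d0 hB.
  have st := lbs t Bt; case: Bt => t01; apply; apply: Hd t01.
  by rewrite -ball_normE /= distrC ger0_norm ?subr_ge0 //; rewrite -/s in ts; lra.
have sn : 0 < s.
  by rewrite lt_neqAle s0 andbT; apply/eqP => E; apply: nPs; rewrite -E.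
have /nbhs_ballP[d d0' Hd] := cP s s01 nPs; have d0 : 0 < d := d0'.
pose t := s - Num.min (d / 2) s.
have m0 : 0 < Num.min (d / 2) s by rewrite lt_min sn andbT divr_gt0.
have md : Num.min (d / 2) s <= d / 2 by rewrite ge_min lexx.
have ms : Num.min (d / 2) s <= s by rewrite ge_min lexx orbT.
have t01 : 0 <= t <= 1 by rewrite /t; lra.
have : B t.
  split; [exact: t01|apply: Hd => //].
  by rewrite -ball_normE /= /t opprB addrC subrK gtr0_norm //; lra.
by move=> /lbs; rewrite /t; lra.
Qed.

Context {S : oriented_surface R}.
Variable e : S -> 'rV[R]_(1 + 3).
Hypothesis e_imm : immersion e.
Hypothesis e_isc : inf_strictly_convex e.
Variables p n v1 v2 : 'rV[R]_(1 + 3).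
Hypothesis F : orthonormal_frame p n v1 v2.
Let hgt := gauss_height e p n.
Let psi := gauss_proj e p n v1 v2.

(** Lifts that agree at t agree nearby, since psi is injective on the domain of a local section;
    lifts that differ at t differ nearby, since S is Hausdorff. *)
Lemma lift_unique (c1 c2 : R -> S) :
  (forall t, 0 <= t <= 1 -> [/\ {for t, continuous c1}, {for t, continuous c2},
     0 < hgt (c1 t) & psi (c1 t) = psi (c2 t)]) ->
  c1 0 = c2 0 -> forall t, 0 <= t <= 1 -> c1 t = c2 t.
Proof.
move=> H H0; apply: (unit_interval_induction (P := fun t => c1 t = c2 t)) => // t t01.
  move=> Et; have [cc1 cc2 h1 _] := H t t01.
  have [W [V [sg [[oW Wz _ _] [sW _ _]]]]] := local_section e_imm e_isc F h1.
  have nW : nbhs (c1 t) W by apply: open_nbhs_nbhs; split; [exact: oW|exact: Wz].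
  have n1 : nbhs t (c1 @^-1` W) := cc1 _ nW.
  rewrite Et in nW; have n2 : nbhs t (c2 @^-1` W) := cc2 _ nW.
  apply: filterS2 n1 n2 => s W1 W2 s01; have [_ _ _ Es] := H s s01.
  have [_ _ E1] := sW _ W1; have [_ _ E2] := sW _ W2.
  exact: etrans (esym E1) (etrans (congr1 sg Es) E2).
move=> nE; have [cc1 cc2 _ _] := H t t01.
have hs := @surface_hausdorff _ S; rewrite open_hausdorff in hs.
have ne : c1 t != c2 t by apply/eqP.
have [[A B] [/= At Bt] [oA oB AB]] := hs _ _ ne.
rewrite inE in At; rewrite inE in Bt.
have n1 : nbhs t (c1 @^-1` A) := cc1 _ (open_nbhs_nbhs (conj oA At)).
have n2 : nbhs t (c2 @^-1` B) := cc2 _ (open_nbhs_nbhs (conj oB Bt)).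
apply: filterS2 n1 n2 => s A1 B2 _ E.
have : (A `&` B) (c1 s) by split; [exact: A1|rewrite E; exact: B2].
by move/eqP: AB => ->.
Qed.

Variable x0 : S.

(* For n = N x0 and p = e x0, the disk round_disk n in the coordinate null_proj:
   mink (null_point z) n = 1 - dot z z / 4. *)
Definition disk4 : set 'rV[R]_2 := [set z | dot z z < 4].

(** Only continuity is asked of b; smoothness follows from [section_smooth]. *)
Definition star_section (U : set 'rV[R]_2) (b : 'rV[R]_2 -> S) : Prop :=
  [/\ open U, U 0, b 0 = x0 & U `<=` disk4] /\
  [/\ forall z (t : R), U z -> 0 <= t <= 1 -> U (t *: z),
      forall z, U z -> {for z, continuous b} &
      forall z, U z -> 0 < hgt (b z) /\ psi (b z) = z].

Lemma section_unique_segment (U1 U2 : set 'rV[R]_2) (b1 b2 : 'rV[R]_2 -> S) w z :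
  (forall t : R, 0 <= t <= 1 -> U1 (w + t *: (z - w)) /\ U2 (w + t *: (z - w))) ->
  (forall z, U1 z -> {for z, continuous b1}) ->
  (forall z, U1 z -> 0 < hgt (b1 z) /\ psi (b1 z) = z) ->
  (forall z, U2 z -> {for z, continuous b2}) ->
  (forall z, U2 z -> 0 < hgt (b2 z) /\ psi (b2 z) = z) ->
  b1 w = b2 w -> b1 z = b2 z.
Proof.
move=> seg c1 h1 c2 h2 E.
pose l := fun t : R => w + t *: (z - w).
have lc t : {for t, continuous l}.
  by apply: cvgD; [exact: cvg_cst|exact: scalel_continuous].
have L0 : l 0 = w by rewrite /l scale0r addr0.
have L1 : l 1 = z by rewrite /l scale1r subrKC.
rewrite -L1; apply: (@lift_unique (b1 \o l) (b2 \o l)); last first.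
- by rewrite ler01 lexx.
- by rewrite /= L0.
move=> t t01; have [U1t U2t] := seg t t01; split.
- by apply: continuous_comp; [exact: lc|exact: c1].
- by apply: continuous_comp; [exact: lc|exact: c2].
- by have [] := h1 _ U1t.
- by have [_ E1] := h1 _ U1t; have [_ E2] := h2 _ U2t; rewrite /= [LHS]E1 [RHS]E2.
Qed.

Lemma star_section_unique U1 U2 b1 b2 z : star_section U1 b1 -> star_section U2 b2 ->
  U1 z -> U2 z -> b1 z = b2 z.
Proof.
move=> [[oU1 u1 b10 _] [s1 c1 h1]] [[oU2 u2 b20 _] [s2 c2 h2]] U1z U2z.
apply: (@section_unique_segment U1 U2 b1 b2 0 z) => //; last by rewrite b10.
by move=> t t01; rewrite add0r subr0; split; [exact: s1|exact: s2].
Qed.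

Definition star_domain : set 'rV[R]_2 :=
  [set z | exists U b, star_section U b /\ U z].

(** The default [x0] serves off [star_domain]; on it, [star_liftE] makes the value independent of
    the section chosen. *)
Definition star_lift (z : 'rV[R]_2) : S :=
  xget x0 [set y | exists U b, [/\ star_section U b, U z & y = b z]].

Lemma star_liftE U b z : star_section U b -> U z -> star_lift z = b z.
Proof.
move=> ss Uz; rewrite /star_lift.
have ex : exists y, [set y | exists U b, [/\ star_section U b, U z & y = b z]] y.
  by exists (b z), U, b.
have [U' [b' [ss' U'z ->]]] := xgetPex x0 ex.
exact: star_section_unique ss' ss U'z Uz.
Qed.

Lemma star_domain_section : star_domain 0 -> star_section star_domain star_lift.
Proof.
move=> D0; split; split.
- rewrite openE => z [U [b [ss Uz]]]; have [[oU _ _ _] _] := ss.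
  have := open_nbhs_nbhs (conj oU Uz); apply: filterS => w Uw.
  by exists U, b.
- exact: D0.
- have [U [b [ss U0]]] := D0; rewrite (star_liftE ss U0).
  by have [[_ _ E _] _] := ss.
- by move=> z [U [b [[[_ _ _ sub] _] Uz]]]; exact: sub.
- move=> z t [U [b [ss Uz]]] t01; exists U, b; split => //.
  by have [_ [star _ _]] := ss; exact: star.
- move=> z [U [b [ss Uz]]]; have [[oU _ _ _] [_ cb _]] := ss.
  have n1 : \forall w \near z, b w = star_lift w.
    have := open_nbhs_nbhs (conj oU Uz); apply: filterS => w Uw.
    by rewrite (star_liftE ss Uw).
  rewrite /prop_for /continuous_at (star_liftE ss Uz).
  exact: cvg_trans (near_eq_cvg n1) (cb z Uz).
- move=> z [U [b [ss Uz]]]; rewrite (star_liftE ss Uz).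
  by have [_ [_ _ H]] := ss; exact: H.
Qed.

End StarSections.

(** * The lift of a ray has finite length and a limit *)

Section RayLift.
Context {R : realType} {S : oriented_surface R}.
Variable e : S -> 'rV[R]_(1 + 3).
Hypothesis e_imm : immersion e.
Hypothesis e_isc : inf_strictly_convex e.
Variables (x0 : S) (v1 v2 : 'rV[R]_(1 + 3)).
Let N := unit_normal e.
Hypothesis F : orthonormal_frame (e x0) (N x0) v1 v2.
Let hgt := gauss_height e (e x0) (N x0).
Let psi := gauss_proj e (e x0) (N x0) v1 v2.
Variables (U : set 'rV[R]_2) (b : 'rV[R]_2 -> S).
Hypothesis ss : star_section e (e x0) (N x0) v1 v2 x0 U b.
Variable z0 : 'rV[R]_2.
Let r : R := dot z0 z0.

Lemma affine_Ck k (O1 : set R) (al de : R) : open O1 ->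
  Ck k O1 (fun s : R => (al + s * de) *: z0).
Proof.
move=> oO; apply: Ck_rowP => // i.
have -> : (fun s : R => ((al + s * de) *: z0) 0 i) = fun s => (al + s * de) * z0 0 i.
  by apply/funext => s; rewrite mxE.
apply: CkM => //; last exact: Ck_cst.
apply: CkD => //; first exact: Ck_cst.
by apply: CkM => //; [exact: Ck_id|exact: Ck_cst].
Qed.

(** Pieces of the ray are reparametrised over [[0, 1]], with de of either sign: curves for the
    distance run forward, while the two parameters to be joined come in any order. *)
Definition line_lift (al de s : R) : S := b ((al + s * de) *: z0).
Definition line_domain (al de : R) : set R := [set s | U ((al + s * de) *: z0)].

Lemma line_continuous al de s : {for s, continuous (fun s : R => (al + s * de) *: z0)}.
Proof.
exact: (Ck_continuous (affine_Ck 0 al de openT)).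
Qed.

Lemma line_domain_open al de : open (line_domain al de).
Proof.
have [[oU _ _ _] _] := ss.
rewrite openE => s Us.
exact: (@line_continuous al de s _ (open_nbhs_nbhs (conj oU Us))).
Qed.

Lemma line_lift_continuous al de s : line_domain al de s -> {for s, continuous (line_lift al de)}.
Proof.
move=> Us; have [_ [_ cb _]] := ss.
exact: (continuous_comp (@line_continuous al de s) (cb _ Us)).
Qed.

Lemma line_lift_Ck al de x :
  Ck 1 (line_domain al de `&` line_lift al de @^-1` chart_dom x) (chart x \o line_lift al de : R -> 'rV[R]_2).
Proof.
have [[oU _ _ _] [_ cb hb]] := ss.
have oO : open (line_domain al de `&` line_lift al de @^-1` chart_dom x).
  rewrite openE => s [Us xs]; apply: filterI.
    exact: (open_nbhs_nbhs (conj (@line_domain_open al de) Us)).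
  apply: (line_lift_continuous Us).
  by apply: open_nbhs_nbhs; split; [exact: dom_open|exact: xs].
have oO' : open (U `&` b @^-1` chart_dom x).
  rewrite openE => z [Uz xz].
  have nU : nbhs z U by apply: open_nbhs_nbhs; split; [exact: oU|exact: Uz].
  have nX : nbhs (b z) (chart_dom x).
    by apply: open_nbhs_nbhs; split; [exact: dom_open|exact: xz].
  exact: (@filterI _ _ (nbhs_filter z) _ _ nU (cb z Uz _ nX)).
apply: (Ck_comp_row oO oO' _ (affine_Ck 1 al de oO) (section_smooth e_imm e_isc F x 1 oU cb hb)).
by move=> s [Us xs]; split.
Qed.

Lemma line_lift_differentiable al de s x : line_domain al de s ->
  chart_dom x (line_lift al de s) -> differentiable (chart x \o line_lift al de : R -> 'rV[R]_2) s.
Proof. by move=> Us xs; apply: CkS_differentiable (line_lift_Ck al de x) _; split. Qed.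

Definition line_vel (f : S -> 'rV[R]_(1 + 3)) al de s : 'rV[R]_(1 + 3) :=
  differential f (line_lift al de s) (velocity (line_lift al de) s).

Lemma line_derive al de s : line_domain al de s ->
  is_derive s 1 (e \o line_lift al de) (line_vel e al de s) /\
  is_derive s 1 (N \o line_lift al de) (line_vel N al de s).
Proof.
move=> Us; have cc := line_lift_continuous Us.
have xx := @dom_center _ _ (line_lift al de s).
have dX := line_lift_differentiable Us xx.
by split; apply: (is_derive_along cc xx dX); [exact: immersion_diff|exact: unit_normal_diff].
Qed.

Lemma line_vel_scale al de s : line_domain al de s ->
  line_domain 0 1 (al + s * de) /\
  line_vel e al de s = de *: line_vel e 0 1 (al + s * de) /\
  line_vel N al de s = de *: line_vel N 0 1 (al + s * de).
Proof.
move=> Us.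
have Us' : line_domain 0 1 (al + s * de) by rewrite /line_domain /= add0r mulr1.
have gen (f : S -> 'rV[R]_(1 + 3)) : is_derive s 1 (f \o line_lift al de) (line_vel f al de s) ->
    is_derive (al + s * de) 1 (f \o line_lift 0 1) (line_vel f 0 1 (al + s * de)) ->
    line_vel f al de s = de *: line_vel f 0 1 (al + s * de).
  move=> [d1 <-] [d2 <-]; have d2' := (derivable1_diffP _ _).1 d2.
  have E : f \o line_lift al de = fun s => (f \o line_lift 0 1) (al + s *: de).
    by apply/funext => u; rewrite /= /line_lift add0r mulr1.
  have [_ D] := @is_derive_line _ R _ (f \o line_lift 0 1) al de s d2'.
  rewrite E D deriveE //.
  have -> : de = de *: (1 : R) :> R by rewrite /GRing.scale /= mulr1.
  by rewrite linearZ /= /GRing.scale /= mulr1.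
have [E1 N1] := line_derive Us; have [E2 N2] := line_derive Us'.
by split; [exact: Us'|split; [exact: gen E1 E2|exact: gen N1 N2]].
Qed.

Lemma line_metric al de s :
  let c := line_lift al de in
  fundamental1 e (c s) (velocity c s) (velocity c s) + fundamental3 e (c s) (velocity c s) (velocity c s) =
  mink (line_vel e al de s) (line_vel e al de s) + mink (line_vel N al de s) (line_vel N al de s).
Proof.
move=> c; have [_ [_ nE]] := normal_facts e_imm (c s) (velocity c s).
by rewrite /fundamental1 /fundamental3 nE.
Qed.

Variable a : R.
Hypothesis a0 : a < 0.
Hypothesis ray_in : forall t, a < t < 1 -> line_domain 0 1 t.
Hypothesis r0 : 0 < r.
Hypothesis r4 : r < 4.
Let c : R -> S := line_lift 0 1.

Lemma ray_null t : a < t < 1 -> 0 < hgt (c t) /\ psi (c t) = t *: z0 /\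
  null_gauss e (c t) = hgt (c t) *: ray_point (e x0) (N x0) v1 v2 z0 t.
Proof.
move=> tT; have [_ [_ _ hb]] := ss; have [h1 h2] := hb _ (ray_in tT).
have E : (0 + t * 1) *: z0 = t *: z0 by rewrite add0r mulr1.
have h2' : psi (c t) = t *: z0 by exact: etrans h2 E.
split; first exact: h1.
split; first exact: h2'.
rewrite /ray_point -h2'.
exact: (null_point_proj F (null_gauss_null e_imm (c t)) (lt0r_neq0 h1)).
Qed.

Lemma ray_curve_derive t : a < t < 1 ->
  is_derive t 1 (e \o c) (line_vel e 0 1 t) /\ is_derive t 1 (N \o c) (line_vel N 0 1 t).
Proof. by move=> tT; exact: line_derive (ray_in tT). Qed.

Lemma ray_curve_mink t : a < t < 1 ->
  [/\ mink ((e \o c) t) ((e \o c) t) = -1, mink ((e \o c) t) ((N \o c) t) = 0,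
      mink (line_vel e 0 1 t) ((e \o c) t) = 0,
      mink (line_vel e 0 1 t) ((N \o c) t) = 0 & mink (line_vel N 0 1 t) ((e \o c) t) = 0].
Proof.
move=> _; have [[h1 _ h3] [[h4 h5 _ h7] _]] := normal_facts e_imm (c t) (velocity c t).
by split; [exact: h1|exact: h3|exact: h4|exact: h5|exact: h7].
Qed.

Lemma ray_curve_ray t : a < t < 1 ->
  0 < height (e x0) (N x0) ((e \o c) t + (N \o c) t) /\
  (e \o c) t + (N \o c) t =
    height (e x0) (N x0) ((e \o c) t + (N \o c) t) *: ray_point (e x0) (N x0) v1 v2 z0 t.
Proof. by move=> tT; have [h1 [_ h3]] := ray_null tT; split; [exact: h1|exact: h3]. Qed.

Lemma ray_speed t : a < t < 1 ->
  mink (line_vel e 0 1 t + line_vel N 0 1 t) (line_vel e 0 1 t + line_vel N 0 1 t) = r * hgt (c t) ^+ 2.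
Proof. by move=> tT; exact: (curve_speed F ray_curve_derive ray_curve_ray tT). Qed.

(** The velocity does not vanish because [ray_speed] gives the derivative of K a positive square;
    strict convexity then applies to it. *)
Lemma ray_convex t : a < t < 1 -> 0 < mink (line_vel N 0 1 t) (line_vel e 0 1 t).
Proof.
move=> tT; have [_ [_ nE]] := normal_facts e_imm (c t) (velocity c t).
have vn : velocity c t != 0.
  apply/eqP => v0; have E := ray_speed tT.
  have eE : line_vel e 0 1 t = 0.
    by apply: etrans (congr1 (differential e (c t)) v0) _; exact: linear0.
  have NE : line_vel N 0 1 t = 0.
    by apply: etrans (congr1 (differential N (c t)) v0) _; exact: linear0.
  rewrite eE NE addr0 mink0l in E; move: E.
  have [h1 _] := ray_null tT; move: (hgt (c t)) h1 => h h1 E.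
  have : 0 < r * h ^+ 2 by rewrite mulr_gt0 // exprn_gt0.
  by rewrite -E ltxx.
by have := e_isc (c t) vn; rewrite /fundamental2 nE.
Qed.

Lemma ray_start : (e \o c) 0 = e x0.
Proof.
have [[_ _ b0 _] _] := ss.
by rewrite /= /c /line_lift mul0r addr0 scale0r b0.
Qed.

Lemma ray_height_bound t : 0 <= t < 1 -> 1 - r / 4 <= (hgt (c t))^-1.
Proof.
move=> t01; have H := curve_height_bound F r0 a0 ray_curve_derive ray_curve_mink ray_curve_ray
  ray_convex ray_start t01.
apply: le_trans H; move: t01 => /andP[t0 t1].
have : t ^+ 2 <= 1 by rewrite expr_le1 // ltW.
by move=> u1; rewrite lerD2l lerN2 ler_pM2r ?invr_gt0 // ler_piMr // ltW.
Qed.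

Lemma ray_height_le t : 0 <= t < 1 -> hgt (c t) <= (1 - r / 4)^-1.
Proof.
move=> t01; have tT : a < t < 1.
  by move: t01 => /andP[t0 ->]; rewrite andbT (lt_le_trans a0).
have [h1 _] := ray_null tT; have H := ray_height_bound t01.
have m0 : 0 < 1 - r / 4 by rewrite subr_gt0 ltr_pdivrMr // mul1r.
by rewrite -[leLHS]invrK lef_pV2 // posrE invr_gt0.
Qed.

Lemma ray_metric_le t : 0 <= t < 1 ->
  mink (line_vel e 0 1 t) (line_vel e 0 1 t) + mink (line_vel N 0 1 t) (line_vel N 0 1 t) <=
    r * (1 - r / 4)^-1 ^+ 2.
Proof.
move=> t01; have tT : a < t < 1.
  by move: t01 => /andP[t0 ->]; rewrite andbT (lt_le_trans a0).
have sp := ray_speed tT; have cv := ray_convex tT; have hl := ray_height_le t01.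
have [h1 _] := ray_null tT.
apply: (@le_trans _ _ (r * hgt (c t) ^+ 2)); last first.
  by rewrite ler_pM2l // ler_pXn2r ?nnegrE ?(ltW h1) // (le_trans (ltW h1)).
rewrite -sp; move: (line_vel e 0 1 t) (line_vel N 0 1 t) cv => u w cv.
by rewrite !mink_lin [mink u w]minkC; move: (mink u u) (mink w w) (mink w u) cv => x y z z0'; lra.
Qed.

Hypothesis e_quasi : quasicomplete e.

Let gsum : tensor2 S := fun x xi nu => fundamental1 e x xi nu + fundamental3 e x xi nu.

Lemma ray_dist (t t' : R) : 0 <= t < 1 -> 0 <= t' < 1 ->
  (riemannian_dist gsum (c t) (c t')
    <= (Num.sqrt r * (1 - r / 4)^-1 * `|t' - t|)%:E)%E.
Proof.
move=> t01 t01'; set de := t' - t.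
have m0 : 0 < (1 - r / 4)^-1 by rewrite invr_gt0 subr_gt0 ltr_pdivrMr // mul1r.
pose K := Num.sqrt r * (1 - r / 4)^-1 * `|de|.
have K0 : 0 <= K by rewrite !mulr_ge0 ?sqrtr_ge0 // ltW.
have par s : 0 <= s <= 1 -> 0 <= t + s * de < 1.
  have -> : t + s * de = (1 - s) * t + s * t' by rewrite /de; ring.
  move: t01 t01' => /andP[h1 h2] /andP[h3 h4] /andP[s0 s1].
  rewrite addr_ge0 ?mulr_ge0 ?subr_ge0 //=.
  have [->|sn] := eqVneq s 0; first by rewrite subr0 mul1r mul0r addr0.
  apply: (@lt_le_trans _ _ ((1 - s) * 1 + s * 1)); last by rewrite !mulr1 subrK.
  by apply: ler_ltD; [rewrite ler_wpM2l ?subr_ge0 // ltW|rewrite ltr_pM2l // lt0r sn].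
have dom s : 0 <= s <= 1 -> line_domain t de s.
  move=> /par s01; have : line_domain 0 1 (t + s * de).
    by apply: ray_in; move: s01 => /andP[h ->]; rewrite andbT (lt_le_trans a0).
  by rewrite /line_domain /= add0r mulr1.
have C1 : C1_curve (line_lift t de) 0 1.
  exists (line_domain t de); split.
  - exact: line_domain_open.
  - by move=> s; rewrite /= in_itv /=; exact: dom.
  - by move=> s Us; exact: line_lift_continuous.
  - exact: line_lift_Ck.
have := @riemannian_dist_le R S gsum
  (line_lift t de) 0 1 K ler01 C1 K0.
have -> : line_lift t de 0 = c t by rewrite /c /line_lift mul0r addr0 add0r mulr1.
have -> : line_lift t de 1 = c t'.
  by rewrite /c /line_lift mul1r add0r mulr1 /de addrC subrK.
rewrite subr0 mulr1; apply => s s01.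
have KE : K ^+ 2 = de ^+ 2 * (r * (1 - r / 4)^-1 ^+ 2).
  rewrite /K !exprMn sqr_sqrtr ?(ltW r0) // real_normK ?num_real //.
  by rewrite mulrC.
rewrite KE; have [_ [E1 E2]] := line_vel_scale (dom _ s01).
have ME := line_metric t de s; rewrite E1 E2 in ME.
apply: le_trans (ler_wpM2l (sqr_ge0 de) (ray_metric_le (par _ s01))).
rewrite le_eqVlt; apply/orP; left; apply/eqP; apply: etrans ME _.
move: (line_vel e 0 1 _) (line_vel N 0 1 _) => u w.
by rewrite !mink_lin; ring.
Qed.

Let tk (k : nat) : R := 1 - k.+1%:R^-1.

Lemma tk01 k : 0 <= tk k < 1.
Proof.
rewrite /tk subr_ge0 invf_le1 // ler1n /=.
by rewrite ltrBlDr ltrDl invr_gt0.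
Qed.

(** [ray_dist] is a Lipschitz bound in the parameter, so the points at the times [tk k] form a
    Cauchy sequence; [dist_neighborhood] makes its limit a topological one. *)
Lemma ray_limit : exists x : S, (fun k => c (tk k)) @ \oo --> x.
Proof.
pose K := Num.sqrt r * (1 - r / 4)^-1.
have K0 : 0 < K by rewrite mulr_gt0 ?sqrtr_gt0 // invr_gt0 subr_gt0 ltr_pdivrMr // mul1r.
have HQ : complete_metric gsum := e_quasi.
have [eps eps0|x Hx] := HQ (fun k : nat => c (tk k)).
  have [M HM] : exists M : nat, K / eps < M.+1%:R.
    exists (Num.truncn (K / eps)); exact: truncnS_gt.
  exists M => m k Mm Mk.
  apply: le_lt_trans (ray_dist (tk01 m) (tk01 k)) _.
  rewrite lte_fin -/K mulrC -ltr_pdivlMr //.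
  have inv j : (M <= j)%N -> 0 < (j.+1%:R : R)^-1 <= M.+1%:R^-1.
    by move=> Mj; rewrite invr_gt0 ltr0n /= lef_pV2 ?posrE ?ltr0n // ler_nat ltnS.
  have MK : M.+1%:R^-1 < eps / K.
    rewrite (_ : eps / K = (K / eps)^-1); last by rewrite (invf_div K eps).
    have anti (A B : R) : 0 < A -> A < B -> B^-1 < A^-1.
      by move=> A0 AB; rewrite ltf_pV2 ?posrE // (lt_trans A0).
    exact: anti (divr_gt0 K0 eps0) HM.
  have /andP[i1 i2] := inv m Mm; have /andP[i3 i4] := inv k Mk.
  rewrite /tk ltr_norml; move: MK i1 i2 i3 i4.
  move: (eps / K) (M.+1%:R^-1 : R) (m.+1%:R^-1 : R) (k.+1%:R^-1 : R) => A B C D h1 h2 h3 h4 h5.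
  by apply/andP; split; lra.
exists x => W; rewrite nbhsE => -[W' [oW' Wx'] W'W].
have [d [d0 Hd]] := dist_neighborhood e_imm oW' Wx'.
have [M HM] := Hx d d0.
by exists M => // k /= Mk; apply: W'W; apply: Hd; exact: HM.
Qed.

Lemma surface_continuous (W : topologicalType) (f : S -> W) x :
  {for chart x x, continuous (f \o param x)} -> {for x, continuous f}.
Proof.
move=> cf; have xx := @dom_center _ _ x.
have cc := continuous_comp (chart_continuous xx) cf.
have n1 : \forall z \near x, ((f \o param x) \o chart x) z = f z.
  have := open_nbhs_nbhs (conj (dom_open x) xx).
  by apply: filterS => z xz /=; rewrite chartK.
have E : ((f \o param x) \o chart x) x = f x by rewrite /= chartK.
have cc' : ((f \o param x) \o chart x) @ x --> ((f \o param x) \o chart x) x by exact: cc.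
rewrite E in cc'; exact: cvg_trans (near_eq_cvg n1) cc'.
Qed.

Lemma gauss_height_continuous x : {for x, continuous hgt}.
Proof.
apply: surface_continuous; have xx := @dom_center _ _ x.
exact: (Ck_continuous (@gauss_height_Ck _ _ _ e_imm (e x0) (N x0) x 0) (chart_imgP xx)).
Qed.

Lemma null_gauss_time_continuous x : {for x, continuous (fun z => null_gauss e z 0 0)}.
Proof.
apply: surface_continuous; have xx := @dom_center _ _ x.
have H := Ck_row 0 (@chart_img_open _ _ x) (null_gauss_Ck e_imm x 0).
exact: (Ck_continuous H (chart_imgP xx)).
Qed.

Lemma gauss_proj_continuous x : 0 < hgt x -> {for x, continuous psi}.
Proof.
move=> hx; apply: surface_continuous; have xx := @dom_center _ _ x.
have hp : height_pos e (e x0) (N x0) x (chart x x).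
  by split; [exact: chart_imgP|rewrite /= chartK].
exact: (Ck_continuous (@gauss_proj_Ck _ _ _ e_imm (e x0) (N x0) v1 v2 x 0) hp).
Qed.

Lemma tk_cvg : tk @ \oo --> (1 : R).
Proof.
have H : (fun k : nat => (1 : R) - k.+1%:R^-1) @ \oo --> (1 - 0 : R).
  by apply: cvgB; [exact: cvg_cst|exact: cvg_harmonic].
by rewrite subr0 in H.
Qed.

Lemma tka k : a < tk k < 1.
Proof. by have /andP[h ->] := tk01 k; rewrite andbT (lt_le_trans a0). Qed.

Lemma quadratic_entry_bound m (A B C : 'rV[R]_m) i (h : R) : exists M, 0 < M /\
  forall t, 0 <= t < 1 -> (A + t *: B + (t * t * h) *: C) 0 i <= M.
Proof.
pose M := `|A 0 i| + `|B 0 i| + `|h * C 0 i| + 1.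
exists M; split; first by rewrite ltr_pwDr // !addr_ge0.
move=> t /andP[t0 t1]; rewrite !mxE.
have b1 := ler_norm (A 0 i).
have b2 : t * B 0 i <= `|B 0 i|.
  apply: le_trans (ler_norm _) _; rewrite normrM ger0_norm //.
  by rewrite ler_piMl // ltW.
have b3 : t * t * h * C 0 i <= `|h * C 0 i|.
  rewrite -mulrA; apply: le_trans (ler_norm _) _; rewrite normrM ger0_norm ?mulr_ge0 //.
  by rewrite ler_piMl // mulr_ile1 // ltW.
by rewrite /M; lra.
Qed.

(** The limit must not be the point at infinity of the coordinate, where the height vanishes. Along
    the ray the time coordinate of K is at most M times the height; this passes to the limit, where
    the time coordinate is positive. *)
Lemma ray_limit_lies x : (fun k => c (tk k)) @ \oo --> x -> 0 < hgt x /\ psi x = z0.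
Proof.
move=> cx.
have hx : 0 < hgt x.
  have [M [M0 HM]] := quadratic_entry_bound (e x0 + N x0) (z0 0 0 *: v1 + z0 0 1 *: v2)
    (null_axis (e x0) (N x0)) 0 (r / 2).
  pose q z := null_gauss e z 0 0 - M * hgt z.
  have qc : {for x, continuous q}.
    apply: cvgB; first exact: null_gauss_time_continuous.
    by apply: cvgM; [exact: cvg_cst|exact: gauss_height_continuous].
  have q0 k : q (c (tk k)) <= 0.
    have [h1 [_ E]] := ray_null (tka k).
    have E0 : null_gauss e (c (tk k)) 0 0 =
        hgt (c (tk k)) * ray_point (e x0) (N x0) v1 v2 z0 (tk k) 0 0.
      by apply: etrans (congr1 (fun w : 'rV[R]_(1 + 3) => w 0 0) E) _; rewrite mxE.
    have Hk := HM _ (tk01 k).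
    have E1 := ray_pointE (e x0) (N x0) v1 v2 z0 (tk k).
    rewrite /q E0 subr_le0 mulrC ler_pM2r // E1; exact: Hk.
  have qx : q x <= 0.
    rewrite leNgt; apply/negP => qp.
    have := cx _ (near_gt qc qp) => -[M' _ HM'].
    by have := HM' M' (leqnn M'); rewrite /= ltNge q0.
  have tx := null_gauss_time e_imm x.
  have : 0 < M * hgt x.
    by move: qx tx; rewrite /q; move: (null_gauss e x 0 0) (M * hgt x) => A B h1 h2; lra.
  by rewrite pmulr_rgt0.
split; first exact: hx.
have c1 : (psi \o (fun k => c (tk k))) @ \oo --> psi x.
  by apply: cvg_comp cx _; exact: gauss_proj_continuous.
have E : psi \o (fun k => c (tk k)) = fun k => tk k *: z0.
  by apply/funext => k; have [_ [E _]] := ray_null (tka k); exact: E.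
rewrite E in c1.
have c2 : (fun k => tk k *: z0) @ \oo --> (1 : R) *: z0.
  by apply: cvgZl; exact: tk_cvg.
rewrite scale1r in c2.
exact: (cvg_unique (@norm_hausdorff _ _) c1 c2).
Qed.

End RayLift.

(** * Extending a section beyond the end of a ray *)

Section Extension.
Context {R : realType} {S : oriented_surface R}.
Variable e : S -> 'rV[R]_(1 + 3).
Hypothesis e_imm : immersion e.
Hypothesis e_isc : inf_strictly_convex e.
Variables (p n v1 v2 : 'rV[R]_(1 + 3)) (x0 : S).
Hypothesis F : orthonormal_frame p n v1 v2.
Let hgt := gauss_height e p n.
Let psi := gauss_proj e p n v1 v2.

Lemma disk4_open : open (@disk4 R).
Proof.
rewrite openE => z z4.
have c : {for z, continuous (fun w : 'rV[R]_2 => dot w w)}.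
  have -> : (fun w : 'rV[R]_2 => dot w w) = fun w => w 0 0 * w 0 0 + w 0 1 * w 0 1.
    by apply/funext => w; rewrite dot2_sum.
  have H i : {for z, continuous (fun w : 'rV[R]_2 => w 0 i)} by exact: coord_continuous.
  exact: (cvgD (cvgM (H 0) (H 0)) (cvgM (H 1) (H 1))).
exact: near_lt c z4.
Qed.

Lemma local_section_continuous (y : S) (V : set 'rV[R]_2) (sg : 'rV[R]_2 -> S) :
  open V -> (forall w, V w -> chart_dom y (sg w)) -> Ck 0 V (chart y \o sg) ->
  forall w, V w -> {for w, continuous sg}.
Proof.
move=> oV Vd C w Vw.
have yw := Vd w Vw.
have c1 : {for (chart y \o sg) w, continuous (param y)}.
  by apply: param_continuous; exists (sg w).
have cc := continuous_comp (C w Vw) c1.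
have n1 : \forall z \near w, (param y \o (chart y \o sg)) z = sg z.
  have := open_nbhs_nbhs (conj oV Vw); apply: filterS => z Vz /=.
  by rewrite chartK //; exact: Vd.
have E : (param y \o (chart y \o sg)) w = sg w by rewrite /= chartK.
have cc' : (param y \o (chart y \o sg)) @ w --> (param y \o (chart y \o sg)) w by exact: cc.
rewrite E in cc'; exact: cvg_trans (near_eq_cvg n1) cc'.
Qed.

(** A local section at x is glued to b over a thin truncated cone Q about the end of the ray. The
    cone reaches back into U along every ray that it meets, which keeps the union star-shaped. *)
Lemma star_section_glue U b z0 x : star_section e p n v1 v2 x0 U b -> disk4 z0 ->
  0 < hgt x -> psi x = z0 ->
  (forall (W : set S) (B : set 'rV[R]_2), nbhs x W -> nbhs z0 B ->
    exists t : R, [/\ 0 < t < 1, U (t *: z0), B (t *: z0) & W (b (t *: z0))]) ->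
  star_domain e p n v1 v2 x0 z0.
Proof.
move=> [[oU U0 b0 U4] [sU cb hb]] z4 hx px Hx.
have [W [V [sg [[oW Wx oV Wd] [sW sV sC]]]]] := local_section e_imm e_isc F hx.
have Vz : V z0 by have [_ H _] := sW x Wx; rewrite -px; exact: H.
have Vd w : V w -> chart_dom x (sg w) by move=> /sV[h _]; exact: Wd.
have csg := local_section_continuous oV Vd (sC 0).
have hsg z : V z -> 0 < hgt (sg z) /\ psi (sg z) = z.
  move=> Vz'; have [Wz pz] := sV z Vz'; have [h _ _] := sW _ Wz.
  by split; [exact: h|exact: pz].
have nV : nbhs z0 (V `&` @disk4 R).
  apply: (@filterI _ _ (nbhs_filter z0)); apply: open_nbhs_nbhs; split=> //.
  exact: disk4_open.
have [rr rr0' rrV] := (nbhs_ballP _ _).1 nV; have rr0 : 0 < rr := rr0'.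
have nW : nbhs x W by apply: open_nbhs_nbhs; split.
have [t1 [/andP[t10 t11] Ut Bt Wt]] := Hx W (ball z0 rr) nW (nbhsx_ballx z0 rr rr0).
have sc (s : R) (w : 'rV[R]_2) : {for w, continuous (fun y : 'rV[R]_2 => s *: y)}.
  exact: scaler_continuous.
(* For w close to z0, the point [t1 *: w] is still in U and its lift still in W, where sg inverts
   psi. *)
have nA : nbhs z0 [set w | [/\ ball z0 rr w, ball z0 rr (t1 *: w), U (t1 *: w) & W (b (t1 *: w))]].
  have n1 := nbhsx_ballx z0 rr rr0.
  have n2 : nbhs z0 ((fun y : 'rV[R]_2 => t1 *: y) @^-1` (ball z0 rr)).
    by apply: (sc t1 z0); apply: open_nbhs_nbhs; split; [exact: ball_open|exact: Bt].
  have n3 : nbhs z0 ((fun y : 'rV[R]_2 => t1 *: y) @^-1` U).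
    by apply: (sc t1 z0); apply: open_nbhs_nbhs; split; [exact: oU|exact: Ut].
  have n4 : nbhs z0 ((b \o (fun y : 'rV[R]_2 => t1 *: y)) @^-1` W).
    apply: (continuous_comp (sc t1 z0) (cb _ Ut)).
    by apply: open_nbhs_nbhs; split; [exact: oW|exact: Wt].
  have n12 := @filterI _ _ (nbhs_filter z0) _ _ n1 n2.
  have n34 := @filterI _ _ (nbhs_filter z0) _ _ n3 n4.
  have := @filterI _ _ (nbhs_filter z0) _ _ n12 n34.
  by apply: (@filterS _ _ (nbhs_filter z0)) => w [[a1 a2] [a3 a4]]; split.
have [d d0' dA] := (nbhs_ballP _ _).1 nA; have d0 : 0 < d := d0'.
(* The points [s *: w] with w within d of z0 and [t1 < s <= 1]. Each lies on the segment from
   [t1 *: w] to w, hence in the ball of radius rr ([QE]). *)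
pose Q : set 'rV[R]_2 := [set y | exists s : R, t1 < s <= 1 /\ ball z0 d (s^-1 *: y)].
have QE y : Q y -> exists (s : R) w, [/\ t1 < s <= 1, y = s *: w,
    s^-1 *: y = w, ball z0 d w & ball z0 rr y].
  move=> [s [s1 By]]; exists s, (s^-1 *: y); move: (s1) => /andP[s2 s3].
  have sn : s != 0 by rewrite gt_eqF // (lt_trans t10).
  split=> //; first by rewrite scalerA mulfV // scale1r.
  have [a1 a2 _ _] := dA _ By.
  have m0 : 0 < 1 - t1 by rewrite subr_gt0.
  have t01 : 0 <= (s - t1) / (1 - t1) <= 1.
    apply/andP; split; first by rewrite divr_ge0 // ?subr_ge0 ltW.
    by rewrite ler_pdivrMr // mul1r lerD2r.
  have := ball_segment a1 a2 t01.
  suff -> : t1 *: (s^-1 *: y) + ((s - t1) / (1 - t1)) *: (s^-1 *: y - t1 *: (s^-1 *: y)) = y by [].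
  have seg (tau : R) (w : 'rV[R]_2) :
      t1 *: w + tau *: (w - t1 *: w) = (t1 + tau * (1 - t1)) *: w.
    by rewrite scalerDl mulrBr mulr1 scalerBl scalerBr scalerA.
  by rewrite seg divfK ?gt_eqF // subrKC scalerA mulfV // scale1r.
have oQ : open Q.
  rewrite openE => y [s [s1 By]].
  have : nbhs y ((fun y : 'rV[R]_2 => s^-1 *: y) @^-1` (ball z0 d)).
    by apply: (sc s^-1 y); apply: open_nbhs_nbhs; split; [exact: ball_open|exact: By].
  by apply: (@filterS _ _ (nbhs_filter y)) => w Bw; exists s.
(* The two sections agree at [t1 *: w], whose lift by b lies in W; the segment from there to y stays
   both in U and in the ball, so [section_unique_segment] carries the agreement to y. *)
have agree y : U y -> Q y -> b y = sg y.
  move=> Uy /QE[s [w [/andP[s1 s2] yE _ Bw By]]].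
  have [a1 a2 a3 a4] := dA _ Bw; have s0 := lt_trans t10 s1.
  apply: (@section_unique_segment _ _ _ e_imm e_isc _ _ _ _ F U V b sg (t1 *: w) y _ cb hb csg hsg).
  - move=> t t01; split; last by apply: (rrV _ _).1; exact: ball_segment By a2 t01.
    have -> : t1 *: w + t *: (y - t1 *: w) = ((t1 + t * (s - t1)) / s) *: y.
      rewrite yE scalerA divfK ?gt_eqF // -scalerBl scalerA -scalerDl.
      by congr (_ *: _); ring.
    apply: sU => //; move: t01 => /andP[t0 t1'].
    have u0 : 0 <= t * (s - t1) by rewrite mulr_ge0 // subr_ge0 ltW.
    have u1 : t * (s - t1) <= s - t1 by rewrite ler_piMl // subr_ge0 ltW.
    rewrite divr_ge0 ?addr_ge0 ?(ltW t10) ?(ltW s0) //= ler_pdivrMr // mul1r.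
    by move: u1; move: (t * _) => u u1; lra.
  - have [_ pz] := hb _ a3; have [_ _ E] := sW _ a4.
    by rewrite -[LHS]E; congr (sg _); exact: pz.
pose b' y := if pselect (U y) then b y else sg y.
have bU y : U y -> b' y = b y by rewrite /b'; case: pselect.
have bQ y : Q y -> b' y = sg y.
  by rewrite /b'; case: pselect => // Uy Qy; exact: agree.
have QV y : Q y -> V y /\ disk4 y.
  by move=> /QE[s [w [_ _ _ _ By]]]; exact: rrV.
exists (U `|` Q), b'; split; last first.
  right; exists 1; rewrite t11 lexx invr1 scale1r; split=> //.
  exact: ballxx.
split; split.
- exact: openU.
- by left.
- by rewrite bU.
- by move=> y [/U4|/QV[]].
- move=> y t yU t01; case: yU => [Uy|Qy]; first by left; exact: sU.
  move: (Qy) => [s [/andP[s1 s2] Bs]]; move: (t01) => /andP[t0 t1'].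
  have s0 := lt_trans t10 s1.
  (* Shrinking [y = s *: w] by t keeps it in Q as long as [t * s > t1]; below, it is a multiple of
     [t1 *: w], a point of U, by a factor at most 1. *)
  have [ts|ts] := ltP t1 (t * s).
    have tn : t != 0 by apply/eqP => tE; move: ts; rewrite tE mul0r ltNge (ltW t10).
    right; exists (t * s); split.
      by rewrite ts /= mulr_ile1 // ltW.
    by rewrite invfM scalerA mulrC mulrA mulfV // mul1r.
  left; have [_ _ Uw _] := dA _ Bs.
  have -> : t *: y = (t * s / t1) *: (t1 *: (s^-1 *: y)).
    rewrite scalerA divfK ?gt_eqF // scalerA -mulrA mulfV ?mulr1 //.
    by rewrite gt_eqF.
  by apply: sU => //; rewrite divr_ge0 ?mulr_ge0 ?(ltW s0) ?(ltW t10) //= ler_pdivrMr // mul1r.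
- move=> y [Uy|Qy].
    have n1 : \forall w \near y, b w = b' w.
      by have := open_nbhs_nbhs (conj oU Uy); apply: filterS => w Uw; rewrite bU.
    rewrite /prop_for /continuous_at bU //.
    exact: cvg_trans (near_eq_cvg n1) (cb y Uy).
  have n1 : \forall w \near y, sg w = b' w.
    by have := open_nbhs_nbhs (conj oQ Qy); apply: filterS => w Qw; rewrite bQ.
  rewrite /prop_for /continuous_at bQ //.
  by apply: cvg_trans (near_eq_cvg n1) _; apply: csg; exact: (QV y Qy).1.
- move=> y [Uy|Qy]; first by rewrite (bU y Uy); exact: hb.
  by rewrite (bQ y Qy); exact: hsg (QV y Qy).1.
Qed.

End Extension.

(** * The section reaches the whole disk *)

Section FullDisk.
Context {R : realType} {S : oriented_surface R}.
Variable e : S -> 'rV[R]_(1 + 3).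
Hypothesis e_imm : immersion e.
Hypothesis e_isc : inf_strictly_convex e.
Hypothesis e_quasi : quasicomplete e.
Variables (x0 : S) (v1 v2 : 'rV[R]_(1 + 3)).
Let N := unit_normal e.
Hypothesis F : orthonormal_frame (e x0) (N x0) v1 v2.
Let hgt := gauss_height e (e x0) (N x0).
Let psi := gauss_proj e (e x0) (N x0) v1 v2.
Let section := star_section e (e x0) (N x0) v1 v2 x0.
Let dom := star_domain e (e x0) (N x0) v1 v2 x0.

Lemma dotZ2 (t : R) (z : 'rV[R]_2) : dot (t *: z) (t *: z) = t ^+ 2 * dot z z.
Proof. by rewrite !dot2_sum !mxE; ring. Qed.

Lemma dot2_gt0 (z : 'rV[R]_2) : z != 0 -> 0 < dot z z.
Proof.
move=> z0; rewrite dot2_sum lt_neqAle addr_ge0 -?expr2 ?sqr_ge0 // andbT eq_sym.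
apply: contra z0; rewrite paddr_eq0 ?sqr_ge0 // !sqrf_eq0 => /andP[/eqP h0 /eqP h1].
apply/eqP/rowP => i; rewrite mxE.
by case: i => -[|[|//]] hi; [rewrite -h0|rewrite -h1]; congr (z 0 _); apply/val_inj.
Qed.

Lemma scalel_continuous_for (z : 'rV[R]_2) (t : R) : {for t, continuous (fun s : R => s *: z)}.
Proof. exact: scalel_continuous. Qed.

Lemma radial_extension U b z0 : section U b -> disk4 z0 -> z0 != 0 ->
  (forall t, 0 <= t < 1 -> U (t *: z0)) -> dom z0.
Proof.
move=> ss z4 zn Uz; have [[oU U0 _ _] _] := ss.
have n0 : nbhs (0 : R) ((fun s : R => s *: z0) @^-1` U).
  apply: scalel_continuous_for; rewrite scale0r.
  by apply: open_nbhs_nbhs; split.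
have [d d0' Hd] := (nbhs_ballP _ _).1 n0; have d0 : 0 < d := d0'.
have a0 : - d < 0 by rewrite oppr_lt0.
have ray t : - d < t < 1 -> line_domain U z0 0 1 t.
  move=> /andP[t0 t1]; rewrite /line_domain /= add0r mulr1.
  have [tp|tn] := leP 0 t; first by apply: Uz; rewrite tp.
  by apply: Hd; rewrite -ball_normE /= sub0r normrN ltr0_norm // ltrNl.
have [x cx] := ray_limit e_imm e_isc F ss a0 ray (dot2_gt0 zn) z4 e_quasi.
have [hx px] := ray_limit_lies e_imm F ss a0 ray cx.
apply: (star_section_glue e_imm e_isc F ss z4 hx px) => W B nW nB.
have h1 : \forall k \near \oo, W (line_lift b z0 0 1 (1 - (k : nat).+1%:R^-1)) by exact: cx W nW.
have h2 : \forall k \near \oo, B ((1 - (k : nat).+1%:R^-1) *: z0).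
  have c2 : (fun k : nat => ((1 : R) - k.+1%:R^-1) *: z0) @ \oo --> (1 : R) *: z0.
    by apply: cvgZl; exact: tk_cvg.
  by rewrite scale1r in c2; exact: c2 _ nB.
have h3 : \forall k \near \oo, (0 < (k : nat))%N by exact: nbhs_infty_gt.
have [k [[k1 k2] k3]] := filter_ex (filterI (filterI h1 h2) h3).
exists (1 - k.+1%:R^-1).
have t01 : 0 < 1 - (k.+1%:R : R)^-1 < 1.
  rewrite ltrBlDr ltrDl invr_gt0 ltr0n /= andbT subr_gt0.
  by rewrite invf_lt1 ?ltr0n // ltr1n ltnS.
split; [exact: t01| |exact: k2|].
  by apply: Uz; move: t01 => /andP[/ltW -> ->].
by move: k1; rewrite /line_lift /= add0r mulr1.
Qed.

Lemma base_height : hgt x0 = 1.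
Proof.
have [[_ _ h] _] := frame_mink F.
by rewrite /hgt /gauss_height /height /null_gauss h opprK.
Qed.

Lemma base_proj : psi x0 = 0.
Proof.
have [_ [[k1 k2 _ _] _]] := frame_mink F.
rewrite /psi /gauss_proj /null_proj /null_gauss k1 k2.
by apply/rowP => i; rewrite !mxE if_same mulr0.
Qed.

Lemma star_domain0 : dom 0.
Proof.
have h0 : 0 < hgt x0 by rewrite base_height.
have [W [V [sg [[oW Wx oV Wd] [sW sV sC]]]]] := local_section e_imm e_isc F h0.
have pE := base_proj.
have [_ Vp sE] := sW _ Wx; rewrite -/psi pE in Vp sE.
have nV : nbhs (0 : 'rV[R]_2) (V `&` @disk4 R).
  apply: filterI; apply: open_nbhs_nbhs; split=> //; first exact: disk4_open.
  by rewrite /disk4 /= dot2_sum !mxE !mul0r addr0.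
have [d d0' Hd] := (nbhs_ballP _ _).1 nV; have d0 : 0 < d := d0'.
have Vd w : V w -> chart_dom x0 (sg w) by move=> /sV[h _]; exact: Wd.
exists (ball 0 d), sg; split; last exact: ballxx.
split; split.
- exact: ball_open.
- exact: ballxx.
- exact: sE.
- by move=> z /Hd[].
- move=> z t Bz t01; have := ball_segment Bz (ballxx (0 : 'rV[R]_2) d0) t01.
  by rewrite subr0 add0r.
- by move=> z /Hd[Vz _]; exact: (local_section_continuous oV Vd (sC 0%N) Vz).
- move=> z /Hd[Vz _]; have [Wz pz] := sV z Vz; have [h _ _] := sW _ Wz.
  by split; [exact: h|exact: pz].
Qed.

(** The induction runs along the ray of z. Membership is open since the domain is; that failure is
    open too is the content of [radial_extension]. *)
Lemma star_domain_full z : disk4 z -> dom z.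
Proof.
move=> z4; have ss := star_domain_section e_imm e_isc F star_domain0.
have [[oU U0 _ _] [sU _ _]] := ss.
have z4t t : 0 <= t <= 1 -> disk4 (t *: z).
  move=> /andP[t0 t1]; rewrite /disk4 /= dotZ2; apply: le_lt_trans z4.
  by rewrite ler_piMl ?expr_le1 // dot2_sum addr_ge0 // -expr2 sqr_ge0.
suff H : forall t : R, 0 <= t <= 1 -> dom (t *: z).
  by rewrite -[z]scale1r; apply: H; rewrite ler01 lexx.
apply: (unit_interval_induction (P := fun t : R => dom (t *: z))).
- by rewrite scale0r.
- move=> t _ Ut.
  have n1 : nbhs t ((fun s : R => s *: z) @^-1` dom).
    apply: scalel_continuous_for.
    by apply: open_nbhs_nbhs; split; [exact: oU|exact: Ut].
  by apply: filterS n1 => s.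
move=> t t01 nU.
have zn : t *: z != 0 by apply/eqP => E; apply: nU; rewrite E.
(* If all earlier points of the ray were in the domain, [radial_extension] would add [t *: z]. So
   some [s0 *: z] with s0 < t is missing, and star-shapedness excludes every s > s0. *)
have [s0 [s01 nU0]] : exists s0, 0 <= s0 < t /\ ~ dom (s0 *: z).
  apply: contrapT => nex; apply: nU.
  apply: (radial_extension ss (z4t t t01) zn) => s /andP[sp s1].
  apply: contrapT => nUs; apply: nex; exists (s * t); rewrite -scalerA; split=> //.
  have tp : 0 < t.
    case/andP: t01 => tge0 _; rewrite lt_neqAle eq_sym tge0 andbT.
    by apply: contra zn => /eqP ->; rewrite scale0r.
  by rewrite mulr_ge0 ?(ltW tp) //= gtr_pMl.
case/andP: s01 => s00 s0t.
have n1 : \forall s \near t, s0 < s by apply: (@near_gt _ R id t s0 _ s0t); exact: cvg_id.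
apply: filterS n1 => s ss0 s01 Us; apply: nU0.
have sp : 0 < s by exact: le_lt_trans ss0.
have -> : s0 *: z = (s0 / s) *: (s *: z) by rewrite scalerA divfK ?gt_eqF.
apply: sU => //; rewrite divr_ge0 // ?(ltW sp) //=.
by rewrite ler_pdivrMr // mul1r ltW.
Qed.

End FullDisk.

(** * The Möbius disk of normal [N x0] *)

Section NormalDisk.
Context {R : realType} {S : oriented_surface R}.
Variable e : S -> 'rV[R]_(1 + 3).
Hypothesis e_imm : immersion e.
Hypothesis e_isc : inf_strictly_convex e.
Hypothesis e_quasi : quasicomplete e.
Variables (x0 : S) (v1 v2 : 'rV[R]_(1 + 3)).
Let N := unit_normal e.
Hypothesis F : orthonormal_frame (e x0) (N x0) v1 v2.
Let hgt := gauss_height e (e x0) (N x0).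
Let psi := gauss_proj e (e x0) (N x0) v1 v2.
Let ht := height (e x0) (N x0).
Implicit Types (u : 'rV[R]_3).

Definition disk_coord u : 'rV[R]_2 := null_proj (e x0) (N x0) v1 v2 (light u).
(** An open set of R^3 containing the round disk: smoothness on a subset of the sphere asks for an
    extension to an open set, and [disk_coord] makes sense wherever the height is positive, on the
    sphere or off it. *)
Definition disk_domain : set 'rV[R]_3 :=
  [set u | 0 < ht (light u) /\ disk4 (disk_coord u)].
Definition disk_section u : S := star_lift e (e x0) (N x0) v1 v2 x0 (disk_coord u).

Lemma klein_light u : klein (light u) = u.
Proof. by rewrite /klein crd_time crd_light0 invr1 scale1r /light row_mxKr. Qed.

Lemma round_disk_domain u : round_disk (N x0) u -> disk_domain u.
Proof.
move=> [bu un]; have ll := light_null bu.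
have [[pp nn _ _] [[pn _ _] [n1 n2 _]]] := F.
have lt0 : 0 < crd (light u : 'rV_4) 0 by rewrite crd_light0.
have lp := H3_null_lt0 (immersion_H3 e_imm x0) ll lt0.
(* The height is half of [<light u, N> - <light u, e>]; the first product is positive on the disk,
   and the second is negative for a future null vector. *)
have h0 : 0 < ht (light u).
  rewrite /ht /height /null_axis !mink_lin [mink (light u) (e x0)]minkC.
  by move: lp un; rewrite -/N; move: (mink _ (light u)) (mink (light u) _) => s t h1 h2; lra.
split; first exact: h0.
have hn : ht (light u) != 0 by rewrite gt_eqF.
have E := null_point_proj F ll hn.
have kN : mink (e x0 + N x0) (N x0) = 1 by rewrite mink_lin pn nn add0r.
have mN : mink (null_axis (e x0) (N x0)) (N x0) = - 2^-1.
  by rewrite /null_axis !mink_lin pn nn; lra.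
have E1 : mink (light u) (N x0) = ht (light u) * (1 - dot (disk_coord u) (disk_coord u) / 4).
  apply: etrans (congr1 (fun w => mink w (N x0)) E) _.
  rewrite minkZl -/ht; congr (_ * _).
  rewrite minkC null_point_mink [mink _ (e x0 + N x0)]minkC kN n1 n2 [mink _ (null_axis _ _)]minkC mN.
  by rewrite /disk_coord; move: (dot _ _) => s; lra.
move: un; rewrite -/N E1 pmulr_rgt0 //.
by rewrite /disk4 /=; move: (dot _ _) => s; lra.
Qed.

Lemma light_Ck k (U : set 'rV[R]_3) : open U -> Ck k U (@light R).
Proof.
move=> oU; apply: Ck_rowP => // i.
have -> : (fun u => light u 0 i) = fun u => crd (light u : 'rV_4) i.
  by apply/funext => u; rewrite -crdE.
case: i => -[|j] hj /=.
  have -> : (fun u => crd (light u : 'rV_4) 0) = fun=> 1 by apply/funext => u; exact: crd_light0.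
  exact: Ck_cst.
have -> : (fun u => crd (light u : 'rV_4) j.+1) = fun u => crd u j.
  by apply/funext => u; exact: crd_light.
by apply: Ck_crd => //; exact: Ck_id.
Qed.

Lemma light_height_Ck k (U : set 'rV[R]_3) : open U -> Ck k U (fun u => ht (light u)).
Proof.
move=> oU; apply: CkN => //; apply: Ck_mink => //; [exact: light_Ck|exact: Ck_cst].
Qed.

Lemma light_height_open : open [set u | 0 < ht (light u)].
Proof.
rewrite openE => u u0.
exact: near_gt (Ck_continuous (light_height_Ck 0 openT) (I : setT u)) u0.
Qed.

Lemma disk_coord_Ck k : Ck k [set u | 0 < ht (light u)] disk_coord.
Proof.
have oI := light_height_open.
apply: Ck_rowP => // i.
have -> : (fun u => disk_coord u 0 i) = fun u =>
    (ht (light u))^-1 * mink (light u) (if i == 0 then v1 else v2).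
  by apply/funext => u; rewrite /disk_coord /null_proj !mxE; case: ifP.
apply: CkM => //.
  apply: CkV => // [u hu|]; first by rewrite gt_eqF.
  exact: light_height_Ck.
by apply: Ck_mink => //; [exact: light_Ck|exact: Ck_cst].
Qed.

Lemma disk_coord_continuous u : 0 < ht (light u) -> {for u, continuous disk_coord}.
Proof. by move=> hu; exact: (Ck_continuous (disk_coord_Ck 0) hu). Qed.

Lemma disk_domain_open : open disk_domain.
Proof.
rewrite openE => u [hu zu]; apply: filterI.
  by apply: open_nbhs_nbhs; split; [exact: light_height_open|exact: hu].
apply: disk_coord_continuous => //.
by apply: open_nbhs_nbhs; split; [exact: disk4_open|exact: zu].
Qed.

Let lift := star_lift e (e x0) (N x0) v1 v2 x0.

Lemma star_lift_full :
  [/\ lift 0 = x0, forall z, disk4 z -> {for z, continuous lift} &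
      forall z, disk4 z -> 0 < hgt (lift z) /\ psi (lift z) = z].
Proof.
have full := star_domain_full e_imm e_isc e_quasi F.
have [[_ _ l0 _] [_ lc lP]] := star_domain_section e_imm e_isc F (star_domain0 e_imm e_isc F).
split; first exact: l0.
- by move=> z /full; exact: lc.
- by move=> z /full; exact: lP.
Qed.

Lemma disk_section_continuous u : disk_domain u -> {for u, continuous disk_section}.
Proof.
move=> [hu zu]; have [_ lc _] := star_lift_full.
exact: (continuous_comp (disk_coord_continuous hu) (lc _ zu)).
Qed.

Lemma disk_section_open x : open (disk_domain `&` disk_section @^-1` chart_dom x).
Proof.
rewrite openE => u [du xu]; apply: filterI.
  by apply: open_nbhs_nbhs; split; [exact: disk_domain_open|exact: du].
apply: (disk_section_continuous du).
by apply: open_nbhs_nbhs; split; [exact: dom_open|exact: xu].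
Qed.

Lemma disk_section_smooth x k :
  Ck k (disk_domain `&` disk_section @^-1` chart_dom x) (chart x \o disk_section).
Proof.
have [_ lc lP] := star_lift_full.
have oY : open (@disk4 R `&` lift @^-1` chart_dom x).
  rewrite openE => z [dz xz]; have o4 := @disk4_open R.
  have n1 : nbhs z (@disk4 R) by apply: open_nbhs_nbhs; split.
  have nX : nbhs (lift z) (chart_dom x).
    by apply: open_nbhs_nbhs; split; [exact: dom_open|exact: xz].
  exact: (@filterI _ _ (nbhs_filter z) _ _ n1 (lc z dz _ nX)).
have C := section_smooth e_imm e_isc F x k (@disk4_open R) lc lP.
have sub : disk_domain `&` disk_section @^-1` chart_dom x `<=` [set u | 0 < ht (light u)].
  by move=> u [[]].
apply: (Ck_comp_row (@disk_section_open x) oY _ (Ck_sub sub (disk_coord_Ck k)) C).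
by move=> u [[_ zu] xu]; split.
Qed.

(** Null vectors of nonzero height with the same coordinate are proportional, and [klein] forgets
    the factor. *)
Lemma asymptotic_gauss_section u : round_disk (N x0) u -> asymptotic_gauss e (disk_section u) = u.
Proof.
move=> du; have [hu zu] := round_disk_domain du; have [bu _] := du.
have [_ _ lP] := star_lift_full; have [hl pl] := lP _ zu.
have E1 := null_point_proj F (null_gauss_null e_imm (disk_section u)) (lt0r_neq0 hl).
have E2 := null_point_proj F (light_null bu) (lt0r_neq0 hu).
rewrite asymptotic_gaussE // -[RHS]klein_light.
apply: etrans (congr1 klein E1) _; apply: etrans _ (esym (congr1 klein E2)).
rewrite !kleinZ ?(lt0r_neq0 hl) ?(lt0r_neq0 hu) //.
by congr (klein (null_point _ _ _ _ _)); exact: pl.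
Qed.

Lemma gauss_round_disk : round_disk (N x0) (asymptotic_gauss e x0).
Proof.
split; first exact: asymptotic_gauss_boundary.
have t0 := null_gauss_time e_imm x0.
have [[_ nn en] _] := normal_facts e_imm x0 0.
rewrite -(pmulr_rgt0 _ t0) -minkZl -null_gauss_light // /null_gauss mink_lin en nn; lra.
Qed.

Lemma section_gauss : disk_section (asymptotic_gauss e x0) = x0.
Proof.
have [l0 _ _] := star_lift_full; rewrite -[RHS]l0; congr (lift _).
have t0 := lt0r_neq0 (null_gauss_time e_imm x0).
have h0 := base_height F; have p0 := base_proj F.
have hn : hgt x0 != 0 by rewrite [hgt x0]h0 oner_neq0.
have E := null_point_proj F (null_gauss_null e_imm x0) hn.
have E' : light (asymptotic_gauss e x0) =
    (null_gauss e x0 0 0)^-1 *: null_point (e x0) (N x0) v1 v2 0.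
  apply: (scalerI t0); rewrite scalerA mulfV // scale1r -null_gauss_light //.
  apply: etrans E _.
  apply: etrans (congr2 (fun a w => a *: null_point (e x0) (N x0) v1 v2 w) h0 p0) _.
  exact: scale1r.
rewrite /disk_coord E'; apply: (null_proj_point F); by rewrite invr_eq0.
Qed.

Lemma moebius_disk_normal : exists alpha,
  moebius_disk (asymptotic_gauss e) (N x0) alpha /\ (alpha @` round_disk (N x0)) x0.
Proof.
exists disk_section; split; last first.
  by exists (asymptotic_gauss e x0); [exact: gauss_round_disk|exact: section_gauss].
have [[_ nn _] _] := normal_facts e_imm x0 0.
split; [exact: nn| |exact: asymptotic_gauss_section].
split.
  apply: continuous_in_subspaceT => u; rewrite inE => du.
  exact: disk_section_continuous (round_disk_domain du).
move=> x u [du xu].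
exists (disk_domain `&` disk_section @^-1` chart_dom x), (chart x \o disk_section).
split=> //; first exact: disk_section_open.
- by split; [exact: round_disk_domain|exact: xu].
- by move=> k; exact: disk_section_smooth.
Qed.

End NormalDisk.

(** * Linear algebra of area forms *)

Section LinearAlgebra.
Context {R : realType}.

(** The coefficients b and c may differ. At [s = - (b + c)] and [t = 2 * a], where the form is
    minimal in s, its value is [a (4 (a d - b c) - (b - c)^2)]. *)
Lemma det2_pos (a b c d : R) :
  (forall s t : R, (s != 0) || (t != 0) -> 0 < s * s * a + s * t * b + t * s * c + t * t * d) ->
  0 < a * d - b * c.
Proof.
move=> H; have a0 : 0 < a.
  by have := H 1 0; rewrite oner_neq0 !(mul0r, mulr0, mul1r, addr0); apply.
have tn : (- (b + c) != 0) || (2 * a != 0) by rewrite [2 * a == 0]gt_eqF ?orbT // mulr_gt0.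
have := H _ _ tn.
have -> : - (b + c) * - (b + c) * a + - (b + c) * (2 * a) * b + 2 * a * - (b + c) * c +
  2 * a * (2 * a) * d = a * (4 * (a * d - b * c) - (b - c) ^+ 2) by ring.
rewrite pmulr_rgt0 // => h; have := sqr_ge0 (b - c).
by move: (_ ^+ 2) h => s h s0; lra.
Qed.

Lemma frame_decompose (xi : 'rV[R]_2) : xi = xi 0 0 *: frame0 + xi 0 1 *: frame1.
Proof.
apply/rowP => i; rewrite !mxE.
by case: i => -[|[|//]] hi; rewrite /= ?(mulr1, mulr0, addr0, add0r); congr (xi 0 _); apply/val_inj.
Qed.

Lemma vol3_cramer (y a b v : 'rV[R]_3) :
  vol [tuple y; a; b] *: v = vol [tuple v; a; b] *: y +
    vol [tuple y; v; b] *: a + vol [tuple y; a; v] *: b.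
Proof.
apply: rowP_crd => k k3; rewrite !(crdD, crdZ) !vol3E.
by case: k k3 => [|[|[|//]]] _; ring.
Qed.

(** Cramer's rule has a further term along y; pairing with y shows that its coefficient is 0. *)
Lemma vol3_orthogonal (y a b v : 'rV[R]_3) : dot y y = 1 -> dot y a = 0 -> dot y b = 0 ->
  dot y v = 0 -> vol [tuple y; a; b] *: v = vol [tuple y; v; b] *: a + vol [tuple y; a; v] *: b.
Proof.
move=> yy ya yb yv; rewrite {1}vol3_cramer.
suff -> : vol [tuple v; a; b] = 0 by rewrite scale0r add0r.
have := congr1 (fun w => crd y 0 * crd w 0 + crd y 1 * crd w 1 + crd y 2 * crd w 2) (vol3_cramer y a b v).
move: yy ya yb yv; rewrite /= !dot3E !(crdD, crdZ).
move: (vol _) (vol _) (vol _) (vol _) => u t s r yy ya yb yv E.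
have : s * (crd y 0 * crd y 0 + crd y 1 * crd y 1 + crd y 2 * crd y 2) =
    r * (crd y 0 * crd v 0 + crd y 1 * crd v 1 + crd y 2 * crd v 2)
    - t * (crd y 0 * crd a 0 + crd y 1 * crd a 1 + crd y 2 * crd a 2)
    - u * (crd y 0 * crd b 0 + crd y 1 * crd b 1 + crd y 2 * crd b 2) by lra.
by rewrite yy ya yb yv !mulr0 mulr1 !subr0.
Qed.

Lemma vol3_comb (y a b : 'rV[R]_3) (s0 t0 s1 t1 : R) :
  vol [tuple y; s0 *: a + t0 *: b; s1 *: a + t1 *: b] =
    (s0 * t1 - t0 * s1) * vol [tuple y; a; b].
Proof. by rewrite !vol3E !(crdD, crdZ); ring. Qed.

(** Expanding along the time axis [light 0] leaves the spatial parts. Those of a and b matter only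
    modulo y, and each of the three rows contributes a factor s. *)
Lemma vol4_time (k a b : 'rV[R]_(1 + 3)) (y a' b' : 'rV[R]_3) (s : R) :
  crd (k : 'rV_4) 0 = s ->
  (forall j, (j < 3)%N -> crd (k : 'rV_4) j.+1 = s * crd y j) ->
  (forall j, (j < 3)%N -> crd (a : 'rV_4) j.+1 = crd (a : 'rV_4) 0 * crd y j + s * crd a' j) ->
  (forall j, (j < 3)%N -> crd (b : 'rV_4) j.+1 = crd (b : 'rV_4) 0 * crd y j + s * crd b' j) ->
  vol [tuple light 0; k; a; b] = s ^+ 3 * vol [tuple y; a'; b'].
Proof.
move=> k0 kE aE bE; rewrite vol4E vol3E /= !crd_light // crd_light0 !crd0.
by rewrite !kE // !aE // !bE //; ring.
Qed.

End LinearAlgebra.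

(** * The differential of the asymptotic Gauss map *)

Section GaussMapArea.
Context {R : realType} {S : oriented_surface R}.
Variable e : S -> 'rV[R]_(1 + 3).
Hypothesis e_imm : immersion e.
Let K := null_gauss e.
Let phi := asymptotic_gauss e.
Variable x : S.
Let lam := K x 0 0.
Let dphi := differential phi x.
Let dK := differential K x.

Lemma gauss_map_crd z j : (j < 3)%N -> crd (K z : 'rV_4) j.+1 = crd (K z : 'rV_4) 0 * crd (phi z) j.
Proof.
move=> j3; apply: etrans (congr1 (fun w : 'rV[R]_(1 + 3) => crd (w : 'rV_4) j.+1)
  (null_gauss_light e_imm z)) _.
by rewrite crdZ crd_light // -crd_time.
Qed.

Lemma gauss_map_Ck y k : Ck k (chart_img y) (phi \o param y).
Proof.
have oI := @chart_img_open _ _ y; have CK := null_gauss_Ck e_imm y k.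
apply: Ck_rowP => // j.
have -> : (fun q => (phi \o param y) q 0 j) = fun q =>
    (crd (K (param y q) : 'rV_4) 0)^-1 * crd (K (param y q) : 'rV_4) j.+1.
  apply/funext => q; rewrite crdE gauss_map_crd // mulrA mulVf ?mul1r //.
  by rewrite -crd_time; exact: lt0r_neq0 (null_gauss_time e_imm _).
apply: CkM => //; last exact: (@Ck_crd _ _ 3).
apply: CkV => //; last exact: (@Ck_crd _ _ 3).
by move=> q _; rewrite -crd_time; exact: lt0r_neq0 (null_gauss_time e_imm _).
Qed.

Lemma gauss_map_differentiable : differentiable (phi \o param x) (chart x x).
Proof. exact: CkS_differentiable (gauss_map_Ck x 1) (chart_imgP (@dom_center _ _ x)). Qed.

Lemma null_gauss_differentiable : differentiable (K \o param x) (chart x x).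
Proof. exact: CkS_differentiable (null_gauss_Ck e_imm x 1) (chart_imgP (@dom_center _ _ x)). Qed.

Lemma gauss_map_differential_crd xi j : (j < 3)%N ->
  crd (dK xi : 'rV_4) j.+1 = crd (dK xi : 'rV_4) 0 * crd (phi x) j + lam * crd (dphi xi) j.
Proof.
move=> j3; have dp := gauss_map_differentiable; have dk := null_gauss_differentiable.
rewrite /dK /dphi /differential -(deriveE xi dk) -(deriveE xi dp).
have ik := derivableP (@diff_derivable _ _ _ _ _ xi dk).
have ip := derivableP (@diff_derivable _ _ _ _ _ xi dp).
move: ik ip; set a := 'D_xi _ _; set b := 'D_xi _ _ => ik ip.
have i1 := @is_derive_crd _ _ 3 _ _ _ _ j.+1 ik.
have i0 := @is_derive_crd _ _ 3 _ _ _ _ 0 ik.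
have ij := is_derive_crd j ip.
have n0 : \forall q \near chart x x,
    ((fun q => crd ((K \o param x) q : 'rV_4) j.+1) -
     (fun q => crd ((K \o param x) q : 'rV_4) 0) * (fun q => crd ((phi \o param x) q) j)) q = 0.
  by apply: near_forall => q; rewrite !fctE /= gauss_map_crd // subrr.
have := is_derive_near_cst n0 (is_deriveB i1 (is_deriveM i0 ij)).
rewrite /= chartK; last exact: dom_center.
move=> /eqP; rewrite subr_eq0 => /eqP ->.
by rewrite /lam crd_time /GRing.scale /= addrC [X in X + _]mulrC.
Qed.

(** In [<K, dK> = 0], with K a multiple lam of [light phi], the terms in the variation of lam cancel
    because phi has unit length; what remains is [lam^2] times the claim. *)
Lemma gauss_map_orthogonal xi : dot (phi x) (dphi xi) = 0.
Proof.
have bp := asymptotic_gauss_boundary e_imm x; rewrite /boundary /= dot3E in bp.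
have [[ee nn en] [[h1 h2 h3 h4] _]] := normal_facts e_imm x xi.
have E : mink (K x) (dK xi) = 0.
  have gen (p n a b : 'rV[R]_(1 + 3)) : mink a p = 0 -> mink a n = 0 -> mink b n = 0 ->
      mink b p = 0 -> mink (p + n) (a + b) = 0.
    by move=> ap an bn bp'; rewrite minkC !mink_lin ap an bn bp' !addr0.
  apply: etrans (congr1 (mink (K x)) (null_gauss_differential e_imm x xi)) _.
  exact: (gen (e x) (unit_normal e x) (differential e x xi)
    (differential (unit_normal e) x xi) h1 h2 h3 h4).
have l0 : lam != 0 := lt0r_neq0 (null_gauss_time e_imm x).
have kE j : (j < 3)%N -> crd (K x : 'rV_4) j.+1 = lam * crd (phi x) j.
  by move=> j3; rewrite gauss_map_crd // /lam crd_time.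
have k0 : crd (K x : 'rV_4) 0 = lam by rewrite /lam crd_time.
rewrite minkE !kE // k0 !gauss_map_differential_crd // in E.
have gen (l d a b c a' b' c' : R) : l != 0 -> a * a + b * b + c * c = 1 ->
    l * a * (d * a + l * a') + l * b * (d * b + l * b') + l * c * (d * c + l * c') - l * d = 0 ->
    a * a' + b * b' + c * c' = 0.
  move=> l0' n1 E'; apply: (mulfI l0'); apply: (mulfI l0'); rewrite !mulr0 -[RHS]E'.
  suff -> : l * d = l * d * (a * a + b * b + c * c) by ring.
  by rewrite n1 mulr1.
by rewrite dot3E; exact: gen l0 bp E.
Qed.

End GaussMapArea.

Section VolumeGram.
Context {R : realType}.

Lemma vol_gram4 (a b c d a' b' c' d' : 'rV[R]_(1 + 3)) :
  vol [tuple a; b; c; d] * vol [tuple a'; b'; c'; d'] =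
  - \det (\matrix_(i < 4, j < 4) mink (nth 0 [:: a; b; c; d] i) (nth 0 [:: a'; b'; c'; d'] j)).
Proof.
rewrite vol_gram; congr (- \det _); apply/matrixP => i j.
by rewrite !mxE !(tnth_nth 0).
Qed.

(** The Gram matrix factors: k pairs only with p and n, while a and b pair only with c and d. *)
Lemma vol_gram_normal (t k a b p n c d : 'rV[R]_(1 + 3)) :
  mink k p = -1 -> mink k n = 1 -> mink k c = 0 -> mink k d = 0 ->
  mink a p = 0 -> mink a n = 0 -> mink b p = 0 -> mink b n = 0 ->
  vol [tuple t; k; a; b] * vol [tuple p; n; c; d] =
  - mink t (p + n) * (mink a c * mink b d - mink a d * mink b c).
Proof.
move=> kp kn kc kd ap an bp bn; rewrite vol_gram4.
rewrite (det4F (fun i j => mink (nth 0 [:: t; k; a; b] i) (nth 0 [:: p; n; c; d] j))) /=.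
by rewrite kp kn kc kd ap an bp bn !mink_lin; ring.
Qed.

Lemma vol4_rot (p c d n : 'rV[R]_(1 + 3)) : vol [tuple p; n; c; d] = vol [tuple p; c; d; n].
Proof. by rewrite !vol4E /=; ring. Qed.

End VolumeGram.

(** * The asymptotic Gauss map preserves orientation *)

Section AreaPositive.
Context {R : realType} {S : oriented_surface R}.
Variable e : S -> 'rV[R]_(1 + 3).
Hypothesis e_imm : immersion e.
Hypothesis e_isc : inf_strictly_convex e.
Let N := unit_normal e.
Let K := null_gauss e.
Variable x : S.
Let de := differential e x.
Let dK := differential K x.

Lemma differentialD m (f : S -> 'rV[R]_m) (s t : R) a b :
  differential f x (s *: a + t *: b) = s *: differential f x a + t *: differential f x b.
Proof. by rewrite /differential linearD !linearZ. Qed.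

Lemma null_gauss_convex xi : xi != 0 -> 0 < mink (dK xi) (de xi).
Proof.
move=> xi0; have II := e_isc x xi0; have [I0 _] := fundamental_ge0 e_imm x xi.
have [_ [_ nE]] := normal_facts e_imm x xi.
have E : mink (dK xi) (de xi) = fundamental1 e x xi xi + fundamental2 e x xi xi.
  apply: etrans (congr1 (fun w => mink w (de xi)) (null_gauss_differential e_imm x xi)) _.
  by rewrite minkDl /fundamental1 /fundamental2 nE.
by rewrite E; exact: ltr_wpDl I0 II.
Qed.

Lemma null_gauss_det : 0 < mink (dK frame0) (de frame0) * mink (dK frame1) (de frame1) -
  mink (dK frame0) (de frame1) * mink (dK frame1) (de frame0).
Proof.
apply: det2_pos => s t st.
have xi0 : s *: frame0 + t *: frame1 != 0 :> 'rV[R]_2.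
  apply: contraL st => /eqP E; rewrite negb_or !negbK.
  have := congr1 (fun w : 'rV[R]_2 => w 0 0) E; have := congr1 (fun w : 'rV[R]_2 => w 0 1) E.
  by rewrite !mxE /= !mulr1 !mulr0 addr0 add0r => -> ->; rewrite eqxx.
have := null_gauss_convex xi0.
have -> : mink (dK (s *: frame0 + t *: frame1)) (de (s *: frame0 + t *: frame1)) =
    s * s * mink (dK frame0) (de frame0) + s * t * mink (dK frame0) (de frame1) +
    t * s * mink (dK frame1) (de frame0) + t * t * mink (dK frame1) (de frame1).
  rewrite /dK /de !differentialD; move: (differential _ _ _) => a.
  move: (differential _ _ _) (differential _ _ _) (differential _ _ _) => b c d.
  by rewrite !mink_lin; ring.
by [].
Qed.

(** The Gram identity ties the area A to the volume of e, its two derivatives and N, positive by the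
    choice of the normal. Their product is, up to powers of the time coordinate of K, the
    determinant of the form [<dK, de>], whose diagonal values I + II are positive. *)
Lemma gauss_area_gt0 : 0 < vol [tuple asymptotic_gauss e x;
  differential (asymptotic_gauss e) x frame0; differential (asymptotic_gauss e) x frame1].
Proof.
set A := vol _.
have l0 := null_gauss_time e_imm x.
have ex xi := normal_facts e_imm x xi.
have [[ee nn en] _] := ex 0.
have k0 : mink (K x) (e x) = -1 by rewrite minkC; exact: mink_null_gauss.
have kn : mink (K x) (N x) = 1 by rewrite /K /null_gauss mink_lin en nn add0r.
have kd xi : mink (K x) (de xi) = 0.
  have [_ [[h1 h2 _ _] _]] := ex xi.
  by rewrite minkC /K /null_gauss mink_lin; rewrite -[RHS]addr0; congr (_ + _); [exact: h1|exact: h2].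
have dKe xi : mink (dK xi) (e x) = 0 /\ mink (dK xi) (N x) = 0.
  have [_ [[h1 h2 h3 h4] _]] := ex xi.
  have E w : mink (dK xi) w = mink (de xi) w + mink (differential N x xi) w.
    apply: etrans (congr1 (fun a => mink a w) (null_gauss_differential e_imm x xi)) _.
    exact: minkDl.
  by split; rewrite E -[RHS]addr0; congr (_ + _); [exact: h1|exact: h4|exact: h2|exact: h3].
have [a0 b0] := dKe frame0; have [a1 b1] := dKe frame1.
have G := vol_gram_normal (light 0) k0 kn (kd frame0) (kd frame1) a0 b0 a1 b1.
have [_ _ _ vpos] := unit_normal_positive e_imm x.
have time (a : 'rV[R]_(1 + 3)) : mink (light 0) a = - a 0 0.
  by rewrite minkE !crd_light // crd_light0 !crd0 crd_time; ring.
have D := null_gauss_det.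
have crdK j : (j < 3)%N -> crd (K x : 'rV_4) j.+1 = K x 0 0 * crd (asymptotic_gauss e x) j.
  by move=> j3; rewrite gauss_map_crd // crd_time.
have V := vol4_time (esym (crd_time (K x))) crdK
  (gauss_map_differential_crd e_imm x frame0) (gauss_map_differential_crd e_imm x frame1).
have E : K x 0 0 ^+ 3 * A * vol [tuple e x; de frame0; de frame1; N x] =
    K x 0 0 * (mink (dK frame0) (de frame0) * mink (dK frame1) (de frame1) -
      mink (dK frame0) (de frame1) * mink (dK frame1) (de frame0)).
  rewrite -[K x 0 0 ^+ 3 * A]V -(vol4_rot (e x)); apply: etrans G _.
  by rewrite time opprK.
have P : 0 < K x 0 0 ^+ 3 * A * vol [tuple e x; de frame0; de frame1; N x].
  by rewrite E; exact: mulr_gt0 l0 D.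
have P1 : 0 < K x 0 0 ^+ 3 * A by rewrite -(pmulr_lgt0 _ vpos).
by rewrite -(pmulr_rgt0 _ (exprn_gt0 3 l0)).
Qed.

End AreaPositive.

(** * Pushing the form forward to the boundary *)

Section PushForm.
Context {R : realType} {S : oriented_surface R}.
Variable e : S -> 'rV[R]_(1 + 3).
Hypothesis e_imm : immersion e.
Hypothesis e_isc : inf_strictly_convex e.
Let phi := asymptotic_gauss e.
Variable x : S.
Let y := phi x.
Let J := jacobian (phi \o param x) (chart x x).
Let A := vol [tuple y; differential phi x frame0; differential phi x frame1].

Lemma differential_jacobian xi : differential phi x xi = xi *m J.
Proof.
have d := gauss_map_differentiable e_imm x.
by rewrite /J -(deriveEjacobian xi d) /differential -(deriveE xi d).
Qed.

(** [pinvmx J] inverts J on its row space only. Tangent vectors lie there because the images of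
    [frame0] and [frame1], having nonzero area A, span the tangent plane. *)
Lemma tangent_pinvmx v : dot y v = 0 -> differential phi x (v *m pinvmx J) = v.
Proof.
move=> yv; rewrite differential_jacobian.
have A0 : A != 0 := lt0r_neq0 (gauss_area_gt0 e_imm e_isc x).
have o0 := gauss_map_orthogonal e_imm x frame0; have o1 := gauss_map_orthogonal e_imm x frame1.
have V := vol3_orthogonal (asymptotic_gauss_boundary e_imm x) o0 o1 yv.
apply: mulmxKpV.
have E : v = (A^-1 *: (vol [tuple y; v; differential phi x frame1] *: frame0 +
    vol [tuple y; differential phi x frame0; v] *: frame1)) *m J.
  apply: (scalerI A0); rewrite -scalemxAl scalerA mulfV // scale1r mulmxDl -!scalemxAl.
  by rewrite -!differential_jacobian; exact: V.
rewrite {1}E; exact: submxMl.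
Qed.

Lemma pinvmx_vol v w : dot y v = 0 -> dot y w = 0 ->
  vol [tuple v *m pinvmx J; w *m pinvmx J] = vol [tuple y; v; w] / A.
Proof.
move=> /tangent_pinvmx hv /tangent_pinvmx hw.
have A0 : A != 0 := lt0r_neq0 (gauss_area_gt0 e_imm e_isc x).
apply: (mulIf A0); rewrite divfK //.
move: hv hw; set a := v *m _; set b := w *m _ => hv hw.
rewrite -hv -hw [a]frame_decompose [b]frame_decompose !differentialD vol3_comb.
by congr (_ * _); rewrite -!frame_decompose vol2E !crdE.
Qed.

End PushForm.

(* H3 is closed in the ambient Minkowski space, so that the closure of a
   horoball there is its closure in H3. *)
Theorem theorem1p2p2 (R : realType) (S : oriented_surface R)
    (e : S -> 'rV[R]_(1 + 3))
    (e_immersion : immersion e)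
    (e_isc : inf_strictly_convex e)
    (e_quasicomplete : quasicomplete e) (x : S) :
  let phi := asymptotic_gauss e in
  let omega := kulkarni_pinkall phi in
  closure (horoball_of (phi x) (push_form phi omega x)) (e x).
Proof.
move=> phi omega; have [pp nn en] := (normal_facts e_immersion x 0).1.
have [v1 [v2 F]] : exists v1 v2, orthonormal_frame (e x) (unit_normal e x) v1 v2.
  have [_ _ _ vpos] := unit_normal_positive e_immersion x.
  have [_ [[p0 n0 _ _] _]] := normal_facts e_immersion x frame0.
  have [_ [[p1 n1 _ _] _]] := normal_facts e_immersion x frame1.
  have sym a b : mink a b = 0 -> mink b a = 0 :> R by rewrite minkC.
  exact: exists_frame (immersion_H3 e_immersion x) nn en (sym _ _ p0) (sym _ _ p1)
    (sym _ _ n0) (sym _ _ n1) (lt0r_neq0 vpos).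
pose T := [set r | exists n alpha, [/\ moebius_disk phi n alpha,
  (alpha @` round_disk n) x & r = pullback_area phi n x frame0 frame1]].
pose A := vol [tuple phi x; differential phi x frame0; differential phi x frame1].
have A0 : 0 < A := gauss_area_gt0 e_immersion e_isc x.
have l0 := null_gauss_time e_immersion x.
(* Positivity of A bounds T below by 0; together with the element found in [TA], this makes [inf T]
   a genuine infimum. *)
have Tge0 r : T r -> 0 <= r.
  move=> [n [alpha [_ _ ->]]]; rewrite /pullback_area /hyperbolic_area.
  by rewrite divr_ge0 ?sqr_ge0 // ltW.
(* This is [<K, N> = 1] divided by the scale lam of K, so that the disk of normal N contributes
   [A * lam ^+ 2] to T. *)
have ln : mink (light (phi x)) (unit_normal e x) = (null_gauss e x 0 0)^-1.
  apply: (mulfI (lt0r_neq0 l0)); rewrite mulfV ?(lt0r_neq0 l0) // -minkZl.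
  by rewrite -(null_gauss_light e_immersion) /null_gauss mink_lin en nn add0r.
have TA : T (A * null_gauss e x 0 0 ^+ 2).
  have [alpha [md ax]] := moebius_disk_normal e_immersion e_isc e_quasicomplete F.
  exists (unit_normal e x), alpha; split; [exact: md|exact: ax|].
  by rewrite /pullback_area /hyperbolic_area ln exprVn invrK.
have i0 : 0 <= inf T by apply: lb_le_inf => //; exists (A * null_gauss e x 0 0 ^+ 2).
have i1 : inf T <= A * null_gauss e x 0 0 ^+ 2 by apply: ge_inf => //; exists 0.
(* The factor c is [inf T / A] because passing to the boundary divides the volume at [phi x] by A
   ([pinvmx_vol]); the bound [c <= lam ^+ 2] is the element [TA]. *)
apply: (closure_horoball_of (asymptotic_gauss_boundary e_immersion x)
  (immersion_H3 e_immersion x) nn en l0 (null_gauss_light e_immersion x) (c := inf T / A)).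
- by rewrite divr_ge0 // ltW.
- by rewrite ler_pdivrMr // mulrC.
- move=> v w yv yw; rewrite /push_form /omega /kulkarni_pinkall -/T.
  rewrite (pinvmx_vol e_immersion e_isc yv yw).
  by rewrite mulrAC mulrA.
Qed.
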